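(* Let $\alpha\in[1,2)$ and let $d>1$ be fixed. There exists $\varepsilon_0>0$ such that for every $\varepsilon\in(0,\varepsilon_0)$ there are a number $W_\alpha=W_\alpha(\varepsilon)\in\mathbb R$ and a simply connected domain $D_0^\varepsilon$ containing the origin and close to the disc of radius $\varepsilon$ centered at the origin (with boundary $\boldsymbol z(x)=(\varepsilon R(x)\cos x,\varepsilon R(x)\sin x)$, $R(x)=1+\varepsilon^{1+\alpha}f(x)$, $x\in[0,2\pi)$, for some $C^1$, $2\pi$-periodic function $f=f_\varepsilon$), such that the patch pair $$\vartheta_{0,\varepsilon}=\frac1{\varepsilon^2}\boldsymbol\chi_{D_0^\varepsilon}-\frac1{\varepsilon^2}\boldsymbol\chi_{D_T^\varepsilon},\qquad D_T^\varepsilon=-D_0^\varepsilon+2d\boldsymbol e_1,$$ generates a global (for all times) travelling solution of the gSQG equation, centered at $(d,0)$ and travelling in the $x_2$ direction with speed $W_\alpha$: $$\vartheta_\varepsilon(\boldsymbol x,t)=\vartheta_{0,\varepsilon}(\boldsymbol x-tW_\alpha\boldsymbol e_2).$$ Moreover $$W_\alpha=W_\alpha^*+O(\varepsilon^\alpha)\quad(\varepsilon\to0),\qquad W_\alpha^*=\frac{\alpha C_\alpha}{2(2d)^{1+\alpha}}.$$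
   Context: The gSQG equation is $\partial_t\vartheta+\mathbf v\cdot\nabla\vartheta=0$, $\mathbf v=\nabla^\perp(-\Delta)^{-1+\frac\alpha2}\vartheta$ in $\mathbb R^2$, with $(x_1,x_2)^\perp=(x_2,-x_1)$ and $(-\Delta)^{-1+\frac\alpha2}\vartheta(\boldsymbol x)=\frac{C_\alpha}{2\pi}\int_{\mathbb R^2}|\boldsymbol x-\boldsymbol y|^{-\alpha}\vartheta(\boldsymbol y)\,d\boldsymbol y$, where $C_\alpha=\frac{\Gamma(\alpha/2)}{2^{1-\alpha}\Gamma(\frac{2-\alpha}{2})}$. $\boldsymbol\chi_D$ is the characteristic function of $D$; $\boldsymbol e_1=(1,0)$, $\boldsymbol e_2=(0,1)$. Closeness of $D_0^\varepsilon$ to the disc of radius $\varepsilon$ means that the functions $f_\varepsilon$ are bounded in $C^1$ uniformly in $\varepsilon$. Meaning of travelling patch solution: the patch pair travels with velocity $W\boldsymbol e_2$ when $(\mathbf v_0(\boldsymbol x)-W\boldsymbol e_2)\cdot\mathbf n(\boldsymbol x)=0$ on $\partial D_0^\varepsilon\cup\partial D_T^\varepsilon$ ($\mathbf v_0$ the velocity generated by $\vartheta_{0,\varepsilon}$, $\mathbf n$ the normal). For $\alpha\in[1,2)$ this is understood as the following contour equation, required for all $x\in[0,2\pi)$ (all integrals being convergent). With $$N(x,y)=(R(x)R(y)+R'(x)R'(y))\sin(x-y)+(R(x)R'(y)-R'(x)R(y))\cos(x-y),$$ $$-W\left(\sin x-\frac{R'(x)}{R(x)}\cos x\right)+\frac{C_\alpha}{\varepsilon^{1+\alpha}R(x)}\cdot\frac1{2\pi}\int_0^{2\pi}\frac{N(x,y)\,dy}{\left((R(x)-R(y))^2+4R(x)R(y)\sin^2\frac{x-y}2\right)^{\alpha/2}}$$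 $$+\frac{C_\alpha}{\varepsilon R(x)}\cdot\frac1{2\pi}\int_0^{2\pi}\frac{N(x,y)\,dy}{\left((\varepsilon R(x)\cos x+\varepsilon R(y)\cos y-2d)^2+(\varepsilon R(x)\sin x+\varepsilon R(y)\sin y)^2\right)^{\alpha/2}}=0.$$ *)

(* Defs.v *)
From HB Require Import structures.
From mathcomp Require Import all_boot all_order all_algebra.
From mathcomp Require Import all_classical all_reals all_analysis.

Set Implicit Arguments.
Unset Strict Implicit.
Unset Printing Implicit Defensive.

Import Order.TTheory GRing.Theory Num.Theory.
Import numFieldNormedType.Exports.

Local Open Scope classical_set_scope.
Local Open Scope ring_scope.

(* The plane is [R * R]; its product topology is the Euclidean one. *)

Section Defs.
Context {R : realType}.

Local Notation mu := (@lebesgue_measure R).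

Definition Gamma (z : R) : R :=
  \int[mu]_(t in `]0, +oo[) (t `^ (z - 1) * expR (- t)).

Definition C_ (alpha : R) : R :=
  Gamma (alpha / 2) / (2 `^ (1 - alpha) * Gamma ((2 - alpha) / 2)).

Definition C1 (f : R -> R) : Prop :=
  (forall x, derivable f x 1) /\ continuous (derive1 f).

Definition boundary {T : topologicalType} (D : set T) : set T :=
  closure D `\` interior D.

Definition null_homotopic (D : set (R * R)) (g : R -> R * R) : Prop :=
  exists H : R * R -> R * R,
    [/\ {within `[0, 1] `*` `[0, 1], continuous H},
        {in `[0, 1] &, forall s t, D (H (s, t))},
        {in `[0, 1], forall t, H (0, t) = g t},
        {in `[0, 1], forall t, H (1, t) = g 0} &
        {in `[0, 1], forall s, H (s, 0) = g 0 /\ H (s, 1) = g 0}].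

Definition simply_connected_domain (D : set (R * R)) : Prop :=
  [/\ open D, D !=set0, connected D &
      forall g : R -> R * R,
        {within `[0, 1], continuous g} -> {in `[0, 1], forall t, D (g t)} ->
        g 0 = g 1 -> null_homotopic D g].

Definition polar_curve (eps : R) (rho : R -> R) (x : R) : R * R :=
  (eps * rho x * cos x, eps * rho x * sin x).

Definition has_polar_boundary (eps : R) (rho : R -> R) (D : set (R * R)) :=
  (forall x, 0 < rho x) /\
  boundary D = [set polar_curve eps rho x | x in `[0, 2 * pi[].

Definition companion (d : R) (D : set (R * R)) : set (R * R) :=
  [set (2 * d, 0) - y | y in D].

Definition patch_pair (d eps : R) (D : set (R * R)) (x : R * R) : R :=
  (eps ^+ 2)^-1 * \1_D x - (eps ^+ 2)^-1 * \1_(companion d D) x.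

Section Contour.
Variables (alpha d eps : R) (rho : R -> R).

Definition N_ (x y : R) : R :=
  (rho x * rho y + derive1 rho x * derive1 rho y) * sin (x - y)
  + (rho x * derive1 rho y - derive1 rho x * rho y) * cos (x - y).

Definition self_integrand (x y : R) : R :=
  N_ x y / ((rho x - rho y) ^+ 2
            + 4 * rho x * rho y * sin ((x - y) / 2) ^+ 2) `^ (alpha / 2).

Definition mutual_integrand (x y : R) : R :=
  N_ x y / ((eps * rho x * cos x + eps * rho y * cos y - 2 * d) ^+ 2
            + (eps * rho x * sin x + eps * rho y * sin y) ^+ 2) `^ (alpha / 2).

(* Up to normalisation, (v_0 - W e_2) . n at the boundary point of angle x,
   where v_0 is written as a contour integral. *)
Definition contour_lhs (W x : R) : R :=
  - W * (sin x - derive1 rho x / rho x * cos x)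
  + C_ alpha / (eps `^ (1 + alpha) * rho x)
    * ((2 * pi)^-1 * \int[mu]_(y in `[0, 2 * pi]) self_integrand x y)
  + C_ alpha / (eps * rho x)
    * ((2 * pi)^-1 * \int[mu]_(y in `[0, 2 * pi]) mutual_integrand x y).

(* [Rintegral] is total, hence the explicit integrability requirements. *)
Definition contour_equation (W : R) : Prop :=
  {in `[0, 2 * pi[, forall x,
    [/\ mu.-integrable `[0, 2 * pi] (EFin \o self_integrand x),
        mu.-integrable `[0, 2 * pi] (EFin \o mutual_integrand x) &
        contour_lhs W x = 0]}.

End Contour.

(* For 1 <= alpha < 2 the velocity has no trace on the boundary of a patch (its
   tangential part diverges), so being a solution of the gSQG equation which is
   a rigidly translating pair of patches means that the contour equation holds;
   the equation on the boundary of [companion d D] is the image of this one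
   under x |-> 2 d e_1 - x. *)
Definition travelling_patch_solution (alpha d eps W : R) (rho : R -> R)
    (D : set (R * R)) (theta : R * R -> R -> R) : Prop :=
  [/\ has_polar_boundary eps rho D,
      forall x t, theta x t = patch_pair d eps D (x - (0, t * W)) &
      contour_equation alpha d eps rho W].

End Defs.

(* Main.v *)
(* Put delta = eps^(1 + alpha), e = 2 - alpha, rho = 1 + delta f and W = C_alpha (w0 + omega),
   with f an even cosine series over frequencies n >= 2. Divided by C_alpha / rho, the contour equation
   becomes L(omega, f) + E(omega, f) = 0, where L(omega, cos (n x)) = - omega sin x + gamma_n sin (n x)
   and gamma_n > 0 is n / (2 pi) times the partial sum of the coefficients
   int_0^(2 pi) |2 sin (u/2)|^(e - 1) sin ((k + 1/2) u) du, positive and bounded below by c k^(-e).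
   Measuring f in the weighted Wiener space with weight gamma_n makes L invertible on odd sine
   series without any loss, and convolution against |2 sin (u/2)|^(- alpha) cos u of g(y) - g(x) is bounded
   on the Wiener algebra, even for g = f', precisely because the weight of g is gamma_n / n. All the nonlinear terms
   are products and binomial series in this algebra, so E is Lipschitz with a constant
   O(eps^alpha) while E(0) = c eps sin (2 x) + O(eps^2): the iteration v |-> - L^(-1) E(v)
   converges, and only the O(eps^2) part and the corrections contribute to omega, whence
   omega = O(eps^alpha). As f is even, the domain is star-shaped with a polar radius that is
   a continuous function of acos (x_1 / |x|), and a radial map onto the disc gives its topology. *)
Require Import Defs.
From HB Require Import structures.
From mathcomp Require Import all_boot all_order all_algebra.
From mathcomp Require Import all_classical all_reals all_analysis.
From mathcomp Require Import measurable_realfun ring lra.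
Import Order.TTheory GRing.Theory Num.Theory.
Import numFieldNormedType.Exports.
Local Open Scope classical_set_scope.
Local Open Scope ring_scope.

Set Implicit Arguments.
Unset Strict Implicit.
Unset Printing Implicit Defensive.

(** The exponent $1+\alpha$ in the radius is dictated by scaling: the disc exerts no
    self-interaction, whose prefactor is $\varepsilon^{-1-\alpha}$, so a perturbation of that size
    has a first variation of order 1, like $W$ and the mutual term. The obstacle is that for
    $\alpha\ge1$ the kernel $|2\sin(u/2)|^{-\alpha}\cos u$ is not integrable, and convolution
    against it costs a full weight, so an inverse of L with any loss would not close the iteration.
    The cost and the symbol are compared without computing either: one is bounded above and the
    other below by partial sums of terms of order $k^{-e}$, matched term by term. This also covers
    $\alpha=1$, where the sums are logarithmic. The symbol vanishes at frequency 1, because a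
    translated disc is a disc; omega replaces the missing unknown. The self-interaction contains the
    quotient of $f(x)-f(y)$ by $\sin((x-y)/2)$, so the algebra consists of functions of two
    variables. No Banach space is built: having norm at most M is an inductive predicate on
    functions. *)

Section Series.
Context {R : realType}.

(** [M] is any upper bound of the partial sums instead of the sum itself, so estimates can be
    enlarged without handling a limit. *)
Definition summ (m : nat -> R) (M : R) :=
  (forall k, 0 <= m k) /\ (forall n, series m n <= M).

Lemma summ_cvg m M : summ m M -> cvgn (series m).
Proof.
move=> [m0 mM]; apply: nondecreasing_is_cvgn.
  apply/nondecreasing_seqP => n; rewrite seriesSr lerDl; exact: m0.
by exists M => _ [n _ <-]; exact: mM.
Qed.

Lemma summ_is_cvg (u m : nat -> R) M :
  summ m M -> (forall k, `|u k| <= m k) -> cvgn (series u).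
Proof.
move=> h um; apply: normed_cvg; apply: (@series_le_cvg _ _ m) => //.
- by move=> k; exact: normr_ge0.
- by case: h.
- exact: summ_cvg h.
Qed.

Lemma series_norm_le (u m : nat -> R) M n :
  summ m M -> (forall k, `|u k| <= m k) -> `|series u n| <= M.
Proof.
move=> h um; apply: le_trans (proj2 h n); rewrite /series /=.
by apply: le_trans (ler_norm_sum _ _ _) _; apply: ler_sum.
Qed.

Lemma summ_norm_le (u m : nat -> R) M l :
  summ m M -> (forall k, `|u k| <= m k) -> series u @ \oo --> l -> `|l| <= M.
Proof.
move=> h um ul; rewrite -(cvg_lim _ (cvg_norm ul))//.
apply: limr_le; first by apply/cvg_ex; exists `|l|; exact: cvg_norm.
by apply: nearW => n; exact: series_norm_le h um.
Qed.

(** Dominated convergence for series: beyond some rank the majorant leaves less than e/3 for every t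
    and for the limit, and finitely many terms remain. It is meant for the filters of neighbourhoods
    and punctured neighbourhoods, to get continuity and derivatives of series. *)
Lemma tannery {T : Type} {F : set_system T} {FF : ProperFilter F}
    (u : nat -> T -> R) (l : nat -> R) (m : nat -> R) M (U : T -> R) (L : R) :
  summ m M -> (forall k t, `|u k t| <= m k) ->
  (forall k, u k @ F --> l k) ->
  (forall t, series (u^~ t) @ \oo --> U t) ->
  series l @ \oo --> L -> U @ F --> L.
Proof.
move=> h um ul uU lL; apply/cvgrPdist_le => e e0.
have lm k : `|l k| <= m k.
  rewrite -(cvg_lim _ (cvg_norm (ul k)))//; apply: limr_le.
    by apply/cvg_ex; exists `|l k|; exact: cvg_norm.
  by apply: nearW => t; exact: um.
have e30 : 0 < e / 3 by rewrite divr_gt0.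
have [n hn] : exists n, limn (series m) - series m n <= e / 3.
  have := summ_cvg h => /cvgrPdist_le /(_ _ e30) [n _ /(_ n (leqnn n)) hn].
  by exists n; apply: le_trans hn; exact: ler_norm.
have tail (v : nat -> R) w : (forall k, `|v k| <= m k) -> series v @ \oo --> w ->
    `|w - series v n| <= e / 3.
  move=> vm vw; apply: le_trans hn.
  have vw' : (fun N => series v N - series v n) @ \oo --> w - series v n.
    by apply: cvgB => //; exact: cvg_cst.
  rewrite -(cvg_lim _ (cvg_norm vw'))//; apply: limr_le.
    by apply/cvg_ex; exists `|w - series v n|; exact: cvg_norm.
  near=> N; have nN : (n <= N)%N by near: N; exact: nbhs_infty_ge.
  rewrite /series /= (big_cat_nat (leq0n n) nN)/= addrAC subrr add0r.
  apply: le_trans (ler_norm_sum _ _ _) _.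
  apply: le_trans (_ : \sum_(n <= k < N) m k <= _); first exact: ler_sum.
  rewrite lerBrDl /series /= -(big_cat_nat (leq0n n) nN)/=.
  apply: (@nondecreasing_cvgn_le _ (series m)); last exact: summ_cvg h.
  apply/nondecreasing_seqP => j; rewrite seriesSr lerDl; exact: (proj1 h).
have fin : (fun t => series (u^~ t) n) @ F --> series l n.
  elim: (n) => [|j IH].
    rewrite {2}/series /= big_geq// (_ : (fun t => _) = cst 0); first exact: cvg_cst.
    by apply/funext => t; rewrite /series /= big_geq.
  rewrite (_ : (fun t => _) = (fun t => series (u^~ t) j) \+ u j); last first.
    by apply/funext => t /=; rewrite seriesSr.
  by rewrite seriesSr; apply: cvgD => //; exact: ul.
near=> t.
have h1 := tail _ _ lm lL; have h2 := tail _ _ (um^~ t) (uU t).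
have h3 : `|series l n - series (u^~ t) n| <= e / 3.
  by near: t; move/cvgrPdist_le : fin; apply.
rewrite (_ : L - U t = (L - series l n) + (series l n - series (u^~ t) n) -
   (U t - series (u^~ t) n)); last by ring.
rewrite (le_trans (ler_normB _ _))//.
have := ler_normD (L - series l n) (series l n - series (u^~ t) n); lra.
Unshelve. all: by end_near. Qed.

End Series.

(** * Absolutely convergent spans of a weighted family of functions *)

Section Span.
Context {R : realType} {T I : Type}.
Variables (e : I -> T -> R) (w : I -> R).

Definition psum (G : nat -> T -> R) (H : T -> R) :=
  forall t, series (fun k => G k t) @ \oo --> H t.

(* Series of elements are elements again: this closure under [span_sum] plays the
   role of completeness. *)
Inductive cspan : R -> (T -> R) -> Prop :=
| span_atom i c M : `|c| * w i <= M -> cspan M (fun t => c * e i t)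
| span_sum m G H M : (forall k, cspan (m k) (G k)) ->
    (forall n, series m n <= M) -> psum G H -> cspan M H.

Hypothesis w_ge0 : forall i, 0 <= w i.

Lemma span_ge0 M g : cspan M g -> 0 <= M.
Proof.
elim=> [i c {}M|m G H {}M _ IH mM _].
  by apply: le_trans; rewrite mulr_ge0.
by have := mM 0%N; rewrite /series /= big_geq.
Qed.

Lemma span_summ m (G : nat -> T -> R) M : (forall k, cspan (m k) (G k)) ->
  (forall n, series m n <= M) -> summ m M.
Proof. by move=> h mM; split=> // k; exact: span_ge0 (h k). Qed.

Lemma span_le M M' g : cspan M g -> M <= M' -> cspan M' g.
Proof.
case=> [i c {}M hM|m G H {}M h mM GH] MM'; first by apply: span_atom; apply: le_trans MM'.
by apply: (@span_sum m G) => // n; apply: le_trans MM'.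
Qed.

Lemma span_ext M g g' : cspan M g -> g =1 g' -> cspan M g'.
Proof. by move=> h gg'; rewrite -(funext gg'). Qed.

Lemma span_scale c M g : cspan M g -> cspan (`|c| * M) (fun t => c * g t).
Proof.
elim=> [i a {}M hM|m G H {}M _ IH mM GH].
  apply: (@span_ext _ (fun t => (c * a) * e i t)); last by move=> t; rewrite mulrA.
  by apply: span_atom; rewrite normrM -mulrA ler_wpM2l.
apply: (@span_sum (fun k => `|c| * m k) (fun k t => c * G k t)) => //.
  by move=> n; rewrite /series /= -mulr_sumr ler_wpM2l//; exact: mM.
move=> t; rewrite (_ : series _ = (fun n => c * series (G^~ t) n)); last first.
  by apply/funext => n; rewrite /series /= mulr_sumr.
by apply: cvgMr => //; exact: GH.
Qed.

Lemma span_opp M g : cspan M g -> cspan M (fun t => - g t).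
Proof.
move=> h; have := span_scale (-1) h; rewrite normrN1 mul1r => h'.
by apply: (span_ext h') => t; rewrite mulN1r.
Qed.

Hypothesis i0 : I.

Lemma span0 M : 0 <= M -> cspan M (fun=> 0).
Proof.
move=> M0; apply: (@span_ext _ (fun t => 0 * e i0 t)).
  by apply: span_atom; rewrite normr0 mul0r.
by move=> t; rewrite mul0r.
Qed.

(** Series are the only combination offered by [cspan], so the sum of two elements is obtained as
    the series g, g', 0, 0, ... *)
Lemma span_add M M' g g' : cspan M g -> cspan M' g' ->
  cspan (M + M') (fun t => g t + g' t).
Proof.
move=> h h'.
pose m k := if k is k'.+1 then if k' is _.+1 then 0 else M' else M.
pose G k := if k is k'.+1 then if k' is _.+1 then (fun=> 0) else g' else g.
have S (V : zmodType) (a b : V) (u := fun k => if k is k'.+1 then if k' is _.+1 then 0 else b else a) n :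
    series u n = if n is n'.+1 then if n' is _.+1 then a + b else a else 0.
  case: n => [|[|n]]; first by rewrite /series /= big_geq.
    by rewrite /series /= big_nat1.
  elim: n => [|n IH]; first by rewrite /series /= big_nat_recr//= big_nat1.
  by rewrite seriesSr /= IH addr0.
apply: (@span_sum m G) => //.
- by case=> [|[|k]] //=; exact: span0.
- have M0 := span_ge0 h; have M'0 := span_ge0 h'.
  move=> n; rewrite S; case: n => [|[|n]] //; first exact: addr_ge0.
  by rewrite lerDl.
- move=> t; rewrite -(cvg_shiftn 2); apply: cvg_near_cst; apply: nearW => n.
  have := S R (g t) (g' t) (n + 2)%N; rewrite addn2 /= => <-.
  by rewrite addn2 /series /=; apply: eq_bigr => -[|[|k]].
Qed.

Lemma span_sub M M' g g' : cspan M g -> cspan M' g' ->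
  cspan (M + M') (fun t => g t - g' t).
Proof. by move=> h h'; apply: (span_add h); exact: span_opp. Qed.

(** A bound of the evaluation at [t] on the atoms, relative to their weights, passes to the whole
    span with the same constant. *)
Lemma span_bound K t M g : 0 <= K -> (forall i, `|e i t| <= K * w i) ->
  cspan M g -> `|g t| <= K * M.
Proof.
move=> K0 eK; elim=> [i c {}M hM|m G H {}M hG IH mM GH].
  rewrite normrM (le_trans (ler_wpM2l _ (eK i)))//.
  by rewrite mulrCA ler_wpM2l.
have h := span_summ hG mM.
apply: (@summ_norm_le _ (fun k => G k t) (fun k => K * m k)) => //.
split=> [k|n]; first by rewrite mulr_ge0//; case: h.
by rewrite /series /= -mulr_sumr ler_wpM2l//; exact: mM.
Qed.

Lemma span_cvg K t m (G : nat -> T -> R) M : 0 <= K -> (forall i, `|e i t| <= K * w i) ->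
  (forall k, cspan (m k) (G k)) -> (forall n, series m n <= M) ->
  cvgn (series (fun k => G k t)).
Proof.
move=> K0 eK hG mM.
apply: (@summ_is_cvg _ _ (fun k => K * m k) (K * M)); last first.
  by move=> k; exact: span_bound (hG k).
split=> [k|n]; first by rewrite mulr_ge0//; exact: span_ge0 (hG k).
by rewrite /series /= -mulr_sumr ler_wpM2l//; exact: mM.
Qed.

End Span.

Section Transfer.
Context {R : realType} {T I T' I' : Type}.
Variables (e : I -> T -> R) (w : I -> R) (e' : I' -> T' -> R) (w' : I' -> R).

(** A bounded operator is known from its atoms. Linearity is replaced by the two facts that the
    induction meets: compatibility with the series of the source span, and a bound on each scalar
    multiple of an atom. *)
Lemma span_transfer (Op : (T -> R) -> (T' -> R)) (C : R) :
  0 <= C ->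
  (forall m G H M, (forall k, cspan e w (m k) (G k)) -> (forall n, series m n <= M) ->
     psum G H -> psum (fun k => Op (G k)) (Op H)) ->
  (forall i c, cspan e' w' (C * (`|c| * w i)) (Op (fun t => c * e i t))) ->
  forall M g, cspan e w M g -> cspan e' w' (C * M) (Op g).
Proof.
move=> C0 hs ha M g; elim=> [i c {}M hM|m G H {}M hG IH mM GH].
  by apply: (span_le (ha i c)); rewrite ler_wpM2l.
apply: (@span_sum _ _ _ e' w' (fun k => C * m k) (fun k => Op (G k))) => //.
  by move=> n; rewrite /series /= -mulr_sumr ler_wpM2l//; exact: mM.
exact: hs GH.
Qed.

End Transfer.

(** * The Wiener algebra of the torus *)

Section Wiener.
Context {R : realType}.

(** The free real phase yields sines as well as cosines and makes the family stable, up to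
    constants, under products and shifts. *)
Definition wa_e (i : int * int * R) (t : R * R) : R :=
  cos (i.1.1%:~R * t.1 + i.1.2%:~R * t.2 + i.2).

Definition WA : R -> (R * R -> R) -> Prop := cspan wa_e (fun=> 1).

Let wa1 (i : int * int * R) : 0 <= 1 :> R. Proof. exact: ler01. Qed.
Let wa0 : int * int * R := (0, 0, 0).

Lemma WA_ge0 M G : WA M G -> 0 <= M.
Proof. exact: span_ge0. Qed.

Lemma WA_le M M' G : WA M G -> M <= M' -> WA M' G.
Proof. exact: span_le. Qed.

Lemma WA_ext M G G' : WA M G -> G =1 G' -> WA M G'.
Proof. exact: span_ext. Qed.

Lemma WA_add M M' G G' : WA M G -> WA M' G' -> WA (M + M') (fun t => G t + G' t).
Proof. exact: (span_add wa1 wa0). Qed.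

Lemma WA_sub M M' G G' : WA M G -> WA M' G' -> WA (M + M') (fun t => G t - G' t).
Proof. exact: (span_sub wa1 wa0). Qed.

Lemma WA_opp M G : WA M G -> WA M (fun t => - G t).
Proof. exact: span_opp. Qed.

Lemma WA_scale c M G : WA M G -> WA (`|c| * M) (fun t => c * G t).
Proof. exact: span_scale. Qed.

Lemma WA_zero M : 0 <= M -> WA M (fun=> 0).
Proof. exact: (span0 _ _ wa0). Qed.

Lemma WA_cos (p q : int) psi : WA 1 (fun t => cos (p%:~R * t.1 + q%:~R * t.2 + psi)).
Proof.
apply: (@WA_ext _ (fun t => 1 * wa_e (p, q, psi) t)); last by move=> t; rewrite mul1r.
by apply: span_atom; rewrite normr1 mulr1.
Qed.

Lemma WA_cst c : WA `|c| (fun=> c).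
Proof.
apply: (@WA_ext _ (fun t => c * wa_e (0, 0, 0) t)).
  by apply: span_atom; rewrite mulr1.
by move=> t; rewrite /wa_e /= !mul0r !addr0 cos0 mulr1.
Qed.

Lemma WA_bound M G t : WA M G -> `|G t| <= M.
Proof.
move=> h; rewrite -[M]mul1r; apply: (span_bound wa1) h => //.
by move=> i; rewrite mul1r /wa_e ler_norml cos_geN1 cos_le1.
Qed.

Lemma cosM_sum (a b : R) : cos a * cos b = 2^-1 * cos (a + b) + 2^-1 * cos (a - b).
Proof. by rewrite cosD cosB; field. Qed.

(** Nested inductions reduce to two atoms, whose product is the half sum of two atoms; hence no loss
    in the constant. *)
Lemma WA_mul M M' G G' : WA M G -> WA M' G' -> WA (M * M') (fun t => G t * G' t).
Proof.
move=> h; elim: h M' G' => {M G} [i c M hM|m G H M hG IH mM GH] M' G' h'; last first.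
  have M'0 := WA_ge0 h'.
  apply: (@span_sum _ _ _ _ _ (fun k => m k * M') (fun k t => G k t * G' t)).
  - by move=> k; exact: IH.
  - by move=> n; rewrite /series /= -mulr_suml ler_wpM2r//; exact: mM.
  - move=> t; rewrite (_ : series _ = (fun n => series (G^~ t) n * G' t)); last first.
      by apply/funext => n; rewrite /series /= mulr_suml.
    by apply: cvgMl; exact: GH.
apply: (@WA_le (`|c| * M')); last first.
  by rewrite ler_wpM2r ?(WA_ge0 h')//; move: hM; rewrite mulr1.
apply: (@WA_ext _ (fun t => c * (wa_e i t * G' t))); last by move=> t; rewrite mulrA.
apply: WA_scale.
elim: h' => {M' G'} [j a M' hM'|m G H M' hG IH mM GH]; last first.
  apply: (@span_sum _ _ _ _ _ m (fun k t => wa_e i t * G k t)) => // t.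
  rewrite (_ : series _ = (fun n => wa_e i t * series (G^~ t) n)); last first.
    by apply/funext => n; rewrite /series /= mulr_sumr.
  by apply: cvgMr; exact: GH.
apply: (@WA_le (`|a| * (`|2^-1| * 1 + `|2^-1| * 1))); last first.
  by rewrite mulr1 in hM'; rewrite ger0_norm; [lra|rewrite invr_ge0; lra].
case: i j => -[p q] ps -[[p' q'] ps'].
apply: (@WA_ext _ (fun t => a *
  (2^-1 * cos ((p + p')%:~R * t.1 + (q + q')%:~R * t.2 + (ps + ps')) +
   2^-1 * cos ((p - p')%:~R * t.1 + (q - q')%:~R * t.2 + (ps - ps'))))).
  by apply: WA_scale; apply: WA_add; apply: WA_scale; exact: WA_cos.
move=> t; rewrite /wa_e /= mulrCA cosM_sum; congr (_ * (_ * cos _ + _ * cos _)).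
  by rewrite !intrD; ring.
by rewrite !intrB; ring.
Qed.

Lemma WA_exp r s k : WA r s -> WA (r ^+ k) (fun t => s t ^+ k).
Proof.
move=> h; elim: k => [|k IH].
  by have := WA_cst 1; rewrite normr1 expr0.
apply: (@WA_ext _ (fun t => s t * s t ^+ k)); last by move=> t; rewrite exprS.
by rewrite exprS; exact: WA_mul.
Qed.

Lemma WA_comp (h : R * R -> R * R) :
  (forall i, exists j, forall t, wa_e i (h t) = wa_e j t) ->
  forall M G, WA M G -> WA M (fun t => G (h t)).
Proof.
move=> hh M G hG; rewrite -[M]mul1r.
apply: (@span_transfer _ _ _ _ _ wa_e (fun=> 1) wa_e (fun=> 1) (fun G t => G (h t)) 1) => //.
- by move=> m G' H M' _ _ GH t; exact: GH.
- move=> i c; have [j hj] := hh i.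
  apply: (@span_ext _ _ _ _ _ _ (fun t => c * wa_e j t)).
    by apply: span_atom; rewrite mul1r.
  by move=> t; rewrite hj.
Qed.

Lemma WA_snd M G : WA M G -> WA M (fun t => G (t.2, 0)).
Proof.
apply: WA_comp => -[[p q] ps]; exists (0, p, ps) => t.
by rewrite /wa_e /= mulr0 mul0r addr0 add0r.
Qed.

Lemma cosD2piZ (a : R) (p : int) : cos (a + p%:~R * (2 * pi)) = cos a.
Proof.
have c2 (c : R) : cos (c + 2 * pi) = cos c by rewrite mulr_natl cosD2pi.
have pn (n : nat) (b : R) : cos (b + n%:R * (2 * pi)) = cos b.
  elim: n b => [|n IH] b; first by rewrite mul0r addr0.
  rewrite -[n.+1%:R]natr1 mulrDl mul1r addrA.
  by rewrite c2.
case: p => n; first exact: pn.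
rewrite NegzE mulrNz mulNr -[in RHS](subrK (n.+1%:R * (2 * pi)) a).
by rewrite pn.
Qed.

Lemma WA_periodic M G x y (p q : int) : WA M G ->
  G (x + p%:~R * (2 * pi), y + q%:~R * (2 * pi)) = G (x, y).
Proof.
elim=> {M G} [[[k l] ps] c M hM|m G H M hG IH mM GH].
  rewrite /wa_e /=; congr (_ * _).
  rewrite -[RHS](cosD2piZ _ (k * p + l * q)); congr cos.
  by rewrite intrD !intrM; ring.
apply: (@cvg_unique _ _ (series (fun k => G k (x, y)) @ \oo)) => //; last exact: GH.
rewrite (_ : (fun k => G k (x, y)) =
  (fun k => G k (x + p%:~R * (2 * pi), y + q%:~R * (2 * pi)))); first exact: GH.
by apply/funext => k; rewrite IH.
Qed.

(* [G1] and [G2] are the values of one nonlinear expression at two unknowns whose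
   distance is [m]. *)
Definition WP (m k : R) (G1 G2 : R * R -> R) :=
  [/\ WA k G1, WA k G2 & WA (k * m) (fun t => G1 t - G2 t)].

Section Pairs.
Variables (m : R) (m0 : 0 <= m).

Lemma WP_ge0 k G1 G2 : WP m k G1 G2 -> 0 <= k.
Proof. by case=> /WA_ge0. Qed.

Lemma WP_le k k' G1 G2 : WP m k G1 G2 -> k <= k' -> WP m k' G1 G2.
Proof.
move=> [h1 h2 h3] kk'; split; [exact: WA_le h1 _|exact: WA_le h2 _|].
by apply: WA_le h3 _; rewrite ler_wpM2r.
Qed.

Lemma WP_ext k G1 G2 G1' G2' : WP m k G1 G2 -> G1 =1 G1' -> G2 =1 G2' -> WP m k G1' G2'.
Proof. by move=> h /funext <- /funext <-. Qed.

Lemma WP_same k G : WA k G -> WP m k G G.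
Proof.
move=> h; split=> //; apply: (@WA_ext _ (fun=> 0)); last by move=> t; rewrite subrr.
by apply: WA_zero; rewrite mulr_ge0// (WA_ge0 h).
Qed.

Lemma WP_cst c : WP m `|c| (fun=> c) (fun=> c).
Proof. exact/WP_same/WA_cst. Qed.

Lemma WP_add k k' G1 G2 G1' G2' : WP m k G1 G2 -> WP m k' G1' G2' ->
  WP m (k + k') (fun t => G1 t + G1' t) (fun t => G2 t + G2' t).
Proof.
move=> [h1 h2 h3] [h1' h2' h3']; split; [exact: WA_add|exact: WA_add|].
rewrite mulrDl; apply: WA_ext; first by apply: WA_add; [exact: h3|exact: h3'].
by move=> t /=; ring.
Qed.

Lemma WP_scale c k G1 G2 : WP m k G1 G2 ->
  WP m (`|c| * k) (fun t => c * G1 t) (fun t => c * G2 t).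
Proof.
move=> [h1 h2 h3]; split; [exact: WA_scale|exact: WA_scale|].
rewrite -mulrA; apply: WA_ext; first by apply: WA_scale; exact: h3.
by move=> t /=; ring.
Qed.

Lemma WP_sub k k' G1 G2 G1' G2' : WP m k G1 G2 -> WP m k' G1' G2' ->
  WP m (k + k') (fun t => G1 t - G1' t) (fun t => G2 t - G2' t).
Proof.
move=> h /(WP_scale (-1)); rewrite normrN1 mul1r => h'.
by apply: WP_ext (WP_add h h') _ _ => t /=; rewrite mulN1r.
Qed.

(** The factor 2 comes from the difference, which splits as G1 (G1' - G2') + (G1 - G2) G2'. *)
Lemma WP_mul k k' G1 G2 G1' G2' : WP m k G1 G2 -> WP m k' G1' G2' ->
  WP m (2 * k * k') (fun t => G1 t * G1' t) (fun t => G2 t * G2' t).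
Proof.
move=> h h'; have k0 := WP_ge0 h; have k'0 := WP_ge0 h'; have kk := mulr_ge0 k0 k'0.
case: h => h1 h2 h3; case: h' => h1' h2' h3'; split.
- by apply: WA_le (WA_mul h1 h1') _; lra.
- by apply: WA_le (WA_mul h2 h2') _; lra.
apply: (@WA_le (k * (k' * m) + k * m * k')); last by lra.
apply: WA_ext; first by apply: WA_add (WA_mul h1 h3') (WA_mul h3 h2').
by move=> t /=; ring.
Qed.

Lemma WP_sum k (G1 G2 : nat -> R * R -> R) K H1 H2 :
  (forall n, WP m (k n) (G1 n) (G2 n)) -> (forall n, series k n <= K) ->
  psum G1 H1 -> psum G2 H2 -> WP m K H1 H2.
Proof.
move=> h kK GH1 GH2; split.
- by apply: (@span_sum _ _ _ _ _ k G1) => // n; case: (h n).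
- by apply: (@span_sum _ _ _ _ _ k G2) => // n; case: (h n).
apply: (@span_sum _ _ _ _ _ (fun n => k n * m) (fun n t => G1 n t - G2 n t)).
- by move=> n; case: (h n).
- by move=> n; rewrite /series /= -mulr_suml ler_wpM2r//; exact: kK.
- move=> t; rewrite (_ : series _ = (fun n => series (G1^~ t) n - series (G2^~ t) n)).
    by apply: cvgB; [exact: GH1|exact: GH2].
  by apply/funext => n; rewrite /series /= sumrB.
Qed.

(** The difference of two k-th powers is a sum of k products, each with one factor s1 - s2; this is
    the origin of the coefficient k. *)
Lemma WP_exp r s1 s2 k : WP m r s1 s2 -> (0 < k)%N ->
  WP m (k%:R * r ^+ k) (fun t => s1 t ^+ k) (fun t => s2 t ^+ k).
Proof.
move=> h; have r0 := WP_ge0 h; case: h => h1 h2 h3 k0.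
have rk : r ^+ k <= k%:R * r ^+ k by rewrite ler_peMl ?exprn_ge0 ?ler1n.
split; [exact: WA_le (WA_exp k h1) _|exact: WA_le (WA_exp k h2) _|].
elim: k {k0 rk} => [|k IH].
  apply: (@WA_ext _ (fun=> 0)); first by rewrite !mul0r; exact: WA_zero.
  by move=> t; rewrite !expr0 subrr.
apply: (@WA_le (r * (k%:R * r ^+ k * m) + r * m * r ^+ k)); last first.
  by rewrite -natr1 exprS le_eqVlt; apply/orP; left; apply/eqP; ring.
apply: WA_ext; first by apply: WA_add (WA_mul h1 IH) (WA_mul h3 (WA_exp k h2)).
by move=> t /=; rewrite !exprS; ring.
Qed.

End Pairs.

End Wiener.

(** * The binomial series of exponent $-\beta$ and its remainders *)

Section Binomial.
Context {R : realType}.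
Variables (beta : R) (beta0 : 0 <= beta) (beta1 : beta <= 1).

(** The binomial coefficient $\binom{-\beta}{k}$. For $0\le\beta\le1$ its absolute value never
    exceeds 1. *)
Fixpoint binc (k : nat) : R :=
  if k is k'.+1 then - (binc k' * (beta + k'%:R) / k%:R) else 1.

Lemma binc_le1 k : `|binc k| <= 1.
Proof.
elim: k => [|k IH] /=; first by rewrite normr1.
have k0 : 0 <= beta + k%:R by rewrite addr_ge0.
rewrite normrN normrM normfV normrM (ger0_norm k0) (gtr0_norm (ltr0Sn _ k)).
rewrite ler_pdivrMr ?ltr0Sn// mul1r (le_trans (ler_piMl k0 IH))//.
by rewrite -natr1 addrC lerD2l.
Qed.

Lemma binc_diffs k : pseries_diffs binc k + k%:R * binc k = - (beta * binc k).
Proof. by rewrite /pseries_diffs /=; field; rewrite addrC natr1 pnatr_eq0. Qed.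

Lemma leq_exp2 k : (k.+1 <= 2 ^ k)%N.
Proof. exact: ltn_expl. Qed.

Lemma cvg_pseries_exp4 (c : nat -> R) :
  (forall k, `|c k| <= 2 * 4 ^+ k) -> cvgn (pseries c 8^-1).
Proof.
move=> hc; apply: normed_cvg.
apply: (@series_le_cvg _ _ (geometric 2 2^-1)) => [k|k|k|].
- exact: normr_ge0.
- by rewrite /geometric /= mulr_ge0// exprn_ge0// invr_ge0.
- rewrite /geometric /= normrM normrX.
  apply: (@le_trans _ _ (2 * 4 ^+ k * `|8^-1| ^+ k)).
    by rewrite ler_wpM2r ?exprn_ge0.
  rewrite -mulrA -exprMn ger0_norm ?invr_ge0//.
  by rewrite (_ : 4 * 8^-1 = 2^-1)//; field.
- by apply: is_cvg_geometric_series; rewrite ger0_norm ?invr_ge0// invf_lt1 ?ltr1n.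
Qed.

(** These are the three convergences required for differentiating a power series term by term. At
    1/8, coefficients bounded by 2 * 4^k give a geometric series of ratio 1/2, and 4^k absorbs the
    factors (k+1)(k+2). *)
Lemma binc_cvg3 : [/\ cvgn (pseries binc 8^-1), cvgn (pseries (pseries_diffs binc) 8^-1) &
  cvgn (pseries (pseries_diffs (pseries_diffs binc)) 8^-1)].
Proof.
have e4 k : 1 <= 4 ^+ k :> R by rewrite exprn_ege1 ?ler1n.
have e2 k : k.+1%:R <= 2 ^+ k :> R by rewrite -natrX ler_nat leq_exp2.
have e24 k : 2 ^+ k <= 4 ^+ k :> R by rewrite lerXn2r ?nnegrE ?ler_nat.
split; apply: cvg_pseries_exp4 => k.
- by have := binc_le1 k; have := e4 k; lra.
- rewrite /pseries_diffs normrM (ger0_norm (ler0n _ _)).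
  apply: (@le_trans _ _ (k.+1%:R * 1)); first by rewrite ler_wpM2l// binc_le1.
  by have := e2 k; have := e24 k; have := e4 k; lra.
rewrite /pseries_diffs !normrM !(ger0_norm (ler0n _ _)) mulrA.
apply: (@le_trans _ _ (k.+1%:R * k.+2%:R * 1)); first by rewrite ler_wpM2l ?binc_le1// mulr_ge0.
rewrite mulr1 (_ : 2 * 4 ^+ k = 2 ^+ k * 2 ^+ k.+1); last first.
  by rewrite exprS (_ : 4 = 2 * 2 :> R) ?exprMn; [ring|lra].
by rewrite ler_pM.
Qed.

(** The sum g of the series satisfies (1 + x) g' = - beta g, so g(x) (1 + x)^beta has zero
    derivative and keeps its value 1 at 0. *)
Lemma binomial_series s : `|s| < 8^-1 ->
  series (fun k => binc k * s ^+ k) @ \oo --> (1 + s) `^ (- beta).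
Proof.
move=> s8; have [c0 c1 c2] := binc_cvg3.
have i8 : `|8^-1| = 8^-1 :> R by rewrite ger0_norm ?invr_ge0.
pose g x := limn (pseries binc x).
have g' x : `|x| < 8^-1 -> is_derive x (1:R) g (limn (pseries (pseries_diffs binc) x)).
  by move=> x8; apply: (pseries_snd_diffs c0 c1 c2); rewrite i8.
have gc x : `|x| < 8^-1 -> cvgn (pseries binc x).
  by move=> x8; apply: (is_cvg_pseries_inside c0); rewrite i8.
have gc' x : `|x| < 8^-1 -> cvgn (pseries (pseries_diffs binc) x).
  by move=> x8; apply: (is_cvg_pseries_inside c1); rewrite i8.
have ode x : `|x| < 8^-1 -> (1 + x) * limn (pseries (pseries_diffs binc) x) = - (beta * g x).
  move=> x8; rewrite mulrDl mul1r.
  have e1 := pseries_diffs_equiv (gc' _ x8).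
  have e2 : x * limn (pseries (pseries_diffs binc) x) =
      limn (series (fun k => k%:R * binc k * x ^+ k)).
    apply/esym/cvg_lim => //.
    rewrite (_ : series _ = (fun n => x * series (fun i => i%:R * binc i * x ^+ i.-1) n)).
      by apply: cvgMr.
    apply/funext => n; rewrite /series /= mulr_sumr; apply: eq_bigr => -[|i] _.
      by rewrite !mul0r mulr0.
    by rewrite /= exprS; ring.
  rewrite e2 -limD; last 2 first.
  - exact: gc'.
  - apply/cvg_ex; exists (x * limn (pseries (pseries_diffs binc) x)).
    rewrite (_ : series _ = (fun n => x * series (fun i => i%:R * binc i * x ^+ i.-1) n)).
      by apply: cvgMr.
    apply/funext => n; rewrite /series /= mulr_sumr; apply: eq_bigr => -[|i] _.
      by rewrite !mul0r mulr0.
    by rewrite /= exprS; ring.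
  rewrite -mulNr; apply: cvg_lim => //.
  rewrite (_ : _ + _ = (fun n => - beta * pseries binc x n)).
    by apply: cvgMr; exact: gc.
  apply/funext => n; rewrite /pseries /series /= mulr_sumr.
  rewrite -[LHS]big_split /=; apply: eq_bigr => i _.
  by rewrite -mulrDl binc_diffs; ring.
pose h x := g x * (1 + x) `^ beta.
have h' x : `|x| < 8^-1 -> is_derive x (1:R) h 0.
  move=> x8; have x1 : 0 < 1 + x.
    by move: x8; rewrite ltr_norml => /andP[? _]; lra.
  have dp : is_derive x (1:R) (fun x => (1 + x) `^ beta) (beta * (1 + x) `^ (beta - 1)).
    have := @is_derive1_comp R (fun y : R => y `^ beta) (fun x : R => 1 + x) x (beta * (1 + x) `^ (beta - 1)) 1 (is_derive1_powR _ x1).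
    rewrite mulr1; apply.
    by rewrite -[X in is_derive _ _ _ X]add0r; exact: (is_deriveD (is_derive_cst (1:R) x 1) (is_derive_id x 1)).
  have dg := g' _ x8.
  apply: (is_derive_eq (is_deriveM dg dp)).
  have e : (1 + x) `^ beta = (1 + x) * (1 + x) `^ (beta - 1).
    rewrite -{2}(powRr1 (ltW x1)) -powRD; first by congr (_ `^ _); ring.
    by rewrite (gt_eqF x1) implybT.
  rewrite /GRing.scale /= e.
  have od := ode x x8; rewrite [X in _ + X = _]mulrAC od; ring.
have hs : h s = h 0.
  have seg a b : a <= b -> `|a| < 8^-1 -> `|b| < 8^-1 -> h b = h a.
    move=> ab a8 b8; have abx x : x \in `[a, b] -> `|x| < 8^-1.
      rewrite in_itv /= => /andP[ax xb]; move: a8 b8; rewrite !ltr_norml => /andP[? ?] /andP[? ?].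
      by apply/andP; split; lra.
    have [] := @MVT_segment _ h (fun=> 0) a b ab.
    - by move=> x xab; apply: h'; apply: abx; exact: subset_itv_oo_cc xab.
    - apply: derivable_within_continuous => x xab.
      by have := h' x (abx _ xab) => -[].
    by move=> c _ /eqP; rewrite mul0r subr_eq0 => /eqP.
  have z8 : `|0 : R| < 8^-1 by rewrite normr0 invr_gt0.
  by have [s0|/ltW s0] := leP 0 s; [exact: seg|apply/esym; exact: seg].
have g0 : g 0 = 1.
  apply: cvg_lim => //; rewrite -(cvg_shiftS _) /=; apply: cvg_near_cst.
  apply: nearW => n; rewrite /pseries /series /= big_nat_recl// expr0 mulr1.
  by rewrite big1 ?addr0// => i _; rewrite exprS mul0r mulr0.
have h0 : h 0 = 1 by rewrite /h g0 addr0 powR1 mulr1.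
have s1 : 0 < 1 + s by move: s8; rewrite ltr_norml => /andP[? _]; lra.
suff -> : (1 + s) `^ (- beta) = g s by exact: gc.
move: hs; rewrite h0 /h powRN => e; apply: (mulIf (lt0r_neq0 (powR_gt0 beta s1))).
by rewrite e mulVf// lt0r_neq0// powR_gt0.
Qed.

Definition binrem (j : nat) (s : R) : R :=
  (1 + s) `^ (- beta) - \sum_(k < j) binc k * s ^+ k.

Lemma binrem_psum j s : `|s| < 8^-1 ->
  series (fun k => if (k < j)%N then 0 else binc k * s ^+ k) @ \oo --> binrem j s.
Proof.
move=> s8; have := binomial_series s8.
rewrite -(cvg_shiftn j (series (fun k => binc k * s ^+ k))) => h.
rewrite -(cvg_shiftn j (series (fun k => if (k < j)%N then 0 else _))) /binrem.
rewrite (_ : (fun n => _) = (fun n => series (fun k => binc k * s ^+ k) (n + j)%N -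
   \sum_(k < j) binc k * s ^+ k)).
  by apply: (cvgB h); exact: cvg_cst.
apply/funext => n; rewrite /series /= !(big_cat_nat (leq0n j) (leq_addl n j)) /=.
rewrite big_nat_cond big1 ?add0r; last by move=> i /andP[/andP[_ ->]].
rewrite big_mkord [X in X - _]addrC addrK big_nat_cond [RHS]big_nat_cond.
by apply: eq_bigr => i /andP[/andP[ji _] _]; rewrite ltnNge ji.
Qed.

Lemma geo_tail_le (q : R) j n : 0 <= q <= 2^-1 ->
  series (fun k => if (k < j)%N then 0 else q ^+ k) n <= 2 * q ^+ j.
Proof.
move=> /andP[q0 q1].
have qj k : 0 <= q ^+ k by exact: exprn_ge0.
(* The subtracted term makes the induction work: q at most 1/2 gives 2 q^(n+1) <= q^n, so adding q^n
   preserves the bound. *)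
suff : series (fun k => if (k < j)%N then 0 else q ^+ k) n <=
   if (j <= n)%N then 2 * q ^+ j - 2 * q ^+ n else 0.
  by have := qj j; have := qj n; case: ifP => _; lra.
elim: n => [|n IH].
  rewrite /series /= big_geq//; case: ifP => //.
  by rewrite leqn0 => /eqP ->; rewrite subrr.
rewrite seriesSr; have := qj n; have := ler_wpM2r (qj n) q1; rewrite -exprS.
case: (ltnP n j) IH => [nj|jn] IH.
  by case: ifP => [jn|_] _ _; rewrite addr0// (_ : n.+1 = j) ?subrr//; apply/eqP; rewrite eqn_leq nj jn.
by rewrite leqW//; lra.
Qed.

(** Since k <= 2^k, the Lipschitz bounds k r^k are dominated by (2r)^k, a geometric sequence of
    ratio at most 1/8. The bound 1/16 on r also keeps all values inside the disc where the binomial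
    series is available. *)
Lemma WP_binrem m r j (s1 s2 : R * R -> R) : 0 <= m -> WP m r s1 s2 -> r <= 16^-1 ->
  (0 < j)%N -> WP m (2 * (2 * r) ^+ j) (fun t => binrem j (s1 t)) (fun t => binrem j (s2 t)).
Proof.
move=> m0 h r16 j0; have r0 := WP_ge0 h.
have lt8 M (G : R * R -> R) t : M <= 16^-1 -> WA M G -> `|G t| < 8^-1.
  by move=> M16 hG; apply: le_lt_trans (WA_bound t hG) _; lra.
apply: (@WP_sum _ m m0 (fun k => if (k < j)%N then 0 else (2 * r) ^+ k)
   (fun k t => if (k < j)%N then 0 else binc k * s1 t ^+ k)
   (fun k t => if (k < j)%N then 0 else binc k * s2 t ^+ k)).
- move=> k /=; case kj: (k < j)%N; first by have := WP_cst m0 0; rewrite normr0.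
  have k0 : (0 < k)%N by rewrite (leq_trans j0)// leqNgt kj.
  apply: (WP_le m0 (WP_scale (binc k) (WP_exp h k0))).
  have k2 : k%:R <= 2 ^+ k :> R.
    by rewrite -natrX ler_nat (leq_trans _ (leq_exp2 k)).
  apply: (@le_trans _ _ (1 * (k%:R * r ^+ k))).
    by rewrite ler_wpM2r ?binc_le1// mulr_ge0// exprn_ge0.
  by rewrite mul1r exprMn ler_wpM2r// exprn_ge0.
- by move=> n; apply: geo_tail_le; apply/andP; split; lra.
- by move=> t; apply: binrem_psum; case: h => /lt8 h1 _ _; exact: h1.
- by move=> t; apply: binrem_psum; case: h => _ /lt8 h1 _; exact: h1.
Qed.

End Binomial.

(** * Real-valued integrals and their exchange with series *)

Section Integration.
Context {R : realType}.
Local Notation mu := (@lebesgue_measure R).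

Definition intg (D : set R) (f : R -> R) := mu.-integrable D (EFin \o f).

Section Basic.
Variables (D : set (measurableTypeR R)) (mD : measurable D).

Lemma intgD (f g : R -> R) : intg D f -> intg D g -> intg D (fun y => f y + g y).
Proof. by move=> hf hg; exact: (integrableD mD hf hg). Qed.

Lemma intgB (f g : R -> R) : intg D f -> intg D g -> intg D (fun y => f y - g y).
Proof. by move=> hf hg; exact: (integrableB mD hf hg). Qed.

Lemma intgZ c (f : R -> R) : intg D f -> intg D (fun y => c * f y).
Proof. by move=> hf; exact: (integrableZl mD c hf). Qed.

Lemma intg_ext (f g : R -> R) : intg D f -> {in D, f =1 g} -> intg D g.
Proof. by move=> hf fg; apply: (eq_integrable mD _ _ _ hf) => // x xD /=; rewrite fg. Qed.

Lemma intg_le (f g : R -> R) : measurable_fun D f -> (forall x, D x -> `|f x| <= g x) ->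
  intg D g -> intg D f.
Proof.
move=> mf fg; apply: le_integrable => //; first exact/measurable_EFinP.
by move=> x Dx /=; rewrite lee_fin (le_trans (fg _ Dx))// ler_norm.
Qed.

Lemma intg_norm (f : R -> R) : intg D f -> intg D (fun y => `|f y|).
Proof. exact: integrable_norm. Qed.

Lemma intg_measurable (f : R -> R) : intg D f -> measurable_fun D f.
Proof. by move=> /integrableP[/measurable_EFinP]. Qed.

Lemma RintegralN (f : R -> R) : intg D f -> \int[mu]_(y in D) (- f y) = - \int[mu]_(y in D) f y.
Proof.
move=> hf; under eq_Rintegral do rewrite -mulN1r.
by rewrite RintegralZl// mulN1r.
Qed.

Lemma Rintegral_norm_le (f g : R -> R) M : intg D g -> measurable_fun D f ->
  (forall x, D x -> `|f x| <= g x) -> \int[mu]_(y in D) g y <= M ->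
  \int[mu]_(y in D) `|f y| <= M.
Proof.
move=> hg mf fg; apply: le_trans; apply: le_Rintegral => //.
by apply: intg_norm; exact: intg_le hg.
Qed.

(** The sum of the |h k| is integrable by monotone convergence and dominates all partial sums, so
    dominated convergence applies; it bounds the $L^1$ norm of the limit as well. *)
Lemma integral_series (h : nat -> R -> R) (m : nat -> R) M (H : R -> R) :
  (forall k, intg D (h k)) -> (forall k, \int[mu]_(y in D) `|h k y| <= m k) ->
  (forall n, series m n <= M) -> (forall y, D y -> series (h^~ y) @ \oo --> H y) ->
  [/\ intg D H, series (fun k => \int[mu]_(y in D) h k y) @ \oo --> \int[mu]_(y in D) H y &
      \int[mu]_(y in D) `|H y| <= M].
Proof.
move=> hi hm mM hH.
have mh k : measurable_fun D (h k) by exact: intg_measurable.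
pose g (y : R) : \bar R := (\sum_(k <oo) (`|h k y|)%:E)%E.
have mabs k : measurable_fun D (fun y => (`|h k y|)%:E).
  by apply/measurable_EFinP; exact: measurableT_comp.
have g0 y : (0 <= g y)%E by apply: nneseries_ge0 => k _ _; rewrite lee_fin.
have mg : measurable_fun D g.
  apply: ge0_emeasurable_sum => // k y _ _; by rewrite lee_fin.
have fink k : (\int[mu]_(y in D) (`|h k y|)%:E = (\int[mu]_(y in D) `|h k y|)%:E)%E.
  rewrite /Rintegral fineK//; apply: integrable_fin_num => //; exact: intg_norm.
have intgle : (\int[mu]_(y in D) g y <= M%:E)%E.
  rewrite /g integral_nneseries//; apply: lime_le.
    by apply: is_cvg_nneseries => k _ _; apply: integral_ge0 => y _; rewrite lee_fin.
  apply: nearW => n; under eq_bigr do rewrite fink.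
  rewrite sumEFin lee_fin; apply: le_trans (mM n).
  by rewrite /series /=; apply: ler_sum => k _; exact: hm.
have ig : mu.-integrable D g.
  apply/integrableP; split => //.
  under eq_integral do rewrite gee0_abs//.
  by apply: le_lt_trans intgle _; rewrite ltry.
have mS n : measurable_fun D (fun y => series (h^~ y) n).
  by rewrite /series /=; apply: measurable_sum => k; exact: mh.
have cS y : D y -> (fun n => (series (h^~ y) n)%:E) @ \oo --> (H y)%:E.
  by move=> Dy; apply: cvg_EFin; [exact: nearW|exact: hH].
have mH : measurable_fun D H.
  by apply: (@measurable_fun_cvg _ _ _ _ (fun n y => series (h^~ y) n)).
have Sg n y : (`|(series (h^~ y) n)%:E| <= g y)%E.
  rewrite /= /series /=; apply: le_trans (_ : ((\sum_(0 <= k < n) `|h k y|)%:E <= _)%E).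
    by rewrite lee_fin ler_norm_sum.
  by rewrite -sumEFin; apply: nneseries_lim_ge => k _; rewrite lee_fin.
have [i1 _ i3] : [/\ mu.-integrable D (EFin \o H),
    [sequence (\int[mu]_(x in D) `|(series (h^~ x) n)%:E - (EFin \o H) x|)%E]_n @ \oo --> 0%E &
    [sequence (\int[mu]_(x in D) (series (h^~ x) n)%:E)%E]_n @ \oo -->
      (\int[mu]_(x in D) (EFin \o H) x)%E].
  apply: (@dominated_convergence _ _ _ mu D mD (fun n y => (series (h^~ y) n)%:E) (EFin \o H) g).
  - by move=> n; exact/measurable_EFinP.
  - exact/measurable_EFinP.
  - by apply: aeW => y Dy; exact: cS.
  - exact: ig.
  - by apply: aeW => y n Dy; exact: Sg.
have iS n : intg D (fun y => series (h^~ y) n).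
  apply: le_integrable ig => //; first exact/measurable_EFinP.
  by move=> y Dy; rewrite [leRHS]gee0_abs//; exact: Sg.
split => //.
- rewrite (_ : series _ = (fun n => \int[mu]_(y in D) series (h^~ y) n)); last first.
    apply/funext => n; elim: n => [|n IH].
      rewrite /series /= big_geq//; under eq_Rintegral do rewrite big_geq//.
      by rewrite Rintegral_cst// mul0r.
    rewrite seriesSr IH -(RintegralD mD (iS n) (hi n)).
    by apply: eq_Rintegral => y _; rewrite seriesSr.
  have i3' : (fun n => (\int[mu]_(x in D) (series (h^~ x) n)%:E)%E) @ \oo -->
      (\int[mu]_(x in D) H x)%:E.
    by rewrite /Rintegral fineK//; exact: integrable_fin_num.
  exact: (fine_cvg i3').
- rewrite -lee_fin; apply: le_trans intgle.
  rewrite /Rintegral fineK; last by apply: integrable_fin_num => //; exact: intg_norm.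
  apply: ge0_le_integral => //.
  - by apply/measurable_EFinP; exact: measurableT_comp.
  - move=> y Dy.
    have <- : limn (fun n => `|(series (h^~ y) n)%:E|%E) = (`|H y|)%:E.
      by apply: cvg_lim => //; exact: (cvg_abse (cS y Dy)).
    apply: lime_le; first by apply/cvg_ex; eexists; exact: (cvg_abse (cS y Dy)).
    by apply: nearW => n; exact: Sg.
Qed.

End Basic.

End Integration.

(** * Reflections and integrals over a period *)

Section Reflection.
Context {R : realType}.
Local Notation mu := (@lebesgue_measure R).

Let mphi (c : R) : measurable_fun [set: measurableTypeR R] (fun y : R => c - y : measurableTypeR R).
Proof. by apply: measurable_funB; [exact: measurable_cst|exact: measurable_id]. Qed.

Let preim (c : R) (x : bool) (a : R) (y : bool) (b : R) :
  (fun y : R => c - y) @^-1` [set` Interval (BSide x a) (BSide y b)] =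
  [set` Interval (BSide (~~ y) (c - b)) (BSide (~~ x) (c - a))].
Proof.
apply/seteqP; split => z /=; rewrite !itv_boundlr /= /Order.le /=;
  case: x; case: y => /=; move=> /andP[? ?]; apply/andP; split; lra.
Qed.

Lemma lebesgue_measure_reflect (c : R) (A : set (measurableTypeR R)) : measurable A ->
  pushforward mu (fun y : R => c - y : measurableTypeR R) A = mu A.
Proof.
move=> mA; apply/esym/lebesgue_measure_unique => //= _ [[a b]] _ <-.
rewrite /pushforward preim /= !lebesgue_measure_itv/=.
rewrite !lte_fin ltrD2l ltrN2; case: ifP => // _.
by rewrite -!EFinD; congr EFin; ring.
Qed.

Lemma integral_reflect (c : R) (D : set (measurableTypeR R)) (h : R -> R) :
  measurable D -> measurable_fun [set: R] h ->
  intg ((fun y : R => c - y) @^-1` D) (fun y => h (c - y)) ->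
  intg D h /\ \int[mu]_(y in D) h y = \int[mu]_(y in (fun y : R => c - y) @^-1` D) h (c - y).
Proof.
move=> mD mh hi; pose phi := fun y : R => c - y : measurableTypeR R.
have mh' : measurable_fun [set: measurableTypeR R] (EFin \o h) by exact/measurable_EFinP.
have ip := integrable_pushforward (mphi c) mh' hi mD.
have E f : (\int[mu]_(y in D) f y = \int[pushforward mu phi]_(y in D) f y)%E.
  apply: eq_measure_integral; first exact: mphi.
  by move=> mf A mA AD; exact/esym/lebesgue_measure_reflect.
split.
  move/integrableP : ip => [m1 m2]; apply/integrableP; split => //.
  by rewrite E.
rewrite /Rintegral E; congr fine.
exact: (integral_pushforward (mphi c) mh' hi mD).
Qed.

Lemma integral_reflect_itv (c a b : R) (h : R -> R) : measurable_fun [set: R] h ->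
  intg `[c - b, c - a] h ->
  intg `[a, b] (fun y => h (c - y)) /\
  \int[mu]_(y in `[a, b]) h (c - y) = \int[mu]_(y in `[c - b, c - a]) h y.
Proof.
move=> mh hi.
have := @integral_reflect c `[a, b] (fun y => h (c - y)).
rewrite preim /=; have -> : (fun y => h (c - (c - y))) = h.
  by apply/funext => y; congr h; ring.
apply => //; apply: measurableT_comp => //; exact: mphi.
Qed.

Definition periodic2pi (h : R -> R) := forall y, h (y + 2 * pi) = h y.

Lemma periodic2piZ h y (k : int) : periodic2pi h -> h (y + k%:~R * (2 * pi)) = h y.
Proof.
move=> hp; have pn (n : nat) z : h (z + n%:R * (2 * pi)) = h z.
  elim: n z => [|n IH] z; first by rewrite mul0r addr0.
  by rewrite -[n.+1%:R]natr1 mulrDl mul1r addrA hp.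
case: k => n; first exact: pn.
by rewrite NegzE mulrNz mulNr -[in RHS](subrK (n.+1%:R * (2 * pi)) y) pn.
Qed.

Let pi2 : 0 < 2 * pi :> R. Proof. by rewrite mulr_gt0// pi_gt0. Qed.

Lemma mod2pi (x : R) : exists k : int, 0 <= x - k%:~R * (2 * pi) < 2 * pi.
Proof.
exists (Num.floor (x / (2 * pi))).
have /andP[h1 h2] := floor_itv (x / (2 * pi)).
rewrite ler_pdivlMr// in h1; rewrite ltr_pdivrMr// intrD mulrDl mul1r in h2.
by rewrite subr_ge0 h1 ltrBlDl.
Qed.

Lemma integral_split (x : R) (h : R -> R) : 0 <= x <= 2 * pi ->
  intg `[0, x] h -> intg `[x, 2 * pi] h ->
  intg `[0, 2 * pi] h /\ \int[mu]_(y in `[0, 2 * pi]) h y =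
    \int[mu]_(y in `[0, x]) h y + \int[mu]_(y in `[x, 2 * pi]) h y.
Proof.
move=> /andP[x0 x1] h1 h2.
have h2' : intg `]x, 2 * pi] h.
  by apply: integrableS h2 => //; apply: subset_itvr; rewrite bnd_simp.
have U : `[0, 2 * pi]%classic = `[0, x]%classic `|` `]x, 2 * pi]%classic.
  by rewrite -itv_bndbnd_setU// bnd_simp.
have D : [disjoint `[0, x]%classic & `]x, 2 * pi]%classic].
  apply/disj_setPS => y [] /=; rewrite !in_itv /= => /andP[_ yx] /andP[xy _].
  by have := lt_le_trans xy yx; rewrite ltxx.
have mh : measurable_fun (`[0, x]%classic `|` `]x, 2 * pi]%classic) h.
  by apply/measurable_funU => //; split; [exact: (intg_measurable h1)|exact: (intg_measurable h2')].
have hU : intg `[0, 2 * pi] h.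
  apply/integrableP; split; first by apply/measurable_EFinP; rewrite U.
  rewrite U ge0_integral_setU//=.
  - apply: lte_add_pinfty.
      by move/integrableP : h1 => [].
    by move/integrableP : h2' => [].
  - by apply/measurable_EFinP; exact: measurableT_comp mh.
split=> //; rewrite U Rintegral_setU//; last by rewrite -U.
by rewrite Rintegral_itv_obnd_cbnd.
Qed.

(** After reducing x modulo 2 pi to x', the interval is cut at x' and each half is mapped to itself
    by a reflection: y to x' - y on the left, y to x' + 2 pi - y on the right, the latter combined
    with periodicity. *)
Lemma integral_period (h : R -> R) x : measurable_fun [set: R] h -> periodic2pi h ->
  intg `[0, 2 * pi] h ->
  intg `[0, 2 * pi] (fun y => h (x - y)) /\
  \int[mu]_(y in `[0, 2 * pi]) h (x - y) = \int[mu]_(y in `[0, 2 * pi]) h y.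
Proof.
move=> mh hp hi; have [k] := mod2pi x; set x' := x - _ => /andP[x0 x1].
have -> : (fun y => h (x - y)) = (fun y => h (x' - y)).
  apply/funext => y; rewrite -[RHS](periodic2piZ _ k hp); congr h; rewrite /x'; ring.
have hs1 : intg `[0, x'] h.
  by apply: integrableS hi => //; apply: subset_itvl; rewrite bnd_simp ltW.
have hs2 : intg `[x', 2 * pi] h.
  by apply: integrableS hi => //; apply: subset_itvr; rewrite bnd_simp.
have x01 : 0 <= x' <= 2 * pi by rewrite x0 ltW.
have [_ hE] := integral_split x01 hs1 hs2.
have [i1 e1] : intg `[0, x'] (fun y => h (x' - y)) /\
    \int[mu]_(y in `[0, x']) h (x' - y) = \int[mu]_(y in `[0, x']) h y.
  by have := @integral_reflect_itv x' 0 x' h mh; rewrite subrr subr0; apply.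
have [i2 e2] : intg `[x', 2 * pi] (fun y => h (x' - y)) /\
    \int[mu]_(y in `[x', 2 * pi]) h (x' - y) = \int[mu]_(y in `[x', 2 * pi]) h y.
  have := @integral_reflect_itv (x' + 2 * pi) x' (2 * pi) h mh.
  have -> : x' + 2 * pi - 2 * pi = x' by ring.
  have -> : x' + 2 * pi - x' = 2 * pi by ring.
  have -> : (fun y => h (x' + 2 * pi - y)) = (fun y => h (x' - y)).
    by apply/funext => y; rewrite -(hp (x' - y)); congr h; ring.
  by apply.
have [i e] := integral_split x01 i1 i2.
by split=> //; rewrite e e1 e2 hE.
Qed.

End Reflection.

(** * Partial convolution on the Wiener algebra *)

Section Convolution.
Context {R : realType}.
Local Notation mu := (@lebesgue_measure R).
Local Notation I2pi := (`[0, 2 * pi]%classic : set R).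

Lemma measurable_trig (a b : R) : measurable_fun [set: R] (fun y : R => cos (a * y + b)).
Proof.
apply: continuous_measurable_fun => y; apply: continuous_comp; last exact: continuous_cos.
by apply: cvgD; [apply: cvgMr; exact: cvg_id|exact: cvg_cst].
Qed.

Lemma WA_measurable M G x : WA M G -> measurable_fun [set: R] (fun y => G (x, y)).
Proof.
elim=> {M G} [[[p q] ps] c M _|m G H M _ IH _ GH].
  apply: measurable_funM => //; rewrite /wa_e /=.
  rewrite (_ : (fun y => _) = (fun y => cos (q%:~R * y + (p%:~R * x + ps)))).
    exact: measurable_trig.
  by apply/funext => y; congr cos; ring.
apply: (@measurable_fun_cvg _ _ _ _ (fun n y => series (fun k => G k (x, y)) n)).
  by move=> n; rewrite /series /=; apply: measurable_sum => k; exact: IH.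
by move=> y _; exact: GH.
Qed.

Section Kernel.
Variables (k : R -> R) (m : R).
Hypotheses (mk : measurable_fun [set: R] k) (kp : periodic2pi k) (ki : intg I2pi k)
  (km : \int[mu]_(y in I2pi) `|k y| <= m).

Let mshift x : measurable_fun [set: R] (fun y => k (x - y)).
Proof.
apply: measurableT_comp => //.
by apply: measurable_funB; [exact: measurable_cst|exact: measurable_id].
Qed.

Let m0 : 0 <= m.
Proof. by apply: le_trans km; apply: Rintegral_ge0. Qed.

Lemma pconv_integrable M G x : WA M G ->
  intg I2pi (fun y => k (x - y) * G (x, y)) /\
  \int[mu]_(y in I2pi) `|k (x - y) * G (x, y)| <= m * M.
Proof.
move=> hG; have M0 := WA_ge0 hG.
have mG : measurable_fun I2pi (fun y => k (x - y) * G (x, y)).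
  by apply: measurable_funTS; apply: measurable_funM => //; exact: WA_measurable hG.
have [i1 _] := integral_period x mk kp ki.
have [i2 e2] : intg I2pi (fun y => `|k (x - y)|) /\
    \int[mu]_(y in I2pi) `|k (x - y)| = \int[mu]_(y in I2pi) `|k y|.
  apply: (@integral_period _ (fun y => `|k y|)).
  - exact: measurableT_comp.
  - by move=> y; rewrite kp.
  - exact: intg_norm.
have i3 : intg I2pi (fun y => M * `|k (x - y)|) by exact: intgZ.
have le y : I2pi y -> `|k (x - y) * G (x, y)| <= M * `|k (x - y)|.
  by move=> _; rewrite normrM mulrC ler_wpM2r// (WA_bound _ hG).
split; first exact: intg_le i3.
apply: (Rintegral_norm_le _ i3) => //.
by rewrite RintegralZl// mulrC ler_wpM2r// e2.
Qed.

(** The result depends on the first coordinate only, but is kept as a function of the pair so that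
    it can be multiplied again inside [WA]. *)
Definition pconv (G : R * R -> R) (t : R * R) : R :=
  \int[mu]_(y in I2pi) (k (t.1 - y) * G (t.1, y)).

Lemma pconvD M M' G G' t : WA M G -> WA M' G' ->
  pconv (fun t => G t + G' t) t = pconv G t + pconv G' t.
Proof.
move=> h h'; rewrite /pconv -RintegralD//.
- by apply: eq_Rintegral => y _; rewrite mulrDr.
- by have [] := pconv_integrable t.1 h.
- by have [] := pconv_integrable t.1 h'.
Qed.

Lemma pconvZ c M G t : WA M G -> pconv (fun t => c * G t) t = c * pconv G t.
Proof.
move=> h; rewrite /pconv -RintegralZl//.
- by apply: eq_Rintegral => y _; rewrite mulrCA.
- by have [] := pconv_integrable t.1 h.
Qed.

Lemma pconvB M M' G G' t : WA M G -> WA M' G' ->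
  pconv (fun t => G t - G' t) t = pconv G t - pconv G' t.
Proof.
move=> h h'; rewrite /pconv -RintegralB//.
- by apply: eq_Rintegral => y _; rewrite mulrBr.
- by have [] := pconv_integrable t.1 h.
- by have [] := pconv_integrable t.1 h'.
Qed.

Lemma pconv_cos (p q : int) ps t :
  pconv (wa_e (p, q, ps)) t =
  cos ((p + q)%:~R * t.1 + ps) * \int[mu]_(y in I2pi) (k y * cos (q%:~R * y)) +
  sin ((p + q)%:~R * t.1 + ps) * \int[mu]_(y in I2pi) (k y * sin (q%:~R * y)).
Proof.
have mc : measurable_fun [set: R] (fun y : R => cos (q%:~R * y)).
  by have := measurable_trig q%:~R 0; under eq_fun do rewrite addr0.
have ms : measurable_fun [set: R] (fun y : R => sin (q%:~R * y)).
  have := measurable_trig q%:~R (- (pi / 2)); apply: eq_measurable_fun => y _.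
  by rewrite cosBpihalf.
have ib (g : R -> R) : measurable_fun [set: R] g -> (forall y, `|g y| <= 1) -> intg I2pi (fun y => k y * g y).
  move=> mg g1; apply: intg_le (intg_norm ki) => //.
    by apply: measurable_funTS; exact: measurable_funM.
  by move=> y _; rewrite normrM ler_piMr.
have c1 y : `|cos y| <= 1 :> R by rewrite ler_norml cos_geN1 cos_le1.
have s1 y : `|sin y| <= 1 :> R by rewrite ler_norml sin_geN1 sin_le1.
have ic : intg I2pi (fun y => k y * cos (q%:~R * y)) by exact: ib.
have is_ : intg I2pi (fun y => k y * sin (q%:~R * y)) by exact: ib.
pose h u := k u * cos (p%:~R * t.1 + q%:~R * (t.1 - u) + ps).
have hE u : h u = cos ((p + q)%:~R * t.1 + ps) * (k u * cos (q%:~R * u)) +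
    sin ((p + q)%:~R * t.1 + ps) * (k u * sin (q%:~R * u)).
  rewrite /h (_ : p%:~R * _ + _ + _ = ((p + q)%:~R * t.1 + ps) - q%:~R * u).
    by rewrite cosB; ring.
  by rewrite intrD; ring.
transitivity (\int[mu]_(y in I2pi) h (t.1 - y)).
  by apply: eq_Rintegral => y _; rewrite /h subKr /wa_e.
have mh : measurable_fun [set: R] h.
  rewrite (funext hE); apply: measurable_funD; apply: measurable_funM => //; exact: measurable_funM.
have hp : periodic2pi h.
  move=> y; rewrite /h kp; congr (_ * _).
  by rewrite -[RHS](cosD2piZ _ (- q)); congr cos; rewrite mulrNz; ring.
have hi : intg I2pi h by rewrite (funext hE); apply: intgD => //; exact: intgZ.
rewrite (integral_period _ mh hp hi).2 (funext hE) RintegralD//; try exact: intgZ.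
by rewrite !RintegralZl.
Qed.

Lemma pconv_psum (n : nat -> R) G M H : (forall j, WA (n j) (G j)) ->
  (forall j, series n j <= M) -> psum G H -> psum (fun j => pconv (G j)) (pconv H).
Proof.
move=> hG nM GH t.
have [] // := @integral_series _ I2pi _ (fun j y => k (t.1 - y) * G j (t.1, y))
  (fun j => m * n j) (m * M) (fun y => k (t.1 - y) * H (t.1, y)).
- by move=> j; have [] := pconv_integrable t.1 (hG j).
- by move=> j; have [] := pconv_integrable t.1 (hG j).
- by move=> j; rewrite /series /= -mulr_sumr ler_wpM2l//; exact: nM.
move=> y _; rewrite (_ : series _ = (fun n => k (t.1 - y) * series (fun j => G j (t.1, y)) n)).
  by apply: cvgMr; exact: GH.
by apply/funext => j; rewrite /series /= mulr_sumr.
Qed.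

(** The image of an atom has frequency p + q in x, with the cosine and sine coefficients of k at q
    as amplitudes; each is at most m, whence 2 m. *)
Lemma WA_pconv M G : WA M G -> WA (2 * m * M) (pconv G).
Proof.
apply: (@span_transfer _ _ _ _ _ wa_e (fun=> 1) wa_e (fun=> 1) pconv (2 * m)).
- exact: mulr_ge0.
- by move=> n G' H M' hG' nM GH; exact: (pconv_psum hG' nM GH).
move=> [[p q] ps] c; rewrite mulr1.
have hw : WA 1 (wa_e (p, q, ps)) by exact: WA_cos.
have bd (g : R -> R) : measurable_fun [set: R] g -> (forall y, `|g y| <= 1) ->
    `|\int[mu]_(y in I2pi) (k y * g y)| <= m.
  move=> mg g1; have hm : measurable_fun I2pi (fun y => k y * g y).
    by apply: measurable_funTS; exact: measurable_funM.
  have le y : I2pi y -> `|k y * g y| <= `|k y| by move=> _; rewrite normrM ler_piMr.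
  apply: (le_trans (le_normr_Rintegral _ (intg_le _ hm le (intg_norm ki)))) => //.
  by apply: (Rintegral_norm_le _ (intg_norm ki)).
have mc : measurable_fun [set: R] (fun y : R => cos (q%:~R * y)).
  by have := measurable_trig q%:~R 0; under eq_fun do rewrite addr0.
have ms : measurable_fun [set: R] (fun y : R => sin (q%:~R * y)).
  have := measurable_trig q%:~R (- (pi / 2)); apply: eq_measurable_fun => y _.
  by rewrite cosBpihalf.
have Cm := bd _ mc (fun y => _ : `|cos _| <= 1); have Sm := bd _ ms (fun y => _ : `|sin _| <= 1).
set C := \int[mu]_(y in I2pi) (k y * cos (q%:~R * y)) in Cm.
set S := \int[mu]_(y in I2pi) (k y * sin (q%:~R * y)) in Sm.
have {}Cm : `|C| <= m by apply: Cm => y; rewrite ler_norml cos_geN1 cos_le1.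
have {}Sm : `|S| <= m by apply: Sm => y; rewrite ler_norml sin_geN1 sin_le1.
apply: (@WA_ext _ _ (fun t => c * (C * cos ((p + q)%:~R * t.1 + 0%:~R * t.2 + ps) +
    S * cos ((p + q)%:~R * t.1 + 0%:~R * t.2 + (ps - pi / 2))))); last first.
  move=> t; rewrite (pconvZ _ _ hw) pconv_cos !mul0r !addr0 addrA cosBpihalf.
  by rewrite [_ * C]mulrC [_ * S]mulrC.
apply: (@WA_le _ (`|c| * (`|C| * 1 + `|S| * 1))); last first.
  by rewrite !mulr1 mulrC ler_wpM2r// mulrDl !mul1r lerD.
by apply: WA_scale; apply: WA_add; apply: WA_scale; exact: WA_cos.
Qed.

End Kernel.

End Convolution.

(** * Convolution of increments against a non-integrable kernel *)

Section DifferenceConvolution.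
Context {R : realType}.
Local Notation mu := (@lebesgue_measure R).
Local Notation I2pi := (`[0, 2 * pi]%classic : set R).
Variable W : nat -> R.

Let mI : @measurable _ (measurableTypeR R) I2pi. Proof. by []. Qed.

Definition trig_e (i : nat * R) (x : R) : R := cos (i.1.+2%:R * x + i.2).

Definition wtrig : R -> (R -> R) -> Prop := cspan trig_e (fun i => W i.1).

Variables (K : R) (W0 : forall n, 0 <= W n) (K0 : 0 <= K) (KW : forall n, 1 <= K * W n).

Let w0 (i : nat * R) : 0 <= W i.1. Proof. exact: W0. Qed.

Variables (k : R -> R) (C : R).
Hypotheses (mk : measurable_fun [set: R] k) (kp : periodic2pi k) (C0 : 0 <= C).
Let kcos n u := k u * (cos (n.+2%:R * u) - 1).
Let ksin n u := k u * sin (n.+2%:R * u).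
Hypotheses (kcos_int : forall n, intg I2pi (kcos n))
  (kcos_le : forall n, \int[mu]_(u in I2pi) `|kcos n u| <= C * W n)
  (ksin_int : forall n, intg I2pi (ksin n))
  (ksin_le : forall n, \int[mu]_(u in I2pi) `|ksin n u| <= C * W n).

Let mkcos n : measurable_fun [set: R] (kcos n).
Proof.
apply: measurable_funM => //; apply: measurable_funB => //.
by have := measurable_trig n.+2%:R (0 : R); under eq_fun do rewrite addr0.
Qed.

Let mksin n : measurable_fun [set: R] (ksin n).
Proof.
apply: measurable_funM => //.
have := measurable_trig n.+2%:R (- (pi / 2) : R); apply: eq_measurable_fun => y _.
by rewrite cosBpihalf.
Qed.

Let cosnp n (y : R) : cos (n.+2%:R * (y + 2 * pi)) = cos (n.+2%:R * y).
Proof. by rewrite mulrDr -[RHS](cosD2piZ _ n.+2). Qed.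

Let pkcos n : periodic2pi (kcos n).
Proof. by move=> y; rewrite /kcos kp cosnp. Qed.

Let pksin n : periodic2pi (ksin n).
Proof.
move=> y; rewrite /ksin kp; congr (_ * _).
rewrite -!cosBpihalf mulrDr -[RHS](cosD2piZ _ n.+2); congr cos; ring.
Qed.

(** The kernel k need not be integrable: only its products with increments of g are. For g(x) = cos
    (n x + ps) and u = x - y, the increment g(y) - g(x) is cos (n x + ps) (cos (n u) - 1) + sin (n x
    + ps) sin (n u), so two integrable kernels per frequency suffice, and [W] measures them. *)
Definition dconv (g : R -> R) (G : R * R -> R) (t : R * R) : R :=
  \int[mu]_(y in I2pi) (k (t.1 - y) * (g y - g t.1) * G (t.1, y)).

Let atomE n ps c (G : R * R -> R) x y :
  k (x - y) * (c * trig_e (n, ps) y - c * trig_e (n, ps) x) * G (x, y) =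
  c * cos (n.+2%:R * x + ps) * (kcos n (x - y) * G (x, y)) +
  c * sin (n.+2%:R * x + ps) * (ksin n (x - y) * G (x, y)).
Proof.
rewrite /trig_e /= (_ : _ * y + ps = (n.+2%:R * x + ps) - n.+2%:R * (x - y)); last by ring.
by rewrite cosB /kcos /ksin; ring.
Qed.

Section Fixed.
Variables (M' : R) (G : R * R -> R) (hG : WA M' G).
Let M'0 : 0 <= M'. Proof. exact: WA_ge0 hG. Qed.

Lemma dconv_integrable M g x : wtrig M g ->
  intg I2pi (fun y => k (x - y) * (g y - g x) * G (x, y)) /\
  \int[mu]_(y in I2pi) `|k (x - y) * (g y - g x) * G (x, y)| <= 2 * C * M' * M.
Proof.
elim=> {M g} [[n ps] c M hM|m F H M hF IH mM FH].
  have [i1 b1] := pconv_integrable (mkcos n) (@pkcos n) (kcos_int n) (kcos_le n) x hG.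
  have [i2 b2] := pconv_integrable (mksin n) (@pksin n) (ksin_int n) (ksin_le n) x hG.
  rewrite (funext (atomE n ps c G x)).
  have i3 := intgZ mI (c * cos (n.+2%:R * x + ps)) i1.
  have i4 := intgZ mI (c * sin (n.+2%:R * x + ps)) i2.
  split; first exact: (intgD mI i3 i4).
  under eq_Rintegral do rewrite (atomE n ps c G x).
  pose k1 y := kcos n (x - y) * G (x, y); pose k2 y := ksin n (x - y) * G (x, y).
  have mf := intg_measurable (intgD mI i3 i4).
  apply: (@le_trans _ _ (\int[mu]_(y in I2pi) (`|c| * `|k1 y| + `|c| * `|k2 y|))).
    have j1 := intgZ mI `|c| (intg_norm i1); have j2 := intgZ mI `|c| (intg_norm i2).
    apply: (Rintegral_norm_le mI (intgD mI j1 j2)) => //.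
    move=> y _; apply: (le_trans (ler_normD _ _)); rewrite !normrM.
    by apply: lerD; apply: ler_wpM2r => //; apply: ler_piMr => //; rewrite ler_norml ?cos_geN1 ?cos_le1 ?sin_geN1 ?sin_le1.
  rewrite RintegralD//; [|exact: (intgZ mI _ (intg_norm i1))|exact: (intgZ mI _ (intg_norm i2))].
  rewrite !RintegralZl//; [|exact: intg_norm|exact: intg_norm].
  apply: (@le_trans _ _ (`|c| * (C * W n * M') + `|c| * (C * W n * M'))).
    by apply: lerD; rewrite ler_wpM2l.
  rewrite (_ : _ + _ = 2 * C * M' * (`|c| * W n)); last by ring.
  by rewrite ler_wpM2l// ?mulr_ge0.
have [] // := @integral_series _ I2pi _
  (fun j y => k (x - y) * (F j y - F j x) * G (x, y))
  (fun j => 2 * C * M' * m j) (2 * C * M' * M)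
  (fun y => k (x - y) * (H y - H x) * G (x, y)).
- by move=> j; have [] := IH j.
- by move=> j; have [] := IH j.
- by move=> j; rewrite /series /= -mulr_sumr ler_wpM2l// ?mulr_ge0//; exact: mM.
move=> y _; rewrite (_ : series _ = (fun n => k (x - y) *
   (series (F^~ y) n - series (F^~ x) n) * G (x, y))).
  by apply: cvgMl; apply: cvgMr; apply: cvgB; exact: FH.
by apply/funext => j; rewrite /series /= -sumrB mulr_sumr mulr_suml.
Qed.

Lemma dconv_psum (m : nat -> R) F M H : (forall j, wtrig (m j) (F j)) ->
  (forall j, series m j <= M) -> psum F H ->
  psum (fun j => dconv (F j) G) (dconv H G).
Proof.
move=> hF mM FH t.
have [] // := @integral_series _ I2pi _
  (fun j y => k (t.1 - y) * (F j y - F j t.1) * G (t.1, y))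
  (fun j => 2 * C * M' * m j) (2 * C * M' * M)
  (fun y => k (t.1 - y) * (H y - H t.1) * G (t.1, y)).
- by move=> j; have [] := dconv_integrable t.1 (hF j).
- by move=> j; have [] := dconv_integrable t.1 (hF j).
- by move=> j; rewrite /series /= -mulr_sumr ler_wpM2l// ?mulr_ge0//; exact: mM.
move=> y _; rewrite (_ : series _ = (fun n => k (t.1 - y) *
   (series (F^~ y) n - series (F^~ t.1) n) * G (t.1, y))).
  by apply: cvgMl; apply: cvgMr; apply: cvgB; exact: FH.
by apply/funext => j; rewrite /series /= -sumrB mulr_sumr mulr_suml.
Qed.

Lemma dconv_atom n ps c t : dconv (fun x => c * trig_e (n, ps) x) G t =
  c * (cos (n.+2%:R * t.1 + ps) * pconv (kcos n) G t +
       sin (n.+2%:R * t.1 + ps) * pconv (ksin n) G t).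
Proof.
have [i1 _] := pconv_integrable (mkcos n) (@pkcos n) (kcos_int n) (kcos_le n) t.1 hG.
have [i2 _] := pconv_integrable (mksin n) (@pksin n) (ksin_int n) (ksin_le n) t.1 hG.
rewrite /dconv; under eq_Rintegral do rewrite atomE.
rewrite RintegralD//; try exact: intgZ.
by rewrite !RintegralZl// /pconv; ring.
Qed.

Lemma WA_dconv M g : wtrig M g -> WA (4 * C * M' * M) (dconv g G).
Proof.
apply: (@span_transfer _ _ _ _ _ trig_e (fun i => W i.1) wa_e (fun=> 1)
  (fun g => dconv g G) (4 * C * M')).
- by rewrite !mulr_ge0.
- by move=> m F H M1 hF mM FH; exact: (dconv_psum hF mM FH).
move=> [n ps] c /=; rewrite (funext (dconv_atom n ps c)).
have h1 := WA_pconv (mkcos n) (@pkcos n) (kcos_int n) (kcos_le n) hG.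
have h2 := WA_pconv (mksin n) (@pksin n) (ksin_int n) (ksin_le n) hG.
have c1 : WA 1 (fun t : R * R => cos (n.+2%:R * t.1 + ps)).
  by apply: (WA_ext (WA_cos n.+2 0 ps)) => t; rewrite mul0r addr0.
have s1 : WA 1 (fun t : R * R => sin (n.+2%:R * t.1 + ps)).
  by apply: (WA_ext (WA_cos n.+2 0 (ps - pi / 2))) => t; rewrite mul0r addr0 addrA cosBpihalf.
apply: WA_le (WA_scale c (WA_add (WA_mul c1 h1) (WA_mul s1 h2))) _.
by rewrite le_eqVlt; apply/orP; left; apply/eqP; ring.
Qed.

Lemma dconvBl M1 M2 g1 g2 t : wtrig M1 g1 -> wtrig M2 g2 ->
  dconv (fun x => g1 x - g2 x) G t = dconv g1 G t - dconv g2 G t.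
Proof.
move=> h1 h2; rewrite /dconv -RintegralB//.
- by apply: eq_Rintegral => y _; ring.
- by have [] := dconv_integrable t.1 h1.
- by have [] := dconv_integrable t.1 h2.
Qed.

End Fixed.

Lemma dconvBr M M1 M2 g G1 G2 t : wtrig M g -> WA M1 G1 -> WA M2 G2 ->
  dconv g (fun t => G1 t - G2 t) t = dconv g G1 t - dconv g G2 t.
Proof.
move=> h h1 h2; rewrite /dconv -RintegralB//.
- by apply: eq_Rintegral => y _; ring.
- by have [] := dconv_integrable h1 t.1 h.
- by have [] := dconv_integrable h2 t.1 h.
Qed.

End DifferenceConvolution.

(** * The fundamental theorem of calculus with singular ends, and the chord function *)

Section Calculus.
Context {R : realType}.
Local Notation mu := (@lebesgue_measure R).

(** The integrand may blow up at both ends. F and the indefinite integral are continuous up to the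
    ends and have equal derivatives inside, so the mean value theorem applied to their difference
    concludes. *)
Lemma FTC_open (F f : R -> R) (a b : R) : a < b ->
  (forall x, x \in `]a, b[ -> is_derive x 1 F (f x)) ->
  {within `[a, b], continuous F} ->
  (forall x, x \in `]a, b[ -> {for x, continuous f}) ->
  intg `[a, b] f -> \int[mu]_(x in `[a, b]) f x = F b - F a.
Proof.
move=> ab dF cF cf fi.
pose G x := \int[mu]_(t in `[a, x]) f t.
have cG : {within `[a, b], continuous G}.
  exact: parameterized_integral_continuous (ltW ab) fi.
have dG x : x \in `]a, b[ -> is_derive x 1 G (f x).
  move=> xab; move: (xab); rewrite in_itv /= => /andP[ax xb].
  have [d1 d2] := continuous_FTC1_closed xb fi ax (cf x xab).
  by split; [exact: d1|rewrite -derive1E; exact: d2].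
have [] := @MVT _ (fun x => F x - G x) (fun x => f x - f x) a b ab.
- by move=> x xab; have := dF x xab; have := dG x xab => ? ?; exact: is_deriveB.
- by move=> x; apply: continuousB; [exact: cF|exact: cG].
move=> c _; rewrite subrr mul0r => /eqP; rewrite subr_eq0 => /eqP FG.
have Ga : G a = 0 by rewrite /G set_itv1 Rintegral_set1.
by move: FG; rewrite Ga subr0 /G => <-; ring.
Qed.

Lemma continuous_absX (e : R) : 0 < e -> continuous (fun x : R => `|x| `^ e).
Proof.
move=> e0 x; have [->|x0] := eqVneq x 0.
  rewrite /continuous_at normr0 powR0 ?gt_eqF//; apply/cvgrPdist_le => r r0 /=.
  near=> y; rewrite sub0r normrN ger0_norm ?powR_ge0//.
  have yr : `|y| <= r `^ e^-1.
    near: y; apply/nbhs_ballP; exists (r `^ e^-1); first exact: powR_gt0.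
    by move=> z; rewrite /ball /= sub0r normrN => /ltW.
  apply: (@le_trans _ _ ((r `^ e^-1) `^ e)).
    by apply: ge0_ler_powR => //; rewrite ?nnegrE ?powR_ge0// ltW.
  by rewrite -powRrM mulVf ?gt_eqF// powRr1// ltW.
apply: (@continuous_comp _ _ _ (fun x : R => `|x|) (fun y : R => y `^ e)).
  exact: norm_continuous.
have x0' : 0 < `|x| by rewrite normr_gt0.
apply: differentiable_continuous; apply/derivable1_diffP.
by have [] := is_derive1_powR e x0'.
Unshelve. all: by end_near. Qed.

Lemma measurable_absX (e : R) (g : R -> R) : measurable_fun [set: R] g ->
  measurable_fun [set: R] (fun x : R => `|g x| `^ e).
Proof.
move=> mg; apply: (@measurableT_comp _ _ _ _ _ _ (fun y : R => y `^ e)).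
  exact: measurable_powR.
exact: measurableT_comp.
Qed.

(** For u in [0, 2 pi], the chord of the unit circle subtending the angle u, that is, the distance
    between two points of the undeformed boundary. *)
Definition vsin (u : R) : R := 2 * sin (u / 2).

Lemma continuous_vsin : continuous vsin.
Proof.
move=> u; apply: cvgMr; apply: continuous_comp; last exact: continuous_sin.
by apply: cvgMl; exact: cvg_id.
Qed.

Lemma is_derive_half (u : R) : is_derive u 1 (fun u : R => u / 2) (2^-1).
Proof.
by apply: is_derive_eq; rewrite !scaler0 add0r /GRing.scale /= mulr1.
Qed.

Lemma is_derive_vsin (u : R) : is_derive u 1 vsin (cos (u / 2)).
Proof.
have h := is_derive_half u.
have h2 := @is_derive1_comp R sin (fun u : R => u / 2) u _ _ (is_derive_sin (u / 2)) h.
have h3 := is_deriveZ 2 h2.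
apply: (is_derive_eq h3); rewrite /GRing.scale /=; by field.
Qed.

Lemma measurable_vsin : measurable_fun [set: R] vsin.
Proof. apply: continuous_measurable_fun; exact: continuous_vsin. Qed.

Lemma vsin_gt0 u : 0 < u < 2 * pi -> 0 < vsin u.
Proof.
move=> /andP[u0 u2]; rewrite /vsin mulr_gt0// sin_gt0_pi// divr_gt0//=.
by rewrite ltr_pdivrMr// mulrC.
Qed.

Lemma vsin_ge0 u : 0 <= u <= 2 * pi -> 0 <= vsin u.
Proof.
move=> /andP[u0 u2]; rewrite /vsin mulr_ge0// sin_ge0_pi// divr_ge0//=.
by rewrite ler_pdivrMr// mulrC.
Qed.

Lemma vsin_le2 u : `|vsin u| <= 2.
Proof.
by rewrite /vsin normrM ger0_norm// ler_piMr// ler_norml sin_geN1 sin_le1.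
Qed.

Lemma vsinD u : vsin (u + 2 * pi) = - vsin u.
Proof.
rewrite /vsin (_ : (u + 2 * pi) / 2 = u / 2 + pi); last by field.
by rewrite sinDpi mulrN.
Qed.

Lemma vsin_refl u : vsin (2 * pi - u) = vsin u.
Proof.
rewrite /vsin (_ : (2 * pi - u) / 2 = pi - u / 2); last by field.
by rewrite sinB sinpi cospi mul0r mulN1r sub0r opprK.
Qed.

Lemma vsin0 : vsin 0 = 0. Proof. by rewrite /vsin mul0r sin0 mulr0. Qed.

Lemma vsin2pi : vsin (2 * pi) = 0.
Proof. by rewrite -[2 * pi]add0r vsinD vsin0 oppr0. Qed.

Lemma vsin_pi : vsin pi = 2. Proof. by rewrite /vsin sin_pihalf mulr1. Qed.

Lemma vsin_sqr u : vsin u ^+ 2 = 2 * (1 - cos u).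
Proof.
have -> : cos u = cos (u / 2 + u / 2) by congr cos; field.
by rewrite cosD /vsin -!expr2 cos2sin2; ring.
Qed.

Lemma sin_vsin u : sin u = vsin u * cos (u / 2).
Proof.
have -> : sin u = sin (u / 2 + u / 2) by congr sin; field.
by rewrite sinD /vsin; ring.
Qed.

End Calculus.

(** * The singular kernel and its Fourier multiplier *)

Section SingularKernel.
Context {R : realType}.
Local Notation mu := (@lebesgue_measure R).
Local Notation I2pi := (`[0, 2 * pi]%classic : set R).
Implicit Types (g : R -> R).

Let mI : @measurable _ (measurableTypeR R) I2pi. Proof. by []. Qed.
Let pi0 : 0 < pi :> R. Proof. exact: pi_gt0. Qed.
Let pi2 : 0 < 2 * pi :> R. Proof. by rewrite mulr_gt0. Qed.

(** Monotone convergence along the intervals [b / (i + 1), b]: a uniform bound on the proper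
    integrals gives integrability down to 0. *)
Lemma intg_improper g (b C : R) : 0 < b -> measurable_fun [set: R] g ->
  (forall x, 0 < x <= b -> 0 <= g x) ->
  (forall x, 0 < x <= b -> intg `[x, b] g /\ \int[mu]_(y in `[x, b]) g y <= C) ->
  intg `[0, b] g.
Proof.
move=> b0 mg g0 hg.
pose F (i : nat) : set (measurableTypeR R) := `[b * i.+1%:R^-1, b]%classic.
have Fb (i : nat) : 0 < b * i.+1%:R^-1 <= b.
  rewrite mulr_gt0 ?invr_gt0 ?ltr0Sn//= ler_piMr ?(ltW b0)//.
  by rewrite invf_le1 ?ltr0Sn// ler1n.
have ndF : nondecreasing_seq F.
  apply/nondecreasing_seqP => n; apply/subsetPset; apply: subset_itvr.
  rewrite bnd_simp ler_wpM2l ?(ltW b0)// lef_pV2 ?posrE ?ltr0Sn//.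
  by rewrite ler_nat.
have UF : \bigcup_i F i = `]0, b]%classic.
  apply/seteqP; split => x /=.
    move=> [i _]; rewrite /F /= !in_itv /= => /andP[bx ->]; rewrite andbT.
    by apply: lt_le_trans bx; have /andP[] := Fb i.
  rewrite in_itv /= => /andP[x0 xb].
  have [n hn] : exists n : nat, b / x < n%:R.
    by exists (Num.truncn (b / x)).+1; rewrite truncnS_gt.
  exists n => //; rewrite /F /= in_itv /= xb andbT ler_pdivrMr ?ltr0Sn//.
  rewrite mulrC -ler_pdivrMr//; apply: (le_trans (ltW hn)).
  by rewrite ler_nat.
have mgE : measurable_fun [set: measurableTypeR R] (EFin \o g) by exact/measurable_EFinP.
have cv := @ge0_nondecreasing_set_cvg_integral _ (measurableTypeR R) R F (EFin \o g) mu ndF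
  (fun i => measurable_itv _) (fun i => measurable_funTS mgE).
have {}cv : (\int[mu]_(x in F i) (g x)%:E)%E @[i --> \oo] --> (\int[mu]_(x in `]0%R, b]) (g x)%:E)%E.
  rewrite -UF; apply: cv => i x; rewrite /F /= in_itv /= => /andP[h1 h2].
  by rewrite lee_fin g0// h2 andbT; apply: lt_le_trans h1; have /andP[] := Fb i.
have le : (\int[mu]_(x in `]0%R, b]) (g x)%:E <= C%:E)%E.
  rewrite -(cvg_lim _ cv)//; apply: lime_le; first by apply/cvg_ex; eexists; exact: cv.
  apply: nearW => i; have [h1 h2] := hg _ (Fb i).
  have fin : (\int[mu]_(x in F i) (g x)%:E)%E \is a fin_num.
    by apply: (integrable_fin_num _ h1).
  by rewrite -(fineK fin) lee_fin.
have i1 : intg `]0, b] g.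
  apply/integrableP; split; first exact: measurable_funTS.
  apply: (@le_lt_trans _ _ (\int[mu]_(x in `]0%R, b]) (g x)%:E)%E); last first.
    by apply: le_lt_trans le _; rewrite ltry.
  rewrite le_eqVlt; apply/orP; left; apply/eqP; apply: eq_integral => x.
  by rewrite inE /= in_itv /= => xb; rewrite ger0_norm// g0.
apply/integrableP; split; first exact: measurable_funTS.
rewrite -integral_itv_obnd_cbnd; last by apply: measurableT_comp => //; exact: measurable_funTS.
by move/integrableP : i1 => [].
Qed.

Lemma integral_symmetric g : measurable_fun [set: R] g ->
  (forall u, g (2 * pi - u) = g u) -> intg `[0, pi] g ->
  intg I2pi g /\ \int[mu]_(u in I2pi) g u = 2 * \int[mu]_(u in `[0, pi]) g u.
Proof.
move=> mg gs gi.
have := @integral_reflect_itv _ (2 * pi) pi (2 * pi) g mg.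
rewrite subrr (_ : 2 * pi - pi = pi); last by ring.
rewrite (funext gs) => /(_ gi) [i2 e2].
have p2 : 0 <= (pi : R) <= 2 * pi by apply/andP; split; have := pi0; lra.
have [h1 h2] := integral_split p2 gi i2.
by split => //; rewrite h2 e2; ring.
Qed.

Lemma integral_antisymmetric g : measurable_fun [set: R] g -> periodic2pi g ->
  (forall u, g (- u) = - g u) -> intg I2pi g -> \int[mu]_(u in I2pi) g u = 0.
Proof.
move=> mg gp gs gi.
have [_] := integral_period 0 mg gp gi.
under eq_Rintegral do rewrite sub0r gs.
by rewrite RintegralN//; lra.
Qed.

Variables (e : R) (e0 : 0 < e) (e1 : e <= 1).

(** With e = 2 - alpha, this is the singular kernel |vsin|^(- alpha) times one factor |vsin|, which
    makes it integrable. *)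
Definition pker (u : R) : R := `|vsin u| `^ (e - 1).

Lemma measurable_pker : measurable_fun [set: R] pker.
Proof. by apply: measurable_absX; exact: measurable_vsin. Qed.

Lemma pker_refl u : pker (2 * pi - u) = pker u.
Proof. by rewrite /pker vsin_refl. Qed.

Lemma is_derive_vsinX (u : R) : 0 < u < 2 * pi ->
  is_derive u 1 (fun u => vsin u `^ e) (e * vsin u `^ (e - 1) * cos (u / 2)).
Proof.
move=> u02; have v0 := vsin_gt0 u02.
exact: (@is_derive1_comp R (fun y : R => y `^ e) vsin u _ _ (is_derive1_powR e v0) (is_derive_vsin u)).
Qed.

Let continuous_vpow (a : R) (u : R) : 0 < u < 2 * pi -> {for u, continuous (fun u => vsin u `^ a)}.
Proof.
move=> u02; have v0 := vsin_gt0 u02.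
apply: (@continuous_comp _ _ _ vsin (fun y : R => y `^ a)); first exact: continuous_vsin.
by apply: differentiable_continuous; apply/derivable1_diffP; have [] := is_derive1_powR a v0.
Qed.

Let continuous_coshalf (u : R) : {for u, continuous (fun u : R => cos (u / 2))}.
Proof.
apply: continuous_comp; last exact: continuous_cos.
by apply: cvgMl; exact: cvg_id.
Qed.

Let g0 u := pker u * cos (u / 2).

Let g0_int : intg `[0, pi] g0.
Proof.
(* The primitive vsin^e / e is largest at pi, where vsin is 2, and 2^e <= 2; hence the constant 2 /
   e. *)
apply: (@intg_improper _ pi (2 / e)) => //.
- apply: measurable_funM; first exact: measurable_pker.
  by apply: continuous_measurable_fun => u; exact: continuous_coshalf.
- move=> x /andP[x0 xpi]; rewrite mulr_ge0 ?powR_ge0// cos_ge0_pihalf//.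
  by have := pi0; move=> ?; apply/andP; split; lra.
move=> x /andP[x0]; rewrite le_eqVlt => /predU1P[->|xpi].
  split; last by rewrite set_itv1 Rintegral_set1 divr_ge0// ltW.
  rewrite set_itv1; apply/integrableP; split; first exact: measurable_fun_set1.
  by rewrite integral_set1.
have inn u : x <= u <= pi -> 0 < u < 2 * pi.
  by move=> /andP[h1 h2]; have := pi0 => ?; apply/andP; split; lra.
have cg u : x <= u <= pi -> {for u, continuous (fun u => vsin u `^ (e - 1) * cos (u / 2))}.
  by move=> /inn h; apply: continuousM; [exact: continuous_vpow|exact: continuous_coshalf].
have gE u : u \in `[x, pi] -> g0 u = vsin u `^ (e - 1) * cos (u / 2).
  by rewrite in_itv /= => /inn/vsin_gt0 v0; rewrite /g0 /pker gtr0_norm.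
have hi : intg `[x, pi] (fun u => vsin u `^ (e - 1) * cos (u / 2)).
  apply: continuous_compact_integrable; first exact: segment_compact.
  apply: continuous_in_subspaceT => u; rewrite inE /= in_itv /= => hu; exact: cg.
have gi : intg `[x, pi] g0.
  by apply: (intg_ext _ hi) => // u; rewrite inE => /= hu; rewrite gE.
split=> //.
have -> : \int[mu]_(u in `[x, pi]) g0 u =
    \int[mu]_(u in `[x, pi]) (vsin u `^ (e - 1) * cos (u / 2)).
  by apply: eq_Rintegral => u; rewrite inE => /= hu; rewrite gE.
have -> : \int[mu]_(u in `[x, pi]) (vsin u `^ (e - 1) * cos (u / 2)) =
    vsin pi `^ e / e - vsin x `^ e / e.
  apply: (@FTC_open _ (fun u => vsin u `^ e / e) _ x pi xpi _ _ _ hi).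
  - move=> u; rewrite in_itv /= => /andP[h1 h2].
    have hu : 0 < u < 2 * pi by apply: inn; rewrite !ltW.
    have h := is_deriveZ e^-1 (is_derive_vsinX hu).
    rewrite (_ : (fun u => _ / e) = (e^-1 \*: (fun u => vsin u `^ e))); last first.
      by apply/funext => y; rewrite /= /GRing.scale /= mulrC.
    by apply: (is_derive_eq h); rewrite /GRing.scale /= -mulrA mulKf// gt_eqF.
  - apply: derivable_within_continuous => u; rewrite in_itv /= => hu.
    have h := is_deriveZ e^-1 (is_derive_vsinX (inn _ hu)).
    rewrite (_ : (fun u => _ / e) = (e^-1 \*: (fun u => vsin u `^ e))); last first.
      by apply/funext => y; rewrite /= /GRing.scale /= mulrC.
    by case: h.
  - by move=> u; rewrite in_itv /= => /andP[h1 h2]; apply: cg; rewrite !ltW.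
rewrite vsin_pi -mulrBl ler_wpM2r ?invr_ge0 ?(ltW e0)//.
apply: (@le_trans _ _ (2 `^ e)); first by rewrite gerBl powR_ge0.
by rewrite -[leRHS]powRr1// ler_powR// ler1n.
Qed.

(* [vsin u]^(e-1) times [sin (u/2)]^2 is bounded, and [cos (u/2)]^2 is absorbed by the derivative. *)
Lemma pker_half_int : intg `[0, pi] pker.
Proof.
apply: (@intg_le _ _ _ _ (fun u => g0 u + 1)) => //.
- by apply: measurable_funTS; exact: measurable_pker.
- move=> u /=; rewrite in_itv /= => /andP[u0 upi].
  have p0 : 0 <= pker u := powR_ge0 _ _.
  have v0 : 0 <= vsin u by apply: vsin_ge0; rewrite u0 /=; have := pi0; move=> ?; lra.
  have c0 : 0 <= cos (u / 2).
    by apply: cos_ge0_pihalf; have := pi0 => ?; apply/andP; split; lra.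
  have c1 : cos (u / 2) <= 1 by exact: cos_le1.
  have cs := cos2Dsin2 (u / 2).
  rewrite ger0_norm// /g0.
  have pv : pker u * (vsin u * vsin u) <= 4.
    have [->|vn0] := eqVneq (vsin u) 0; first by rewrite !mulr0.
    have vp : 0 < vsin u by rewrite lt_neqAle eq_sym vn0.
    rewrite mulrA /pker gtr0_norm// -[X in _ * X * _]powRr1// -powRD; last first.
      by rewrite vn0 implybT.
    rewrite subrK (_ : 4 = 2 * 2); last by ring.
    have := vsin_le2 u; rewrite gtr0_norm// => v2.
    rewrite ler_pM ?powR_ge0//.
    apply: (@le_trans _ _ (2 `^ e)); first by rewrite ge0_ler_powR ?nnegrE// ltW.
    by rewrite -[leRHS]powRr1// ler_powR// ler1n.
  have s2 : sin (u / 2) ^+ 2 = vsin u * vsin u / 4 by rewrite /vsin; field.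
  have k1 : pker u * cos (u / 2) ^+ 2 <= pker u * cos (u / 2).
    by apply: ler_wpM2l => //; rewrite expr2; exact: ler_piMl.
  have k2 : pker u * sin (u / 2) ^+ 2 <= 1 by rewrite s2 mulrA ler_pdivrMr// mul1r.
  have k3 : pker u = pker u * cos (u / 2) ^+ 2 + pker u * sin (u / 2) ^+ 2.
    by rewrite -mulrDr cs mulr1.
  by rewrite [leLHS]k3; exact: lerD.
- apply: intgD => //; apply: continuous_compact_integrable; first exact: segment_compact.
  by move=> u; exact: cvg_cst.
Qed.

Lemma pker_int : intg I2pi pker.
Proof. exact: (integral_symmetric measurable_pker pker_refl pker_half_int).1. Qed.

End SingularKernel.

(** * The symbol of the linearised operator *)

Section Multiplier.
Context {R : realType}.
Local Notation mu := (@lebesgue_measure R).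
Local Notation I2pi := (`[0, 2 * pi]%classic : set R).
Implicit Types (g : R -> R).

Let mI : @measurable _ (measurableTypeR R) I2pi. Proof. by []. Qed.
Let pi0 : 0 < (pi : R). Proof. exact: pi_gt0. Qed.
Let pi2 : 0 < 2 * (pi : R). Proof. by rewrite mulr_gt0. Qed.

(** Identities between powers of [vsin] are available only away from its zeros 0 and 2 pi; these end
    points form a null set. *)
Lemma intg_eq_oo (f g : R -> R) (a b : R) : measurable_fun [set: R] f -> measurable_fun [set: R] g ->
  (forall u, a < u < b -> f u = g u) -> intg `[a, b] f ->
  intg `[a, b] g /\ \int[mu]_(u in `[a, b]) g u = \int[mu]_(u in `[a, b]) f u.
Proof.
move=> mf mg fg fi.
have m1 (h : R -> R) : measurable_fun [set: R] h -> measurable_fun `]a, b[ (EFin \o h).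
  by move=> mh; apply/measurable_EFinP; exact: measurable_funTS.
have E (h1 h2 : R -> R) : measurable_fun [set: R] h1 -> measurable_fun [set: R] h2 ->
    (forall u, a < u < b -> h1 u = h2 u) ->
    (\int[mu]_(u in `[a, b]) (h2 u)%:E = \int[mu]_(u in `[a, b]) (h1 u)%:E)%E.
  move=> mh1 mh2 h12; rewrite (integral_itv_bndoo _ _ (m1 _ mh1)) (integral_itv_bndoo _ _ (m1 _ mh2)).
  by apply: eq_integral => u; rewrite inE /= in_itv /= => uab; rewrite h12.
split; last by rewrite /Rintegral (E f g).
apply/integrableP; split; first by apply/measurable_EFinP; exact: measurable_funTS.
rewrite (E (fun u => `|f u|) (fun u => `|g u|)); [|exact: measurableT_comp|exact: measurableT_comp|].
  by move/integrableP : fi => [].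
by move=> u uab; rewrite fg.
Qed.

Variables (e : R) (e0 : 0 < e) (e1 : e <= 1).
Local Notation pk := (pker e).

Let pi_int := pker_int e0 e1.

Lemma measurable_sinZ (a : R) : measurable_fun [set: R] (fun u : R => sin (a * u)).
Proof.
have := measurable_trig a (- (pi / 2) : R); apply: eq_measurable_fun => y _.
by rewrite cosBpihalf.
Qed.

Lemma measurable_cosZ (a : R) : measurable_fun [set: R] (fun u : R => cos (a * u)).
Proof. by have := measurable_trig a (0 : R); under eq_fun do rewrite addr0. Qed.

Let intg_pkM g : measurable_fun [set: R] g -> (forall u, `|g u| <= 1) ->
  intg I2pi (fun u => pk u * g u).
Proof.
move=> mg g1; apply: (intg_le _ _ _ pi_int) => //.
  by apply: measurable_funTS; apply: measurable_funM => //; exact: measurable_pker.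
by move=> u _; rewrite normrM (ger0_norm (powR_ge0 _ _)) ler_piMr// powR_ge0.
Qed.

Let sin_abs1 (x : R) : `|sin x| <= 1. Proof. by rewrite ler_norml sin_geN1 sin_le1. Qed.
Let cos_abs1 (x : R) : `|cos x| <= 1. Proof. by rewrite ler_norml cos_geN1 cos_le1. Qed.

Definition kcoef (k : nat) : R := \int[mu]_(u in I2pi) (pk u * sin ((k%:R + 2^-1) * u)).

Let kcoef_int k : intg I2pi (fun u => pk u * sin ((k%:R + 2^-1) * u)).
Proof. by apply: intg_pkM => //; exact: measurable_sinZ. Qed.

Let continuous_absvpow (a : R) (u : R) : 0 < u < 2 * pi ->
  {for u, continuous (fun u => `|vsin u| `^ a)}.
Proof.
move=> u02; have v0 := vsin_gt0 u02.
have v0' : 0 < `|vsin u| by rewrite gtr0_norm.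
apply: (@continuous_comp _ _ _ (fun u => `|vsin u|) (fun y : R => y `^ a)).
  by apply: continuous_comp; [exact: continuous_vsin|exact: norm_continuous].
by apply: differentiable_continuous; apply/derivable1_diffP; have [] := is_derive1_powR a v0'.
Qed.

Let is_derive_sinZ (a u : R) : is_derive u 1 (fun u : R => sin (a * u)) (a * cos (a * u)).
Proof.
have h : is_derive u 1 (fun u : R => a * u) a.
  have := is_deriveZ a (is_derive_id u (1 : R)).
  by move=> h; apply: (is_derive_eq h); rewrite /GRing.scale /= mulr1.
have := @is_derive1_comp R sin (fun u : R => a * u) u _ _ (is_derive_sin (a * u)) h.
by rewrite mulrC.
Qed.

Let contZ (a : R) : continuous (fun u : R => a * u).
Proof. by move=> u; apply: cvgMr; exact: cvg_id. Qed.

Let int_absvX (a : R) : intg I2pi (fun u => `|vsin u| `^ e * cos (a * u)).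
Proof.
apply: continuous_compact_integrable; first exact: segment_compact.
apply: continuous_subspaceT => u; apply: cvgM.
  apply: (@continuous_comp _ _ _ vsin (fun y : R => `|y| `^ e)); first exact: continuous_vsin.
  exact: continuous_absX.
by apply: continuous_comp; [exact: contZ|exact: continuous_cos].
Qed.

(* Integration by parts against |vsin|^e, which vanishes at both ends. *)
Lemma parts_vsinX (m : nat) :
  \int[mu]_(u in I2pi) (e * (pk u * (cos (u / 2) * sin (m%:R * u))) +
     m%:R * (`|vsin u| `^ e * cos (m%:R * u))) = 0.
Proof.
have F0 : `|vsin 0| `^ e * sin (m%:R * 0) = 0 :> R by rewrite mulr0 sin0 mulr0.
have F1 : `|vsin (2 * pi)| `^ e * sin (m%:R * (2 * pi)) = 0 :> R.
  by rewrite vsin2pi normr0 powR0 ?gt_eqF// mul0r.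
transitivity (`|vsin (2 * pi)| `^ e * sin (m%:R * (2 * pi)) - `|vsin 0| `^ e * sin (m%:R * 0)); last first.
  by rewrite F0 F1 subrr.
apply: (@FTC_open _ (fun u => `|vsin u| `^ e * sin (m%:R * u))) => //.
- move=> u; rewrite in_itv /= => hu.
  apply: (@near_eq_is_derive _ _ _ (fun u => vsin u `^ e * sin (m%:R * u))).
    near=> w; rewrite ger0_norm// vsin_ge0//.
    have : w \in `]0, 2 * pi[ by near: w; apply: near_in_itvoo; rewrite in_itv.
    by rewrite in_itv /= => /andP[/ltW -> /ltW ->].
  have h1 := is_derive_vsinX e hu; have h2 := is_derive_sinZ m%:R u.
  apply: (is_derive_eq (is_deriveM h1 h2)).
  have v0 := vsin_gt0 hu; rewrite /pker (gtr0_norm v0) /GRing.scale /=; ring.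
- apply: continuous_subspaceT => u; apply: cvgM.
    apply: (@continuous_comp _ _ _ vsin (fun y : R => `|y| `^ e)); first exact: continuous_vsin.
    exact: continuous_absX.
  by apply: continuous_comp; [exact: contZ|exact: continuous_sin].
- move=> u; rewrite in_itv /= => hu.
  apply: continuousD.
    apply: continuousM; first exact: cst_continuous.
    apply: continuousM; first exact: continuous_absvpow.
    apply: continuousM.
      by apply: continuous_comp; [apply: cvgMl; exact: cvg_id|exact: continuous_cos].
    by apply: continuous_comp; [exact: contZ|exact: continuous_sin].
  apply: continuousM; first exact: cst_continuous.
  apply: continuousM; first exact: continuous_absvpow.
  by apply: continuous_comp; [exact: contZ|exact: continuous_cos].
- apply: intgD => //; apply: intgZ => //.
  apply: intg_pkM.
    apply: measurable_funM; last exact: measurable_sinZ.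
    by have := measurable_cosZ 2^-1; apply: eq_measurable_fun => y _; rewrite mulrC.
  by move=> u; rewrite normrM mulr_ile1.
Unshelve. all: by end_near. Qed.

Lemma pk_vsin u : 0 <= vsin u -> pk u * vsin u = `|vsin u| `^ e.
Proof.
move=> v0; have [->|vn0] := eqVneq (vsin u) 0.
  by rewrite mulr0 normr0 powR0// gt_eqF.
rewrite /pker ger0_norm// -[X in _ * X]powRr1// -powRD ?subrK//.
by rewrite vn0 implybT.
Qed.

Let ltI u : I2pi u -> 0 <= vsin u.
Proof. by rewrite /= in_itv /= => /vsin_ge0. Qed.

(** Product-to-sum formulas express the integration by parts at frequency j + 1 through the
    half-integer frequencies j + 1/2 and j + 3/2. *)
Lemma kcoef_rec j : kcoef j.+1 * (j.+1%:R + e / 2) = kcoef j * (j.+1%:R - e / 2).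
Proof.
have := parts_vsinX j.+1.
have hE u : I2pi u -> e * (pk u * (cos (u / 2) * sin (j.+1%:R * u))) +
     j.+1%:R * (`|vsin u| `^ e * cos (j.+1%:R * u)) =
   (j.+1%:R + e / 2) * (pk u * sin ((j.+1%:R + 2^-1) * u)) -
   (j.+1%:R - e / 2) * (pk u * sin ((j%:R + 2^-1) * u)).
  move=> /ltI v0; rewrite -(pk_vsin v0) /vsin.
  rewrite (_ : (j.+1%:R + 2^-1) * u = j.+1%:R * u + u / 2); last by ring.
  rewrite (_ : (j%:R + 2^-1) * u = j.+1%:R * u - u / 2); last by rewrite -natr1; field.
  by rewrite sinD sinB; field.
rewrite (_ : \int[mu]_(u in _) _ = \int[mu]_(u in I2pi) (
   (j.+1%:R + e / 2) * (pk u * sin ((j.+1%:R + 2^-1) * u)) -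
   (j.+1%:R - e / 2) * (pk u * sin ((j%:R + 2^-1) * u)))); last first.
  by apply: eq_Rintegral => u; rewrite inE => hu; exact: hE.
rewrite RintegralB//; [|exact: intgZ|exact: intgZ].
rewrite !RintegralZl//; try exact: kcoef_int.
by rewrite /kcoef => h; lra.
Qed.

Lemma integral_cosZ (m : nat) : (0 < m)%N -> \int[mu]_(u in I2pi) cos (m%:R * u) = 0.
Proof.
move=> m0; have mn0 : m%:R != 0 :> R by rewrite pnatr_eq0 -lt0n.
have h (u : R) : is_derive u 1 (fun u : R => sin (m%:R * u) / m%:R) (cos (m%:R * u)).
  have := is_deriveZ m%:R^-1 (is_derive_sinZ m%:R u).
  rewrite (_ : (fun u => _ / m%:R) = (m%:R^-1 \*: (fun u => sin (m%:R * u)))); last first.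
    by apply/funext => y; rewrite /= /GRing.scale /= mulrC.
  by move=> h; apply: (is_derive_eq h); rewrite /GRing.scale /= mulKf.
have cc : continuous (fun u : R => cos (m%:R * u)).
  by move=> u; apply: continuous_comp; [exact: contZ|exact: continuous_cos].
transitivity (sin (m%:R * (2 * (pi : R))) / m%:R - sin (m%:R * 0) / m%:R); last first.
  rewrite mulr0 sin0 mul0r subr0.
  suff -> : sin (m%:R * (2 * pi)) = 0 :> R by rewrite mul0r.
  rewrite -cosBpihalf -[_ - _]addrC; have := cosD2piZ (- (pi / 2) : R) m.
  by rewrite /= => ->; rewrite cosN cos_pihalf.
apply: (@FTC_open _ (fun u => sin (m%:R * u) / m%:R)) => //.
- apply: derivable_within_continuous => u _; by have [] := h u.
- by move=> u _; exact: cc.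
- apply: continuous_compact_integrable; first exact: segment_compact.
  exact: continuous_subspaceT.
Qed.

(** The coefficient is half the integral of |vsin|^e. As vsin / 2 lies in [0, 1], this power
    dominates (vsin / 2)^2 = (1 - cos u) / 2, whose integral over a period is pi. *)
Lemma kcoef0_gt0 : 0 < kcoef 0.
Proof.
have i1 : intg I2pi (fun u => `|vsin u| `^ e).
  by apply: (intg_ext _ (int_absvX 0)) => // u _; rewrite mul0r cos0 mulr1.
have -> : kcoef 0 = 2^-1 * \int[mu]_(u in I2pi) (`|vsin u| `^ e).
  rewrite -RintegralZl//; apply: eq_Rintegral => u; rewrite inE => /ltI v0.
  by rewrite -pk_vsin// /vsin add0r [_ * u]mulrC; field.
have i2 : intg I2pi (fun u => 2^-1 * (1 - cos (1%:R * u))).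
  apply: continuous_compact_integrable; first exact: segment_compact.
  apply: continuous_subspaceT => u; apply: cvgMr; apply: cvgB; first exact: cvg_cst.
  by apply: continuous_comp; [exact: contZ|exact: continuous_cos].
rewrite mulr_gt0// ?invr_gt0//.
apply: (@lt_le_trans _ _ (\int[mu]_(u in I2pi) (2^-1 * (1 - cos (1%:R * u))))).
  have i3 : intg I2pi (fun u => cos (1%:R * u)).
    apply: continuous_compact_integrable; first exact: segment_compact.
    by apply: continuous_subspaceT => u; apply: continuous_comp; [exact: contZ|exact: continuous_cos].
  have i4 : intg I2pi (cst 1).
    apply: continuous_compact_integrable; first exact: segment_compact.
    by move=> u; exact: cvg_cst.
  rewrite RintegralZl//; last exact: intgB.
  rewrite RintegralB// integral_cosZ// subr0 Rintegral_cst// mul1r.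
  have mE : mu I2pi = (2 * pi)%:E by rewrite lebesgue_measure_itv/= lte_fin pi2 sube0.
  rewrite (_ : fine _ = 2 * pi); last exact: (congr1 fine mE).
  by rewrite mulr_gt0// invr_gt0.
apply: le_Rintegral => // u /ltI v0.
have v2 : `|vsin u| <= 2 := vsin_le2 u; rewrite ger0_norm// in v2 *.
rewrite mul1r (_ : 2^-1 * (1 - cos u) = (vsin u / 2) ^+ 2); last first.
  by rewrite expr_div_n vsin_sqr; field.
have [->|vn0] := eqVneq (vsin u) 0; first by rewrite mul0r expr0n /= powR_ge0.
have vp : 0 < vsin u by rewrite lt_neqAle eq_sym vn0.
have h01 : 0 < vsin u / 2 <= 1 by rewrite divr_gt0//= ler_pdivrMr// mul1r.
apply: (@le_trans _ _ ((vsin u / 2) `^ e)); last first.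
  by apply: ge0_ler_powR; rewrite ?nnegrE ?ltW//; have /andP[] := h01 => ? ?; lra.
apply: (@le_trans _ _ ((vsin u / 2) `^ 1)).
  rewrite powRr1; last by rewrite divr_ge0.
  by rewrite expr2 ler_piMl//; have /andP[/ltW] := h01.
by apply: ger_powR.
Qed.

Lemma kcoef_gt0 k : 0 < kcoef k.
Proof.
elim: k => [|j IH]; first exact: kcoef0_gt0.
have j1 : 1 <= j.+1%:R :> R by rewrite ler1n.
have [e0' e1'] := (e0, e1).
have h1 : 0 < j.+1%:R + e / 2 by lra.
have h2 : 0 < j.+1%:R - e / 2 by lra.
by have := mulr_gt0 IH h2; rewrite -kcoef_rec pmulr_lgt0.
Qed.

(** Convexity of exp between ln x and 0 with weights e and 1 - e gives x^e <= e x + 1 - e. *)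
Lemma bernoulli_powR (x : R) : 0 <= x <= 1 -> x `^ e <= 1 - e * (1 - x).
Proof.
move=> /andP[x0 x1]; have [->|xn0] := eqVneq x 0.
  by rewrite powR0 ?gt_eqF// subr0 mulr1 subr_ge0.
have xp : 0 < x by rewrite lt_neqAle eq_sym xn0.
have := convex_expR (Itv01 (ltW e0) e1) (ln x) 0.
by rewrite !convRE /= /unstable.onem expR0 mulr0 addr0 mulr1 lnK ?posrE// /powR gt_eqF//; lra.
Qed.

(** The sequence [kcoef k] times k^e is nondecreasing: (n / (n+1))^e <= 1 - e / (n+1) <= 1 - e / (n
    + 1 + e/2), and the last quantity is the ratio of consecutive coefficients. *)
Lemma kcoef_lower k : (0 < k)%N -> kcoef 1 <= kcoef k * k%:R `^ e.
Proof.
case: k => // k _; elim: k => [|k IH]; first by rewrite powR1 mulr1.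
apply: (le_trans IH); set n := k.+1 in IH *.
have n1 : 1 <= n%:R :> R by rewrite ler1n.
have [e0' e1'] := (e0, e1).
have n0 : 0 < n.+1%:R :> R by rewrite ltr0n.
have r01 : 0 <= (n%:R : R) / n.+1%:R <= 1.
  by rewrite divr_ge0//= ler_pdivrMr// mul1r ler_nat.
have h := bernoulli_powR r01.
have nE : n%:R `^ e = (n%:R / n.+1%:R) `^ e * n.+1%:R `^ e :> R.
  by rewrite -powRM ?divr_ge0// divfK// gt_eqF.
have d1 : 0 < n.+1%:R + e / 2 by lra.
have kE : kcoef n.+1 = kcoef n * ((n.+1%:R - e / 2) / (n.+1%:R + e / 2)).
  by rewrite mulrA -kcoef_rec mulfK// gt_eqF.
rewrite nE kE mulrA ler_wpM2r ?powR_ge0// ler_wpM2l ?(ltW (kcoef_gt0 _))//.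
apply: (le_trans h).
rewrite (_ : n%:R / n.+1%:R = 1 - n.+1%:R^-1); last first.
  by rewrite -[n.+1%:R]natr1; field; rewrite natr1 pnatr_eq0.
rewrite (_ : (n.+1%:R - e / 2) / (n.+1%:R + e / 2) = 1 - e / (n.+1%:R + e / 2)); last first.
  by field; rewrite gt_eqF//; lra.
rewrite (_ : 1 - (1 - n.+1%:R^-1) = n.+1%:R^-1); last by ring.
rewrite lerD2l lerN2 ler_wpM2l ?(ltW e0)//.
by rewrite lef_pV2 ?posrE//; lra.
Qed.

(** The sum is empty for m = 1: the symbol, proportional to m times this sum, vanishes at frequency
    1, in accordance with translation invariance. Unknown perturbations therefore start at frequency
    2. *)
Definition ksum (m : nat) : R := \sum_(1 <= k < m) kcoef k.

Lemma ksum_ge m : (1 < m)%N -> kcoef 1 <= ksum m.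
Proof.
move=> m1; rewrite /ksum big_ltn// lerDl sumr_ge0// => k _.
exact/ltW/kcoef_gt0.
Qed.

Local Notation phi := (fun u => `|vsin u| `^ (e - 2)).

Lemma measurable_phi : measurable_fun [set: R] phi.
Proof. by apply: measurable_absX; exact: measurable_vsin. Qed.

Lemma phi_vsin u : 0 < vsin u -> `|vsin u| `^ (e - 2) * vsin u = pk u.
Proof.
move=> v0; rewrite /pker gtr0_norm// -[X in _ * X]powRr1 ?ltW// -powRD.
  by congr (_ `^ _); ring.
by rewrite lt0r_neq0 ?implybT.
Qed.

(** Each summand times vsin u is pk u (cos (k u) - cos ((k + 1) u)). *)
Let telescope u m : \sum_(1 <= k < m.+1) (pk u * sin ((k%:R + 2^-1) * u)) * vsin u =
  pk u * (cos u - cos (m.+1%:R * u)).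
Proof.
elim: m => [|m IH]; first by rewrite big_geq// mul1r subrr mulr0.
rewrite big_nat_recr//= IH /vsin.
rewrite (_ : (m.+1%:R + 2^-1) * u = m.+1%:R * u + u / 2); last by ring.
rewrite (_ : m.+2%:R * u = m.+1%:R * u + (u / 2 + u / 2)); last by rewrite -[m.+2%:R]natr1; field.
set a := m.+1%:R * u; rewrite !(sinD, cosD) -!expr2.
have := cos2Dsin2 (u / 2) => cs.
have -> : cos (u / 2) ^+ 2 = 1 - sin (u / 2) ^+ 2 by lra.
ring.
Qed.

(* The integral is [2 * pi] times the symbol, at frequency [m], of the linearised operator. *)
Lemma integral_multiplier m : (0 < m)%N ->
  intg I2pi (fun u => phi u * (e / 2 * (sin u * sin (m%:R * u)) +
     m%:R * ((1 - cos (m%:R * u)) * cos u))) /\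
  \int[mu]_(u in I2pi) (phi u * (e / 2 * (sin u * sin (m%:R * u)) +
     m%:R * ((1 - cos (m%:R * u)) * cos u))) = m%:R * ksum m.
Proof.
case: m => // m _.
(* Away from the end points the integrand is B + S. B is half the derivative of |vsin|^e sin ((m +
   1) u), hence integrates to 0; S telescopes after multiplication by vsin and integrates to the
   claimed multiple of [ksum]. *)
pose B u := 2^-1 * (e * (pk u * (cos (u / 2) * sin (m.+1%:R * u))) +
     m.+1%:R * (`|vsin u| `^ e * cos (m.+1%:R * u))).
pose S u := m.+1%:R * \sum_(1 <= k < m.+1) (pk u * sin ((k%:R + 2^-1) * u)).
have iB0 : intg I2pi (fun u => e * (pk u * (cos (u / 2) * sin (m.+1%:R * u))) +
     m.+1%:R * (`|vsin u| `^ e * cos (m.+1%:R * u))).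
  apply: intgD => //; apply: intgZ => //.
  apply: intg_pkM.
    apply: measurable_funM; last exact: measurable_sinZ.
    by have := measurable_cosZ 2^-1; apply: eq_measurable_fun => y _; rewrite mulrC.
  by move=> u; rewrite normrM mulr_ile1.
have iB : intg I2pi B by exact: intgZ.
have iS0 n : intg I2pi (fun u => \sum_(1 <= k < n) (pk u * sin ((k%:R + 2^-1) * u))) /\
  \int[mu]_(u in I2pi) (\sum_(1 <= k < n) (pk u * sin ((k%:R + 2^-1) * u))) = ksum n.
  elim: n => [|n [IH1 IH2]].
    rewrite /ksum big_geq//; split.
      apply: (intg_ext _ (intgZ _ 0 pi_int)) => // u _; by rewrite mul0r big_geq.
    by under eq_Rintegral do rewrite big_geq//; rewrite Rintegral_cst// mul0r.
  case: n IH1 IH2 => [|n] IH1 IH2.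
    rewrite /ksum big_geq//; split.
      apply: (intg_ext _ (intgZ _ 0 pi_int)) => // u _; by rewrite mul0r big_geq.
    by under eq_Rintegral do rewrite big_geq//; rewrite Rintegral_cst// mul0r.
  have E u : \sum_(1 <= k < n.+2) (pk u * sin ((k%:R + 2^-1) * u)) =
     \sum_(1 <= k < n.+1) (pk u * sin ((k%:R + 2^-1) * u)) +
      pk u * sin ((n.+1%:R + 2^-1) * u) by rewrite big_nat_recr.
  rewrite (funext E); split; first exact: intgD.
  rewrite (RintegralD mI IH1 (kcoef_int n.+1)) IH2.
  by rewrite /ksum [RHS]big_nat_recr.
have [iS1 iS2] := iS0 m.+1.
have iS : intg I2pi S by exact: intgZ.
have iBS : intg I2pi (fun u => B u + S u) by exact: intgD.
have mA : measurable_fun [set: R] (fun u => phi u * (e / 2 * (sin u * sin (m.+1%:R * u)) +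
     m.+1%:R * ((1 - cos (m.+1%:R * u)) * cos u))).
  have ms1 : measurable_fun [set: R] (fun u : R => sin u).
    by have := measurable_sinZ 1; apply: eq_measurable_fun => y _; rewrite mul1r.
  have mc1 : measurable_fun [set: R] (fun u : R => cos u).
    by have := measurable_cosZ 1; apply: eq_measurable_fun => y _; rewrite mul1r.
  apply: measurable_funM; first exact: measurable_phi.
  apply: measurable_funD; apply: measurable_funM => //; apply: measurable_funM => //.
    exact: measurable_sinZ.
  by apply: measurable_funB => //; exact: measurable_cosZ.
have mBS : measurable_fun [set: R] (fun u => B u + S u).
  apply: measurable_funD; apply: measurable_funM => //.
    apply: measurable_funD; apply: measurable_funM => //; apply: measurable_funM.
    - exact: measurable_pker.
    - apply: measurable_funM; last exact: measurable_sinZ.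
      by have := measurable_cosZ 2^-1; apply: eq_measurable_fun => y _; rewrite mulrC.
    - by apply: measurable_absX; exact: measurable_vsin.
    - exact: measurable_cosZ.
  apply: measurable_sum => k; apply: measurable_funM; first exact: measurable_pker.
  exact: measurable_sinZ.
have E u : 0 < u < 2 * pi -> B u + S u = phi u * (e / 2 * (sin u * sin (m.+1%:R * u)) +
     m.+1%:R * ((1 - cos (m.+1%:R * u)) * cos u)).
  move=> /vsin_gt0 v0; apply: (mulIf (lt0r_neq0 v0)).
  rewrite mulrDl /S -[X in _ + X = _]mulrA mulr_suml telescope /B -pk_vsin ?ltW//.
  rewrite [RHS]mulrAC phi_vsin// (sin_vsin u).
  have v2 := vsin_sqr u; have -> : cos u = 1 - vsin u ^+ 2 / 2 by rewrite v2; field.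
  by field.
have [i1 ->] := intg_eq_oo mBS mA E iBS.
split=> //; rewrite RintegralD// /B RintegralZl// parts_vsinX mulr0 add0r.
by rewrite /S RintegralZl// iS2.
Qed.

End Multiplier.

(** * Bounds of the singular kernel by the weights *)

Section KernelBound.
Context {R : realType}.
Local Notation mu := (@lebesgue_measure R).
Local Notation I2pi := (`[0, 2 * pi]%classic : set R).
Local Notation Ipi := (`[0, pi]%classic : set R).
Implicit Types (g : R -> R).

Let mI : @measurable _ (measurableTypeR R) I2pi. Proof. by []. Qed.
Let mI1 : @measurable _ (measurableTypeR R) Ipi. Proof. by []. Qed.
Let pi0 : 0 < (pi : R). Proof. exact: pi_gt0. Qed.

Variables (e : R) (e0 : 0 < e) (e1 : e <= 1).
Local Notation pk := (pker e).
Local Notation phi := (fun u => `|vsin u| `^ (e - 2)).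

Let qf (k : nat) (w : R) := w / (1 + k%:R * w).

Let den1 (k : nat) (w : R) : 0 <= w -> 1 <= 1 + k%:R * w.
Proof. by move=> w0; rewrite lerDl mulr_ge0. Qed.

Let den0 (k : nat) (w : R) : 0 <= w -> 0 < 1 + k%:R * w.
Proof. by move=> w0; apply: lt_le_trans (den1 k w0); rewrite ltr01. Qed.

Let qf_ge0 k w : 0 <= w -> 0 <= qf k w.
Proof. by move=> w0; rewrite /qf divr_ge0// (le_trans ler01)// den1. Qed.

Let qf_le k w : 0 <= w -> (0 < k)%N -> qf k w <= k%:R^-1.
Proof.
move=> w0 k0; have kp : 0 < k%:R :> R by rewrite ltr0n.
by rewrite /qf ler_pdivrMr ?den0// mulrDr mulr1 mulKf ?gt_eqF// lerDr invr_ge0 ltW.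
Qed.

(** The function w / (1 + k w) has derivative (1 + k w)^-2, so psi k times cos (u / 2) is, on (0,
    pi), the derivative of (w / (1 + k w))^e / e at w = vsin u. Its integral is thus explicit and of
    order k^-e, the size of the lower bound on [kcoef]. *)
Definition psi (k : nat) (u : R) : R :=
  qf k `|vsin u| `^ (e - 1) * (1 + k%:R * `|vsin u|) ^- 2.

Let psi_ge0 k u : 0 <= psi k u.
Proof. by rewrite /psi mulr_ge0 ?powR_ge0// invr_ge0 exprn_ge0// ltW ?den0. Qed.

Let measurable_absvsin : measurable_fun [set: R] (fun u : R => `|vsin u|).
Proof. by apply: measurableT_comp => //; exact: measurable_vsin. Qed.

Let continuous_den k : continuous (fun u : R => (1 + k%:R * `|vsin u|)^-1).
Proof.
move=> u; apply: cvgV; first by rewrite gt_eqF// den0.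
apply: cvgD; first exact: cvg_cst.
apply: cvgMr; apply: cvg_norm; exact: continuous_vsin.
Qed.

Let continuous_den2 k : continuous (fun u : R => (1 + k%:R * `|vsin u|) ^- 2).
Proof.
rewrite (_ : (fun u => _) = (fun u => (1 + k%:R * `|vsin u|)^-1 * (1 + k%:R * `|vsin u|)^-1)).
  by move=> u; apply: cvgM; exact: continuous_den.
by apply/funext => w; rewrite expr2 invfM.
Qed.

Let continuous_q k : continuous (fun u : R => qf k `|vsin u|).
Proof.
move=> u; apply: cvgM; last exact: continuous_den.
by apply: cvg_norm; exact: continuous_vsin.
Qed.

Lemma measurable_psi k : measurable_fun [set: R] (psi k).
Proof.
apply: measurable_funM.
  rewrite (_ : (fun u => _) = (fun u => `|qf k `|vsin u| | `^ (e - 1))).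
    by apply: measurable_absX; apply: continuous_measurable_fun; exact: continuous_q.
  by apply/funext => u; rewrite [in RHS]ger0_norm// qf_ge0.
by apply: continuous_measurable_fun; exact: continuous_den2.
Qed.

Let psi_le_pk k u : 0 < vsin u -> psi k u <= (1 + 2 * k%:R) * pk u.
Proof.
move=> v0; have w0 : 0 < `|vsin u| by rewrite gtr0_norm.
have w2 := vsin_le2 u.
have d1 := den1 k (ltW w0); have d0 := den0 k (ltW w0).
have k0 : 0 <= k%:R :> R by [].
have kd : 0 < 1 + 2 * k%:R :> R by lra.
apply: (@le_trans _ _ (qf k `|vsin u| `^ (e - 1))).
  rewrite /psi ler_piMr ?powR_ge0// invf_le1 ?exprn_gt0//.
  by rewrite expr2 mulr_ege1.
have di : 0 <= (1 + k%:R * `|vsin u|)^-1 by rewrite invr_ge0 ltW.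
rewrite /qf (powRM _ (ltW w0) di) [leLHS]mulrC; apply: ler_wpM2r; first exact: powR_ge0.
rewrite -(powR_inv1 (ltW d0)) -powRrM mulN1r opprB.
apply: (@le_trans _ _ ((1 + k%:R * `|vsin u|) `^ 1)).
  by apply: ler_powR => //; have := e0; lra.
rewrite (powRr1 (ltW d0)) lerD2l mulrC.
by apply: ler_wpM2r.
Qed.

Lemma psi_int k : intg I2pi (psi k).
Proof.
have mp := measurable_psi k; have mq := @measurable_pker _ e.
pose B u := (1 + 2 * k%:R) * pk u.
have iB : intg I2pi B by apply: intgZ => //; exact: pker_int.
pose G u := if (0 < u) && (u < 2 * pi) then psi k u else 0.
have mG : measurable_fun [set: R] G.
  apply: measurable_fun_ifT; [|exact: mp|exact: measurable_cst].
  apply: measurable_and; apply: measurable_fun_ltr => //; exact: measurable_cst.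
have iG : intg I2pi G.
  apply: (intg_le _ _ _ iB) => //; first exact: measurable_funTS.
  move=> u _; rewrite /G; case: ifP => [/vsin_gt0 v0|_]; last by rewrite normr0 mulr_ge0 ?powR_ge0// addr_ge0// mulr_ge0.
  by rewrite ger0_norm//; exact: psi_le_pk.
by apply: (intg_eq_oo mG mp _ iG).1 => u hu; rewrite /G hu.
Qed.

Let psi_half_int k : intg Ipi (psi k).
Proof.
apply: integrableS (psi_int k) => //; apply: subset_itvl; rewrite bnd_simp.
by have := pi0; lra.
Qed.

Let cos_half_bd (u : R) : 0 <= u <= pi -> 0 <= cos (u / 2) <= 1.
Proof.
move=> /andP[u0 u1]; rewrite cos_le1 andbT; apply: cos_ge0_pihalf.
by have := pi0 => ?; apply/andP; split; lra.
Qed.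

Let psicos_int k : intg Ipi (fun u => psi k u * cos (u / 2)).
Proof.
apply: (intg_le _ _ _ (psi_half_int k)) => //.
  apply: measurable_funTS; apply: measurable_funM; first exact: measurable_psi.
  by have := @measurable_cosZ R 2^-1; apply: eq_measurable_fun => y _; rewrite mulrC.
by move=> u _; rewrite normrM (ger0_norm (psi_ge0 _ _)) ler_piMr// ler_norml cos_geN1 cos_le1.
Qed.

Lemma psi_half_FTC k : \int[mu]_(u in Ipi) (psi k u * cos (u / 2)) = qf k 2 `^ e / e.
Proof.
transitivity (`|qf k `|vsin pi| | `^ e / e - `|qf k `|vsin 0| | `^ e / e); last first.
  rewrite vsin_pi vsin0 normr0 {2}/qf mul0r normr0 powR0 ?gt_eqF// mul0r subr0.
  by rewrite [`|2|]ger0_norm// ger0_norm// qf_ge0.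
apply: (@FTC_open _ (fun u => `|qf k `|vsin u| | `^ e / e)) => //.
- move=> u; rewrite in_itv /= => /andP[u0 u1].
  have u02 : 0 < u < 2 * pi by rewrite u0/=; have := pi0; lra.
  have v0 := vsin_gt0 u02.
  have d0 := den0 k (ltW v0).
  apply: (@near_eq_is_derive _ _ _ (fun u => e^-1 * (vsin u / (1 + k%:R * vsin u)) `^ e)).
    near=> w.
    have v0w : 0 <= vsin w.
      have : w \in `]0, 2 * pi[ by near: w; apply: near_in_itvoo; rewrite in_itv.
      by rewrite in_itv /= => /andP[/ltW h1 /ltW h2]; rewrite vsin_ge0// h1 h2.
    by rewrite (ger0_norm v0w) (ger0_norm (qf_ge0 _ v0w)) mulrC.
  have h1 := is_derive_vsin u.
  have h2 := is_deriveD (is_derive_cst (1:R) u 1) (is_deriveZ k%:R h1).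
  have d0' : (cst 1 + k%:R \*: vsin) u != 0 :> R by rewrite gt_eqF.
  have h3 := is_deriveM h1 (is_deriveV d0' h2).
  have q0 : 0 < vsin u / (1 + k%:R * vsin u) by rewrite divr_gt0.
  have h4 := @is_derive1_comp R (fun y : R => y `^ e) (fun u => vsin u / (1 + k%:R * vsin u)) u _ _
    (is_derive1_powR e q0) h3.
  apply: (is_derive_eq (is_deriveZ e^-1 h4)).
  rewrite /psi /qf (gtr0_norm v0) /GRing.scale /= add0r.
  set Q := _ `^ (e - 1).
  rewrite (_ : (cst 1 + k%:R \*: vsin) u = 1 + k%:R * vsin u)//; field.
  by rewrite !gt_eqF.
- by apply: continuous_subspaceT => u; apply: cvgMl; apply: (@continuous_comp _ _ _ (fun u => qf k `|vsin u|) (fun y : R => `|y| `^ e)); [exact: continuous_q|exact: continuous_absX].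
- move=> u; rewrite in_itv /= => /andP[u0 u1].
  have u02 : 0 < u < 2 * pi by rewrite u0/=; have := pi0; lra.
  have v0 := vsin_gt0 u02; have w0 : 0 < `|vsin u| by rewrite gtr0_norm.
  have q0 : 0 < qf k `|vsin u| by rewrite divr_gt0// den0// ltW.
  apply: continuousM; last first.
    by apply: continuous_comp; [apply: cvgMl; exact: cvg_id|exact: continuous_cos].
  apply: continuousM.
    apply: (@continuous_comp _ _ _ (fun u => qf k `|vsin u|) (fun y : R => y `^ (e - 1))); first exact: continuous_q.
    by apply: differentiable_continuous; apply/derivable1_diffP; have [] := is_derive1_powR (e - 1) q0.
  exact: continuous_den2.
Unshelve. all: by end_near. Qed.

(** The explicit primitive only controls psi times cos (u / 2). The unit is split as cos^2 + sin^2: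
    the first part is below cos (u / 2), while sin (u / 2)^2 = vsin^2 / 4 turns the second into
    qf^(e + 1) / 4, which is at most k^-e. *)
Let psi_pointwise k u : (0 < k)%N -> 0 <= u <= pi ->
  psi k u <= psi k u * cos (u / 2) + k%:R^-1 `^ e.
Proof.
move=> k0 hu; have /andP[c0 c1] := cos_half_bd hu; have p0 := psi_ge0 k u.
have w0 : 0 <= `|vsin u| by [].
have cs := cos2Dsin2 (u / 2).
have s2 : sin (u / 2) ^+ 2 = `|vsin u| ^+ 2 / 4 by rewrite -normrX ger0_norm ?sqr_ge0// /vsin; field.
have kp : 0 < k%:R :> R by rewrite ltr0n.
have q0 := qf_ge0 k w0; have qk := qf_le w0 k0.
have d0 := den0 k w0.
have k1 : psi k u * cos (u / 2) ^+ 2 <= psi k u * cos (u / 2).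
  by apply: ler_wpM2l => //; rewrite expr2; exact: ler_piMl.
have k2 : psi k u * sin (u / 2) ^+ 2 <= k%:R^-1 `^ e.
  apply: (@le_trans _ _ (qf k `|vsin u| `^ e)); last first.
    by apply: ge0_ler_powR; rewrite ?nnegrE ?invr_ge0// ltW.
  have -> : psi k u * sin (u / 2) ^+ 2 = qf k `|vsin u| `^ (e - 1) * (qf k `|vsin u| * qf k `|vsin u|) / 4.
    by rewrite s2 /psi /qf; set Q := _ `^ _; field; rewrite gt_eqF.
  have [->|qn0] := eqVneq (qf k `|vsin u|) 0; first by rewrite !mulr0 mul0r powR_ge0.
  have qp : 0 < qf k `|vsin u| by rewrite lt_neqAle eq_sym qn0.
  have -> : qf k `|vsin u| `^ e = qf k `|vsin u| `^ (e - 1) * qf k `|vsin u|.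
    by rewrite -[X in _ = _ * X]powRr1// -powRD ?subrK// qn0 implybT.
  rewrite -mulrA; apply: ler_wpM2l; first exact: powR_ge0.
  have k11 : k%:R^-1 <= 1 :> R by rewrite invf_le1// ler1n.
  set q := qf _ _ in q0 qk qp *.
  by have := ler_wpM2l q0 (le_trans qk k11); lra.
have k3 : psi k u = psi k u * cos (u / 2) ^+ 2 + psi k u * sin (u / 2) ^+ 2.
  by rewrite -mulrDr cs mulr1.
by rewrite [leLHS]k3; exact: lerD.
Qed.

Lemma psi_le k : (0 < k)%N ->
  \int[mu]_(u in I2pi) psi k u <= 2 * (e^-1 + pi) * k%:R^-1 `^ e.
Proof.
move=> k0; have kp : 0 < k%:R :> R by rewrite ltr0n.
have ps u : psi k (2 * pi - u) = psi k u by rewrite /psi vsin_refl.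
have [_ ->] := integral_symmetric (measurable_psi k) ps (psi_half_int k).
rewrite -mulrA ler_pM2l// mulrDl.
have i1 : intg Ipi (cst (k%:R^-1 `^ e)).
  apply: continuous_compact_integrable; first exact: segment_compact.
  by move=> u; exact: cvg_cst.
apply: (@le_trans _ _ (\int[mu]_(u in Ipi) (psi k u * cos (u / 2) + k%:R^-1 `^ e))).
  apply: le_Rintegral => //; [exact: psi_half_int|exact: (intgD mI1 (psicos_int k) i1)|].
  by move=> u; rewrite /= in_itv /= => hu; exact: psi_pointwise.
rewrite (RintegralD mI1 (psicos_int k) i1) psi_half_FTC Rintegral_cst//.
have mE : mu Ipi = (pi : R)%:E by rewrite lebesgue_measure_itv/= lte_fin pi0 sube0.
rewrite (_ : fine _ = pi); last exact: (congr1 fine mE).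
apply: lerD; last by rewrite mulrC.
rewrite mulrC; apply: ler_wpM2l; first by rewrite invr_ge0 ltW.
by apply: ge0_ler_powR; rewrite ?nnegrE ?invr_ge0 ?qf_ge0 ?qf_le// ltW.
Qed.

(** As long as m w <= 2, the new term is at least w / 9 because (1 + m w)^2 <= 9; afterwards the
    minimum stays at 2 while the sum can only grow. *)
Let vmin m (w : R) : 0 < w ->
  Num.min (m%:R * w) 2 <= 9 * \sum_(k < m) w * (1 + k%:R * w) ^- 2.
Proof.
move=> w0; elim: m => [|m IH].
  by rewrite big_ord0 mulr0 mul0r ge_min lexx.
rewrite big_ord_recr /= mulrDr.
have d0 := den0 m (ltW w0).
have [h|h] := leP (m%:R * w) 2; last first.
  rewrite ge_min; apply/orP; right; rewrite (min_r (ltW h)) in IH; apply: (le_trans IH); rewrite lerDl.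
  by rewrite mulr_ge0// divr_ge0 ?(ltW w0)// exprn_ge0// ltW.
rewrite (min_l h) in IH.
rewrite ge_min; apply/orP; left; rewrite -[m.+1%:R]natr1 mulrDl mul1r; apply: lerD => //.
rewrite mulrA ler_pdivlMr ?exprn_gt0// mulrC; apply: ler_wpM2r; first exact: ltW.
rewrite (_ : 9 = 3 ^+ 2); last by ring.
by rewrite lerXn2r ?nnegrE ?(ltW d0)//; lra.
Qed.

(** After [vmin], phi times vsin is |vsin|^(e - 1), and this negative or zero power is at most the
    same power of the smaller quantity vsin / (1 + k vsin) that enters psi k. *)
Lemma phi_min_le m u : 0 < u < 2 * pi ->
  phi u * Num.min (m%:R * vsin u) 2 <= 9 * \sum_(k < m) psi k u.
Proof.
move=> hu; have v0 := vsin_gt0 hu; have w0 := gtr0_norm v0.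
apply: (le_trans (ler_wpM2l (powR_ge0 _ _) (vmin m v0))).
rewrite mulrCA ler_pM2l// mulr_sumr; apply: ler_sum => k _.
have d0 := den0 k (ltW v0); have d1 := den1 k (ltW v0).
rewrite mulrA phi_vsin// /psi w0; apply: ler_wpM2r.
  by rewrite invr_ge0 exprn_ge0// ltW.
have q0 : 0 < qf k (vsin u) by rewrite divr_gt0.
have qv : qf k (vsin u) <= vsin u by rewrite /qf ler_pdivrMr// ler_peMr// ltW.
rewrite /pker w0 -[e - 1]opprK (powRN (vsin u)) (powRN (qf k (vsin u))).
rewrite lef_pV2 ?posrE ?powR_gt0//.
apply: ge0_ler_powR; rewrite ?nnegrE ?(ltW q0) ?(ltW v0)//.
by have := e1; lra.
Qed.

Let sin_mul_le m (x : R) : `|sin (m%:R * x)| <= m%:R * `|sin x|.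
Proof.
elim: m => [|m IH]; first by rewrite !mul0r sin0 normr0.
rewrite -natr1 !mulrDl !mul1r sinD (le_trans (ler_normD _ _))//; apply: lerD.
  by rewrite normrM (le_trans _ IH)// ler_piMr// ler_norml cos_geN1 cos_le1.
by rewrite normrM ler_piMl// ler_norml cos_geN1 cos_le1.
Qed.

Lemma sin_half_le (m : nat) (u : R) : 0 <= vsin u -> 2 * `|sin (m%:R * (u / 2))| <= Num.min (m%:R * vsin u) 2.
Proof.
move=> v0; rewrite le_min; apply/andP; split; last first.
  by rewrite ler_piMr// ler_norml sin_geN1 sin_le1.
apply: (le_trans (ler_wpM2l _ (sin_mul_le m (u / 2)))) => //.
by rewrite -(ger0_norm v0) /vsin normrM [`|2|]ger0_norm// mulrCA.
Qed.

Section Kernel.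
Variables (m : nat) (h : R -> R).
Hypotheses (mh : measurable_fun [set: R] h)
  (hm : forall u, `|h u| <= 2 * `|sin (m%:R * (u / 2))|).

Let mphicos : measurable_fun [set: R] (fun u => phi u * cos u).
Proof.
apply: measurable_funM; first exact: measurable_phi.
by have := @measurable_cosZ R 1; apply: eq_measurable_fun => y _; rewrite mul1r.
Qed.

Lemma kernel_bound : intg I2pi (fun u => phi u * cos u * h u) /\
  \int[mu]_(u in I2pi) `|phi u * cos u * h u| <=
  9 * \sum_(k < m) \int[mu]_(u in I2pi) psi k u.
Proof.
pose S u := 9 * \sum_(k < m) psi k u.
have iS0 n : intg I2pi (fun u => \sum_(k < n) psi k u) /\
    \int[mu]_(u in I2pi) (\sum_(k < n) psi k u) = \sum_(k < n) \int[mu]_(u in I2pi) psi k u.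
  elim: n => [|n [IH1 IH2]].
    rewrite big_ord0; split.
      apply: (intg_ext _ (intgZ _ 0 (psi_int 0))) => // u _; by rewrite mul0r big_ord0.
    by under eq_Rintegral do rewrite big_ord0; rewrite Rintegral_cst// mul0r.
  have E u : \sum_(k < n.+1) psi k u = \sum_(k < n) psi k u + psi n u by rewrite big_ord_recr.
  rewrite (funext E); split; first by apply: intgD => //; exact: psi_int.
  by rewrite (RintegralD mI IH1 (psi_int n)) IH2 big_ord_recr.
have [j1 j2] := iS0 m.
have iS : intg I2pi S by exact: intgZ.
(* The pointwise bound holds on the open interval only, so the kernel is cut off at the end points
   before integrating. *)
pose G u := if (0 < u) && (u < 2 * pi) then phi u * cos u * h u else 0.
have mf : measurable_fun [set: R] (fun u => phi u * cos u * h u) by exact: measurable_funM.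
have mG : measurable_fun [set: R] G.
  apply: measurable_fun_ifT; [|exact: mf|exact: measurable_cst].
  apply: measurable_and; apply: measurable_fun_ltr => //; exact: measurable_cst.
have GS u : I2pi u -> `|G u| <= S u.
  move=> _; rewrite /G; case: ifP => [hu|_]; last first.
    by rewrite normr0 mulr_ge0// sumr_ge0.
  apply: le_trans (phi_min_le m hu); have v0 := vsin_gt0 hu.
  rewrite !normrM (ger0_norm (powR_ge0 _ _)) -mulrA; apply: ler_wpM2l; first exact: powR_ge0.
  apply: (le_trans _ (sin_half_le m (ltW v0))); apply: le_trans (hm u).
  by rewrite ler_piMl// ler_norml cos_geN1 cos_le1.
have iG : intg I2pi G by apply: (intg_le _ _ GS iS) => //; exact: measurable_funTS.
have GE u : 0 < u < 2 * pi -> G u = phi u * cos u * h u by move=> hu; rewrite /G hu.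
have [k1 _] := intg_eq_oo mG mf GE iG.
split=> //.
have mGn : measurable_fun [set: R] (fun u => `|G u|) by exact: measurableT_comp.
have mfn : measurable_fun [set: R] (fun u => `|phi u * cos u * h u|) by exact: measurableT_comp.
have GEn u : 0 < u < 2 * pi -> `|G u| = `|phi u * cos u * h u| by move=> /GE ->.
have [_ ->] := intg_eq_oo mGn mfn GEn (intg_norm iG).
apply: (Rintegral_norm_le _ iS) => //; first exact: measurable_funTS.
by rewrite /S RintegralZl// j2.
Qed.

End Kernel.

(** The terms of order k^-e are compared one by one with [kcoef], so the growth of the sums never
    has to be known. The term k = 0 has no such bound and is absorbed by the lower bound [kcoef e 1]
    of [ksum]. *)
Lemma psi_sum_le : exists2 C, 0 <= C & forall m, (1 < m)%N ->
  9 * \sum_(k < m) \int[mu]_(u in I2pi) psi k u <= C * ksum e m.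
Proof.
pose c1 := kcoef e 1; have c10 : 0 < c1 by exact: kcoef_gt0.
pose P0 := \int[mu]_(u in I2pi) psi 0 u.
have P00 : 0 <= P0 by apply: Rintegral_ge0.
have ei : 0 <= e^-1 + pi by rewrite addr_ge0 ?invr_ge0 ?ltW.
exists (9 * (P0 + 2 * (e^-1 + pi)) / c1).
  by rewrite divr_ge0 ?(ltW c10)// mulr_ge0// addr_ge0// mulr_ge0.
move=> [//|m] m1; rewrite -!mulrA ler_pM2l// big_ord_recl /= -/P0.
have h1 : P0 <= P0 * (c1^-1 * ksum e m.+1).
  by rewrite ler_peMr// mulrC ler_pdivlMr// mul1r ksum_ge.
have h2 : \sum_(i < m) \int[mu]_(u in I2pi) psi (bump 0 i) u <= 2 * (e^-1 + pi) * (c1^-1 * ksum e m.+1).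
  rewrite /ksum big_add1 /= big_mkord !mulr_sumr; apply: ler_sum => k _.
  apply: (le_trans (psi_le _)) => //.
  apply: ler_wpM2l; first by rewrite mulr_ge0.
  have n0 : 0 <= (bump 0 k)%:R :> R by [].
  have np : 0 < (bump 0 k)%:R `^ e :> R by rewrite powR_gt0// ltr0n.
  have -> : (bump 0 k)%:R^-1 `^ e = ((bump 0 k)%:R `^ e)^-1 :> R.
    by rewrite -(powR_inv1 n0) -powRrM mulN1r powRN.
  rewrite mulrC ler_pdivlMr// mulrC ler_pdivrMr//.
  exact: kcoef_lower.
by rewrite [leRHS]mulrDl lerD.
Qed.

End KernelBound.

(** * Unknowns and the linearised operator *)

Section Unknowns.
Context {R : realType}.
Local Notation mu := (@lebesgue_measure R).
Local Notation I2pi := (`[0, 2 * pi]%classic : set R).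
Variables (e : R) (e0 : 0 < e) (e1 : e <= 1).

Definition phik (u : R) : R := `|vsin u| `^ (e - 2).
Definition ks (u : R) : R := phik u * sin u.
Definition kc (u : R) : R := phik u * cos u.
Definition Wt (n : nat) : R := ksum e n.+2.
(** The inverse of a lower bound of all the weights, hence the constant of the embeddings into the
    unweighted Wiener algebra. *)
Definition Kt : R := (kcoef e 1)^-1.

Let kc10 : 0 < kcoef e 1. Proof. exact: kcoef_gt0. Qed.

Lemma Kt_gt0 : 0 < Kt. Proof. by rewrite invr_gt0. Qed.
Let Kt_ge0 : 0 <= Kt. Proof. exact/ltW/Kt_gt0. Qed.

Lemma Wt_ge n : 1 <= Kt * Wt n.
Proof. by rewrite /Kt mulrC ler_pdivlMr// mul1r ksum_ge. Qed.

Lemma Wt_gt0 n : 0 < Wt n.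
Proof. by apply: lt_le_trans kc10 _; exact: ksum_ge. Qed.

Let Wt_ge0 n : 0 <= Wt n. Proof. exact/ltW/Wt_gt0. Qed.

Lemma phik_periodic : periodic2pi phik.
Proof. by move=> u; rewrite /phik vsinD normrN. Qed.

Lemma measurable_sin1 : measurable_fun [set: R] (fun u : R => sin u).
Proof. by have := @measurable_sinZ R 1; apply: eq_measurable_fun => y _; rewrite mul1r. Qed.

Lemma measurable_cos1 : measurable_fun [set: R] (fun u : R => cos u).
Proof. by have := @measurable_cosZ R 1; apply: eq_measurable_fun => y _; rewrite mul1r. Qed.

Lemma measurable_phik : measurable_fun [set: R] phik.
Proof. exact: measurable_phi. Qed.

Lemma measurable_ks : measurable_fun [set: R] ks.
Proof. by apply: measurable_funM; [exact: measurable_phik|exact: measurable_sin1]. Qed.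

Lemma measurable_kc : measurable_fun [set: R] kc.
Proof. by apply: measurable_funM; [exact: measurable_phik|exact: measurable_cos1]. Qed.

Lemma ks_periodic : periodic2pi ks.
Proof. by move=> u; rewrite /ks phik_periodic mulr_natl sinD2pi. Qed.

Lemma kc_periodic : periodic2pi kc.
Proof. by move=> u; rewrite /kc phik_periodic mulr_natl cosD2pi. Qed.

Lemma ksN u : ks (- u) = - ks u.
Proof. by rewrite /ks /phik sinN mulrN /vsin mulNr sinN mulrN normrN. Qed.

Lemma kcN u : kc (- u) = kc u.
Proof. by rewrite /kc /phik cosN /vsin mulNr sinN mulrN normrN. Qed.

Lemma ks_int : intg I2pi ks.
Proof.
pose G u := if (0 < u) && (u < 2 * pi) then ks u else 0.
have mG : measurable_fun [set: R] G.
  apply: measurable_fun_ifT; [|exact: measurable_ks|exact: measurable_cst].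
  apply: measurable_and; apply: measurable_fun_ltr => //; exact: measurable_cst.
have iG : intg I2pi G.
  apply: (intg_le _ _ _ (pker_int e0 e1)) => //; first exact: measurable_funTS.
  move=> u _; rewrite /G; case: ifP => [/vsin_gt0 v0|_]; last by rewrite normr0 powR_ge0.
  rewrite /ks /phik sin_vsin mulrA phi_vsin// normrM (ger0_norm (powR_ge0 _ _)).
  by rewrite ler_piMr ?powR_ge0// ler_norml cos_geN1 cos_le1.
by apply: (intg_eq_oo mG measurable_ks _ iG).1 => u hu; rewrite /G hu.
Qed.

Definition Cs : R := \int[mu]_(u in I2pi) `|ks u|.

Let Cc_ex : exists C, 0 <= C /\ forall m, (1 < m)%N ->
  9 * \sum_(k < m) \int[mu]_(u in I2pi) psi e k u <= C * ksum e m.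
Proof. by have [C ? ?] := psi_sum_le e0 e1; exists C. Qed.

(** A definite value is extracted from the existence statement because later constants, down to the
    threshold on eps, are explicit formulas in it. *)
Definition Cc : R := projT1 (cid Cc_ex).
Lemma Cc_ge0 : 0 <= Cc. Proof. by rewrite /Cc; case: cid => C []. Qed.
Let Cc_le m : (1 < m)%N ->
  9 * \sum_(k < m) \int[mu]_(u in I2pi) psi e k u <= Cc * ksum e m.
Proof. by rewrite /Cc; case: cid => C [] _ /= h; exact: h. Qed.

Let halfm (m : nat) (u : R) : m%:R * u = m%:R * (u / 2) + m%:R * (u / 2).
Proof. by field. Qed.

Lemma kcos_bound n : intg I2pi (fun u => kc u * (cos (n.+2%:R * u) - 1)) /\
  \int[mu]_(u in I2pi) `|kc u * (cos (n.+2%:R * u) - 1)| <= Cc * Wt n.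
Proof.
have [||h1 h2] := @kernel_bound R e e0 e1 n.+2 (fun u => cos (n.+2%:R * u) - 1).
- by apply: measurable_funB; [exact: measurable_cosZ|exact: measurable_cst].
- move=> u; rewrite halfm; set a := _ * (u / 2).
  rewrite cosD -!expr2; have -> : cos a ^+ 2 - sin a ^+ 2 - 1 = - (2 * (sin a * sin a)).
    by have := cos2Dsin2 a; rewrite !expr2; lra.
  rewrite normrN normrM [`|2|]ger0_norm// ler_pM2l// normrM ler_piMl//.
  by rewrite ler_norml sin_geN1 sin_le1.
by split => //; apply: (le_trans h2); exact: Cc_le.
Qed.

Lemma ksin_bound n : intg I2pi (fun u => kc u * sin (n.+2%:R * u)) /\
  \int[mu]_(u in I2pi) `|kc u * sin (n.+2%:R * u)| <= Cc * Wt n.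
Proof.
have [||h1 h2] := @kernel_bound R e e0 e1 n.+2 (fun u => sin (n.+2%:R * u)).
- exact: measurable_sinZ.
- move=> u; rewrite halfm; set a := _ * (u / 2).
  have -> : sin (a + a) = 2 * (sin a * cos a) by rewrite sinD; ring.
  rewrite normrM [`|2|]ger0_norm// ler_pM2l// normrM ler_piMr//.
  by rewrite ler_norml cos_geN1 cos_le1.
by split => //; apply: (le_trans h2); exact: Cc_le.
Qed.

(* An unknown is the triple (omega, f, f'), stored as one function on
   [option (bool * R)]: [None] carries omega, [Some (false, x)] carries f x and
   [Some (true, x)] carries f' x. A span over the atoms [ze] thus differentiates f
   term by term. The weight [n.+2%:R * Wt n] is, up to [2 * pi], the symbol of the
   linearised operator. *)
Definition ze (i : option nat) (t : option (bool * R)) : R :=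
  match i, t with
  | None, None => 1
  | Some n, Some (false, x) => cos (n.+2%:R * x)
  | Some n, Some (true, x) => - (n.+2%:R * sin (n.+2%:R * x))
  | _, _ => 0
  end.

Definition zw (i : option nat) : R := if i is Some n then n.+2%:R * Wt n else 1.

Definition Z : R -> (option (bool * R) -> R) -> Prop := cspan ze zw.

Definition om (v : option (bool * R) -> R) : R := v None.
Definition fv (v : option (bool * R) -> R) (x : R) : R := v (Some (false, x)).
Definition gv (v : option (bool * R) -> R) (x : R) : R := v (Some (true, x)).

Lemma zw_ge0 i : 0 <= zw i.
Proof. by case: i => [n|] //=; rewrite mulr_ge0. Qed.

Lemma Z_ge0 M v : Z M v -> 0 <= M. Proof. exact: (span_ge0 zw_ge0). Qed.
Lemma Z_add M M' v v' : Z M v -> Z M' v' -> Z (M + M') (fun t => v t + v' t).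
Proof. exact: (span_add zw_ge0 None). Qed.
Lemma Z_zero M : 0 <= M -> Z M (fun=> 0).
Proof. exact: (span0 _ _ None). Qed.

Let sin_abs1 (x : R) : `|sin x| <= 1. Proof. by rewrite ler_norml sin_geN1 sin_le1. Qed.
Let cos_abs1 (x : R) : `|cos x| <= 1. Proof. by rewrite ler_norml cos_geN1 cos_le1. Qed.

Let n2W n : n.+2%:R <= Kt * (n.+2%:R * Wt n).
Proof. by rewrite mulrCA ler_peMr// Wt_ge. Qed.

Let oneW n : 1 <= Kt * (n.+2%:R * Wt n).
Proof. by apply: le_trans (n2W n); rewrite ler1n. Qed.

Lemma ze_bound i t : `|ze i t| <= (1 + Kt) * zw i.
Proof.
case: i => [n|] /=; last first.
  by case: t => [_|]; rewrite ?normr0 ?normr1 mulr1 ?addr_ge0// lerDl.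
apply: (@le_trans _ _ (Kt * (n.+2%:R * Wt n))); last first.
  by apply: ler_wpM2r; [rewrite mulr_ge0|rewrite lerDr].
case: t => [[[] x]|]; last by rewrite normr0 !mulr_ge0.
  by apply: le_trans (n2W n); rewrite normrN normrM ger0_norm// ler_piMr.
by apply: le_trans (oneW n).
Qed.

Let Kt1 : 0 <= 1 + Kt. Proof. by rewrite addr_ge0. Qed.

Lemma Z_psum_cvg m (V : nat -> option (bool * R) -> R) M t :
  (forall k, Z (m k) (V k)) -> (forall n, series m n <= M) ->
  cvgn (series (fun k => V k t)).
Proof. exact: (span_cvg zw_ge0 Kt1 (fun i => ze_bound i t)). Qed.

Lemma Z_om M v : Z M v -> `|om v| <= M.
Proof.
move=> h; rewrite -[M]mul1r; apply: (span_bound zw_ge0 ler01 _ h) => -[n|] /=.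
  by rewrite normr0 mul1r mulr_ge0.
by rewrite normr1 mulr1.
Qed.

Lemma Z_gv M v : Z M v -> wtrig Wt M (gv v).
Proof.
move=> h; rewrite -[M]mul1r.
apply: (@span_transfer _ _ _ _ _ _ _ trig_e (fun i => Wt i.1) gv 1 ler01 _ _ _ _ h).
  by move=> m G H M' _ _ GH x; exact: GH.
move=> [n|] c /=; rewrite mul1r.
  apply: (@span_ext _ _ _ _ _ _ (fun x => (c * n.+2%:R) * trig_e (n, pi / 2) x)).
    by apply: span_atom => /=; rewrite normrM -mulrA [`|n.+2%:R|]ger0_norm.
  by move=> x; rewrite /trig_e /gv /= cosDpihalf; ring.
apply: (@span_ext _ _ _ _ _ _ (fun=> 0)); last by move=> x; rewrite /gv /= mulr0.
by apply: (span0 _ _ (0%N, 0)); rewrite mulr1.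
Qed.

Lemma Z_fv M v : Z M v -> wtrig Wt M (fv v).
Proof.
move=> h; rewrite -[M]mul1r.
apply: (@span_transfer _ _ _ _ _ _ _ trig_e (fun i => Wt i.1) fv 1 ler01 _ _ _ _ h).
  by move=> m G H M' _ _ GH x; exact: GH.
move=> [n|] c /=; rewrite mul1r.
  apply: (@span_ext _ _ _ _ _ _ (fun x => c * trig_e (n, 0) x)).
    by apply: span_atom => /=; apply: ler_wpM2l => //; rewrite ler_peMl// ler1n.
  by move=> x; rewrite /trig_e /fv /= addr0.
apply: (@span_ext _ _ _ _ _ _ (fun=> 0)); last by move=> x; rewrite /fv /= mulr0.
by apply: (span0 _ _ (0%N, 0)); rewrite mulr1.
Qed.

Lemma WA_fv M v : Z M v -> WA (Kt * M) (fun t => fv v t.1).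
Proof.
move=> h.
apply: (@span_transfer _ _ _ _ _ _ _ wa_e (fun=> 1) (fun v t => fv v t.1) Kt Kt_ge0 _ _ _ _ h).
  by move=> m G H M' _ _ GH x; exact: GH.
move=> [n|] c /=.
  apply: (@WA_ext _ _ (fun t => c * cos (n.+2%:~R * t.1 + 0%:~R * t.2 + 0))).
    apply: (WA_le (WA_scale c (WA_cos n.+2 0 0))).
    by rewrite mulrCA ler_wpM2l.
  by move=> t; rewrite /fv /= mul0r !addr0.
apply: (@WA_ext _ _ (fun=> 0)); last by move=> x; rewrite /fv /= mulr0.
by apply: WA_zero; rewrite mulr1 mulr_ge0.
Qed.

Lemma WA_gv M v : Z M v -> WA (Kt * M) (fun t => gv v t.1).
Proof.
move=> h.
apply: (@span_transfer _ _ _ _ _ _ _ wa_e (fun=> 1) (fun v t => gv v t.1) Kt Kt_ge0 _ _ _ _ h).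
  by move=> m G H M' _ _ GH x; exact: GH.
move=> [n|] c /=.
  apply: (@WA_ext _ _ (fun t => (c * n.+2%:R) * cos (n.+2%:~R * t.1 + 0%:~R * t.2 + pi / 2))).
    apply: (WA_le (WA_scale (c * n.+2%:R) (WA_cos n.+2 0 (pi / 2)))).
    by rewrite mulr1 normrM mulrCA ler_wpM2l// [`|n.+2%:R|]ger0_norm.
  by move=> t; rewrite /gv /= mul0r !addr0 cosDpihalf; ring.
apply: (@WA_ext _ _ (fun=> 0)); last by move=> x; rewrite /gv /= mulr0.
by apply: WA_zero; rewrite mulr1 mulr_ge0.
Qed.

(* With b = (f x - f y) / 2 and q = [cotq v (x, y)], off the diagonal
   (f x - f y)^2 = 4 sin ((x - y) / 2)^2 (q^2 + b^2), which takes the singularity out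
   of the denominator of the self-interaction. *)
Definition cotq (v : option (bool * R) -> R) (t : R * R) : R :=
  let th := (t.1 - t.2) / 2 in
  if sin th == 0 then gv v t.1 else (fv v t.1 - fv v t.2) / 2 * (cos th / sin th).

(** The product of sin (n th) and cot th, with its limit at the zeros of sin th. By the recurrence
    below it is a trigonometric polynomial whose coefficients have total size at most n. *)
Let dir (n : nat) (th : R) : R := if sin th == 0 then n%:R * cos (n%:R * th) else sin (n%:R * th) * (cos th / sin th).

Let dir_rec n th : dir n.+2 th = dir n th + (cos (n.+2%:R * th) + cos (n%:R * th)).
Proof.
have e2 : n.+2%:R * th = n%:R * th + (th + th) by rewrite -[n.+2%:R]natr1 -[n.+1%:R]natr1; ring.
rewrite /dir; case: (eqVneq (sin th) 0) => [s0|s0].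
  have c2 : cos th ^+ 2 = 1 by have := cos2Dsin2 th; rewrite s0 expr0n /= addr0.
  have -> : cos (n.+2%:R * th) = cos (n%:R * th).
    by rewrite e2 cosD cosD sinD s0 -expr2 c2; ring.
  by rewrite -[n.+2%:R]natr1 -[n.+1%:R]natr1; ring.
have h X : X * (cos th / sin th) * sin th = X * cos th by rewrite -mulrA divfK.
apply: (mulIf s0); rewrite (mulrDl (sin (n%:R * th) * _)) !h e2 !(sinD, cosD).
apply/eqP; rewrite -subr_eq0; apply/eqP.
transitivity ((sin (n%:R * th) * cos th + cos (n%:R * th) * sin th) *
  (cos th ^+ 2 + sin th ^+ 2 - 1)); first by ring.
by rewrite cos2Dsin2 subrr mulr0.
Qed.

Let dir0 th : dir 0 th = 0.
Proof. by rewrite /dir; case: ifP => _; rewrite !mul0r// sin0 mul0r. Qed.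

Let dir1 th : dir 1 th = cos th.
Proof. by rewrite /dir; case: eqP => [_|/eqP s0]; rewrite !mul1r// mulrCA divff// mulr1. Qed.

(* [sin (m s) dir n th] with s = (x+y)/2, th = (x-y)/2 has integer frequencies when m = n mod 2. *)
Let WA_dir n : forall m : nat, odd m = odd n ->
  WA n%:R (fun t : R * R => sin (m%:R * ((t.1 + t.2) / 2)) * dir n ((t.1 - t.2) / 2)).
Proof.
have term m n' : odd m = odd n' ->
    WA 1 (fun t : R * R => sin (m%:R * ((t.1 + t.2) / 2)) * cos (n'%:R * ((t.1 - t.2) / 2))).
  move=> mn.
  have [p [q [hp hq]]] : exists p q : int, m%:R + n'%:R = p%:~R * 2 :> R /\ m%:R - n'%:R = q%:~R * 2 :> R.
    have mE : m%:R = (odd n')%:R + m./2%:R * 2 :> R.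
      by rewrite -{1}(odd_double_half m) mn natrD -muln2 natrM.
    have nE : n'%:R = (odd n')%:R + n'./2%:R * 2 :> R.
      by rewrite -{1}(odd_double_half n') natrD -muln2 natrM.
    exists ((odd n' + m./2 + n'./2)%N : int), ((m./2 : int) - (n'./2 : int)).
    by rewrite mE nE; split; rewrite ?intrB -!pmulrn ?natrD; ring.
  have hw := @WA_add R _ _ _ _ (WA_scale 2^-1 (WA_cos p q (- (pi / 2)))) (WA_scale 2^-1 (WA_cos q p (- (pi / 2)))).
  apply: (@WA_le _ (`|2^-1| * 1 + `|2^-1| * 1)); last by rewrite ger0_norm ?invr_ge0//; lra.
  apply: (WA_ext hw) => t; rewrite !cosBpihalf.
  have -> : p%:~R * t.1 + q%:~R * t.2 = m%:R * ((t.1 + t.2) / 2) + n'%:R * ((t.1 - t.2) / 2).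
    have -> : p%:~R = (m%:R + n'%:R) / 2 :> R by rewrite hp mulfK.
    have -> : q%:~R = (m%:R - n'%:R) / 2 :> R by rewrite hq mulfK.
    by field.
  have -> : q%:~R * t.1 + p%:~R * t.2 = m%:R * ((t.1 + t.2) / 2) - n'%:R * ((t.1 - t.2) / 2).
    have -> : p%:~R = (m%:R + n'%:R) / 2 :> R by rewrite hp mulfK.
    have -> : q%:~R = (m%:R - n'%:R) / 2 :> R by rewrite hq mulfK.
    by field.
  by rewrite sinD sinB; field.
have [k] := ubnP n; elim: k n => // k IH [|[|n]] hn m mn.
- apply: (@WA_ext _ _ (fun=> 0)); first exact: WA_zero.
  by move=> t; rewrite dir0 mulr0.
- apply: (WA_ext (term m 1%N mn)) => t; rewrite dir1 mul1r//.
have hIH := IH n (ltnW hn) m _.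
have mn' : odd m = odd n by rewrite mn /= negbK.
apply: (WA_le (WA_ext (WA_add (hIH mn') (WA_add (term m n.+2 mn) (term m n mn'))) _)).
  by move=> t; rewrite dir_rec; ring.
by rewrite -[n.+2%:R]natr1 -[n.+1%:R]natr1; lra.
Qed.

(** For f = cos (n x), s = (x + y) / 2 and th = (x - y) / 2, f(x) - f(y) = - 2 sin (n s) sin (n th),
    so [cotq] is - sin (n s) [dir] n th. Its size n is paid by the factor n in the weight of f. *)
Lemma WA_cotq M v : Z M v -> WA (Kt * M) (cotq v).
Proof.
move=> h.
apply: (@span_transfer _ _ _ _ _ _ _ wa_e (fun=> 1) cotq Kt Kt_ge0 _ _ _ _ h).
  move=> m G H M' _ _ GH t; rewrite /cotq; case: eqP => _; first exact: GH.
  rewrite (_ : series _ = (fun n => (series (fun k => fv (G k) t.1) n - series (fun k => fv (G k) t.2) n) / 2 *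
     (cos ((t.1 - t.2) / 2) / sin ((t.1 - t.2) / 2)))).
    by apply: cvgMl; apply: cvgMl; apply: cvgB; exact: GH.
  by apply/funext => n; rewrite /series /= -sumrB !mulr_suml.
move=> [n|] c /=.
  have hd := WA_scale (- c) (@WA_dir n.+2 n.+2 erefl).
  apply: (WA_le (WA_ext hd _)).
    move=> t; rewrite /cotq /dir /fv /gv /=.
    set th := (t.1 - t.2) / 2; set s := (t.1 + t.2) / 2.
    have -> : n.+2%:R * t.1 = n.+2%:R * s + n.+2%:R * th by rewrite /s /th; field.
    have -> : n.+2%:R * t.2 = n.+2%:R * s - n.+2%:R * th by rewrite /s /th; field.
    case: (eqVneq (sin th) 0) => [s0|s0]; last by rewrite cosD cosB; field.
    have sn0 : sin (n.+2%:R * th) = 0.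
      elim: (n.+2) => [|j IH]; first by rewrite mul0r sin0.
      by rewrite -[j.+1%:R]natr1 mulrDl mul1r sinD IH s0; ring.
    by rewrite sinD sn0; ring.
  by rewrite normrN mulrCA ler_wpM2l.
apply: (@WA_ext _ _ (fun=> 0)).
  by apply: WA_zero; rewrite mulr1 mulr_ge0.
by move=> t; rewrite /cotq /fv /gv /=; case: eqP => _; rewrite ?mulr0// subrr !mul0r.
Qed.

Lemma fv_even M v x : Z M v -> fv v (- x) = fv v x.
Proof.
elim=> {M v} [[n|] c M _|m G H M _ IH _ GH].
- by rewrite /fv /= mulrN cosN.
- by [].
apply: (@cvg_unique _ _ (series (fun k => fv (G k) x) @ \oo)) => //; last exact: GH.
by rewrite (_ : (fun k => fv (G k) x) = (fun k => fv (G k) (- x))); [exact: GH|apply/funext => k; rewrite IH].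
Qed.

Lemma gv_odd M v x : Z M v -> gv v (- x) = - gv v x.
Proof.
elim=> {M v} [[n|] c M _|m G H M _ IH _ GH].
- by rewrite /gv /= [_ * - x]mulrN sinN !mulrN.
- by rewrite /gv /= mulr0 oppr0.
apply: (@cvg_unique _ _ (series (fun k => gv (G k) (- x)) @ \oo)) => //; first exact: GH.
rewrite (_ : series _ = (fun n => - series (fun k => gv (G k) x) n)).
  by apply: cvgN; exact: GH.
by apply/funext => n; rewrite /series /= -sumrN; apply: eq_bigr => k _; rewrite IH.
Qed.

Lemma fv_periodic M v : Z M v -> periodic2pi (fv v).
Proof.
move=> h x; have := WA_periodic x 0 1 0 (WA_fv h); rewrite /= !mul1r.
by apply.
Qed.

End Unknowns.

(** * The linearised operator and its inverse *)

Section Linearised.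
Context {R : realType}.
Local Notation mu := (@lebesgue_measure R).
Local Notation I2pi := (`[0, 2 * pi]%classic : set R).
Variables (e : R) (e0 : 0 < e) (e1 : e <= 1).
Local Notation Kt := (Kt e).
Local Notation Wt := (Wt e).
Local Notation Z := (Z e).
Local Notation Cs := (Cs e).
Local Notation Cc := (Cc e0 e1).

Let mI : @measurable _ (measurableTypeR R) I2pi. Proof. by []. Qed.
Let pi2 : 0 < 2 * (pi : R). Proof. by rewrite mulr_gt0// pi_gt0. Qed.
Let mks := measurable_ks e.
Let pks := @ks_periodic R e.
Let iks := ks_int e0 e1.
Let mkc := measurable_kc e.
Let pkc := @kc_periodic R e.
Let kci n := (kcos_bound e0 e1 n).1.
Let kcl n := (kcos_bound e0 e1 n).2.
Let ksi n := (ksin_bound e0 e1 n).1.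
Let ksl n := (ksin_bound e0 e1 n).2.

Definition Ks := pconv (ks e).
Definition Kd := dconv (kc e).

Lemma Ks_int M G x : WA M G -> intg I2pi (fun y => ks e (x - y) * G (x, y)).
Proof. by move=> h; have [] := pconv_integrable mks pks iks (lexx _) x h. Qed.

Lemma WA_Ks M G : WA M G -> WA (2 * Cs * M) (Ks G).
Proof. exact: (WA_pconv mks pks iks (lexx _)). Qed.

Lemma KsD M M' G G' t : WA M G -> WA M' G' -> Ks (fun t => G t + G' t) t = Ks G t + Ks G' t.
Proof. exact: (pconvD mks pks iks (lexx _)). Qed.

Lemma KsB M M' G G' t : WA M G -> WA M' G' -> Ks (fun t => G t - G' t) t = Ks G t - Ks G' t.
Proof. exact: (pconvB mks pks iks (lexx _)). Qed.

Lemma KsZ c M G t : WA M G -> Ks (fun t => c * G t) t = c * Ks G t.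
Proof. exact: (pconvZ mks pks iks (lexx _)). Qed.

Lemma Kd_int M' G M g x : WA M' G -> wtrig Wt M g ->
  intg I2pi (fun y => kc e (x - y) * (g y - g x) * G (x, y)).
Proof. by move=> h h'; have [] := dconv_integrable mkc pkc (Cc_ge0 e0 e1) kci kcl ksi ksl h x h'. Qed.

Lemma WA_Kd M' G M g : WA M' G -> wtrig Wt M g -> WA (4 * Cc * M' * M) (Kd g G).
Proof. by move=> h; exact: (WA_dconv mkc pkc (Cc_ge0 e0 e1) kci kcl ksi ksl h). Qed.

Lemma KdBl M' G M1 M2 g1 g2 t : WA M' G -> wtrig Wt M1 g1 -> wtrig Wt M2 g2 ->
  Kd (fun x => g1 x - g2 x) G t = Kd g1 G t - Kd g2 G t.
Proof. by move=> h; exact: (dconvBl mkc pkc (Cc_ge0 e0 e1) kci kcl ksi ksl h). Qed.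

Lemma KdBr M M1 M2 g G1 G2 t : wtrig Wt M g -> WA M1 G1 -> WA M2 G2 ->
  Kd g (fun t => G1 t - G2 t) t = Kd g G1 t - Kd g G2 t.
Proof. exact: (dconvBr mkc pkc (Cc_ge0 e0 e1) kci kcl ksi ksl). Qed.

Definition fsnd (v : option (bool * R) -> R) (t : R * R) : R := fv v t.2.

Lemma WA_fsnd M v : Z M v -> WA (Kt * M) (fsnd v).
Proof. by move=> h; exact: (WA_snd (WA_fv e0 e1 h)). Qed.

(** The factor e / 2 is 1 - beta: at first order the numerator contributes f(x) + f(y) and the
    denominator - beta times the same. Only f(y) remains, since the odd kernel [ks] has zero
    integral. *)
Definition Lz (v : option (bool * R) -> R) (x : R) : R :=
  - om v * sin x + (2 * pi)^-1 * (e / 2 * Ks (fsnd v) (x, 0) + Kd (gv v) (fun=> 1) (x, 0)).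

Definition gam (n : nat) : R := n.+2%:R * Wt n / (2 * pi).

Lemma gam_gt0 n : 0 < gam n.
Proof. by rewrite /gam divr_gt0// mulr_gt0// Wt_gt0. Qed.

Let w1 : WA 1 (fun _ : R * R => 1 : R).
Proof. by have := WA_cst (1:R); rewrite normr1. Qed.

Let ks_cos0 (m : nat) : \int[mu]_(u in I2pi) (ks e u * cos (m%:R * u)) = 0.
Proof.
apply: integral_antisymmetric.
- by apply: measurable_funM => //; exact: measurable_cosZ.
- move=> u; rewrite pks; congr (_ * _).
  by rewrite mulrDr -[RHS](cosD2piZ _ m).
- by move=> u; rewrite ksN mulrN cosN mulNr.
- apply: (intg_le _ _ _ (intg_norm iks)) => //.
    by apply: measurable_funTS; apply: measurable_funM => //; exact: measurable_cosZ.
  by move=> u _; rewrite normrM ler_piMr// ler_norml cos_geN1 cos_le1.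
Qed.

Let sin2pin (m : nat) (u : R) : sin (m%:R * (u + 2 * pi)) = sin (m%:R * u).
Proof.
rewrite -!cosBpihalf mulrDr -[RHS](cosD2piZ _ m); congr cos; ring.
Qed.

Let kc_sin0 (n : nat) : \int[mu]_(u in I2pi) (kc e u * sin (n.+2%:R * u)) = 0.
Proof.
apply: integral_antisymmetric => //.
- by apply: measurable_funM => //; exact: measurable_sinZ.
- by move=> u; rewrite pkc sin2pin.
- by move=> u; rewrite kcN mulrN sinN mulrN.
Qed.

Let pconv1 (k : R -> R) x : measurable_fun [set: R] k -> periodic2pi k -> intg I2pi k ->
  pconv k (fun=> 1) (x, 0) = \int[mu]_(u in I2pi) k u.
Proof.
move=> mk pk ik; rewrite /pconv /=; under eq_Rintegral do rewrite mulr1.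
by have [] := integral_period x mk pk ik.
Qed.

Let mkcos n : measurable_fun [set: R] (fun u => kc e u * (cos (n.+2%:R * u) - 1)).
Proof.
apply: measurable_funM => //; apply: measurable_funB; last exact: measurable_cst.
exact: measurable_cosZ.
Qed.

Let mksin n : measurable_fun [set: R] (fun u => kc e u * sin (n.+2%:R * u)).
Proof. by apply: measurable_funM => //; exact: measurable_sinZ. Qed.

Lemma Lz_atom n c x : Lz (fun t => c * ze (Some n) t) x = c * gam n * sin (n.+2%:R * x).
Proof.
have E1 : Ks (fsnd (fun t => c * ze (Some n) t)) (x, 0) =
    c * (sin (n.+2%:R * x) * \int[mu]_(u in I2pi) (ks e u * sin (n.+2%:R * u))).
  rewrite (_ : fsnd _ = (fun t : R * R => c * wa_e (0, n.+2 : int, 0) t)); last first.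
    by apply/funext => t; rewrite /fsnd /fv /wa_e /= mul0r add0r addr0.
  rewrite (KsZ c _ (WA_cos 0 n.+2 0)) /Ks (pconv_cos mks pks iks).
  by rewrite add0r !addr0 /= -!pmulrn ks_cos0 mulr0 add0r.
have E2 : Kd (gv (fun t => c * ze (Some n) t)) (fun=> 1) (x, 0) =
    - (c * n.+2%:R * sin (n.+2%:R * x)) * \int[mu]_(u in I2pi) (kc e u * (cos (n.+2%:R * u) - 1)).
  rewrite (_ : gv _ = (fun x => (c * n.+2%:R) * trig_e (n, pi / 2) x)); last first.
    by apply/funext => y; rewrite /gv /trig_e /= cosDpihalf; ring.
  rewrite /Kd (dconv_atom mkc pkc kci kcl ksi ksl w1) /=.
  rewrite (pconv1 _ (mkcos n))//; last first.
    by move=> u; rewrite pkc; congr (_ * (_ - _)); rewrite mulrDr -[RHS](cosD2piZ _ n.+2).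
  rewrite (pconv1 _ (mksin n))//; last by move=> u; rewrite pkc sin2pin.
  by rewrite kc_sin0 mulr0 addr0 cosDpihalf; ring.
rewrite /Lz E1 E2 /om /= mulr0 oppr0 mul0r add0r.
have [_ hm] := integral_multiplier e0 e1 (isT : (0 < n.+2)%N).
have iS : intg I2pi (fun u => ks e u * sin (n.+2%:R * u)).
  apply: (intg_le _ _ _ (intg_norm iks)) => //.
    by apply: measurable_funTS; apply: measurable_funM => //; exact: measurable_sinZ.
  by move=> u _; rewrite normrM ler_piMr// ler_norml sin_geN1 sin_le1.
have hm2 : e / 2 * \int[mu]_(u in I2pi) (ks e u * sin (n.+2%:R * u)) -
    n.+2%:R * \int[mu]_(u in I2pi) (kc e u * (cos (n.+2%:R * u) - 1)) = n.+2%:R * Wt n.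
  rewrite -hm; transitivity (\int[mu]_(u in I2pi) (e / 2 * (ks e u * sin (n.+2%:R * u)) -
     n.+2%:R * (kc e u * (cos (n.+2%:R * u) - 1)))); last first.
    by apply: eq_Rintegral => u _; rewrite /ks /kc /phik; ring.
  rewrite (RintegralB mI (intgZ mI _ iS) (intgZ mI _ (kci n))).
  by rewrite (RintegralZl _ mI iS) (RintegralZl _ mI (kci n)).
have P0 : 2 * pi != 0 :> R by rewrite gt_eqF.
by rewrite /gam -hm2; move: (2 * pi) P0 => P P0; field.
Qed.

Lemma Lz_om c x : Lz (fun t => c * ze None t) x = - c * sin x.
Proof.
have E1 : Ks (fsnd (fun t => c * ze None t)) (x, 0) = 0.
  have -> : fsnd (fun t => c * ze None t) = (fun t => 0 * 1).
    by apply/funext => t; rewrite /fsnd /fv /= mulr0 mul0r.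
  by rewrite (KsZ _ _ w1) mul0r.
have E2 : Kd (gv (fun t => c * ze None t)) (fun=> 1) (x, 0) = 0.
  rewrite /Kd /dconv; under eq_Rintegral do rewrite /gv /= mulr0 subrr mulr0 mul0r.
  by rewrite Rintegral_cst// mul0r.
by rewrite /Lz E1 E2 /om /= mulr1 mulr0 addr0 mulr0 addr0.
Qed.

Lemma Lz_psum (m : nat -> R) V M v : (forall k, Z (m k) (V k)) ->
  (forall n, series m n <= M) -> psum V v -> psum (fun k => Lz (V k)) (Lz v).
Proof.
move=> hV mM Vv x.
have m0 k : 0 <= m k := Z_ge0 e0 e1 (hV k).
have c1 : series (fun k => om (V k) * sin x) @ \oo --> om v * sin x.
  rewrite (_ : series _ = (fun n => series (fun k => om (V k)) n * sin x)).
    by apply: cvgMl; exact: Vv.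
  by apply/funext => n; rewrite /series /= mulr_suml.
have c2 : series (fun k => Ks (fsnd (V k)) (x, 0)) @ \oo --> Ks (fsnd v) (x, 0).
  apply: (pconv_psum mks pks iks (lexx _) (n := fun k => Kt * m k) (M := Kt * M)).
  - by move=> k; exact: WA_fsnd.
  - by move=> n; rewrite /series /= -mulr_sumr ler_wpM2l ?(ltW (Kt_gt0 e0 e1))//; exact: mM.
  - by move=> t; exact: Vv.
have c3 : series (fun k => Kd (gv (V k)) (fun=> 1) (x, 0)) @ \oo --> Kd (gv v) (fun=> 1) (x, 0).
  apply: (dconv_psum mkc pkc (Cc_ge0 e0 e1) kci kcl ksi ksl w1 (m := m) (M := M)) => //.
  - by move=> k; exact: (Z_gv (hV k)).
  - by move=> t; exact: Vv.
rewrite (_ : series _ = (fun n => - series (fun k => om (V k) * sin x) n +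
  (2 * pi)^-1 * (e / 2 * series (fun k => Ks (fsnd (V k)) (x, 0)) n +
   series (fun k => Kd (gv (V k)) (fun=> 1) (x, 0)) n))).
  rewrite /Lz mulNr; apply: cvgD; first exact: cvgN.
  by apply: cvgMr; apply: cvgD => //; exact: cvgMr.
apply/funext => n; rewrite /series /= mulr_sumr -big_split/= mulr_sumr -sumrN -big_split/=.
by apply: eq_bigr => k _; rewrite /Lz mulNr.
Qed.

Lemma Lz_sub M1 M2 v1 v2 x : Z M1 v1 -> Z M2 v2 ->
  Lz (fun t => v1 t - v2 t) x = Lz v1 x - Lz v2 x.
Proof.
move=> h1 h2.
have E1 : Ks (fsnd (fun t => v1 t - v2 t)) (x, 0) = Ks (fsnd v1) (x, 0) - Ks (fsnd v2) (x, 0).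
  exact: (KsB _ (WA_fsnd h1) (WA_fsnd h2)).
have E2 : Kd (gv (fun t => v1 t - v2 t)) (fun=> 1) (x, 0) =
    Kd (gv v1) (fun=> 1) (x, 0) - Kd (gv v2) (fun=> 1) (x, 0).
  exact: (KdBl _ w1 (Z_gv h1) (Z_gv h2)).
by rewrite /Lz E1 E2 /om; ring.
Qed.

(** The equation is solved for the odd part because the pieces of a series in [WA] need not be odd
    when its sum is. On an atom, frequency 0 has no odd part, frequency 1 is matched by omega and
    the others by cosines; dividing by [gam] cancels the weight up to 2 pi. *)
Lemma Lz_inverse M G : WA M G -> exists v, Z (2 * pi * M) v /\
  forall x, Lz v x = (G (x, 0) - G (- x, 0)) / 2.
Proof.
have pi1 : 1 <= 2 * (pi : R) by have := @pi_ge2 R; lra.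
elim=> {M G} [[[p q] ps] c M hM|m G H M hG IH mM GH]; last first.
  have /choice [V hV] : forall k, exists v, Z (2 * pi * m k) v /\
    forall x, Lz v x = (G k (x, 0) - G k (- x, 0)) / 2 by exact: IH.
  have sM n : series (fun k => 2 * pi * m k) n <= 2 * pi * M.
    by rewrite /series /= -mulr_sumr ler_wpM2l ?(ltW pi2)//; exact: mM.
  pose v t := limn (series (fun k => V k t)).
  have Vv : psum V v by move=> t; exact: (Z_psum_cvg e0 e1 (fun k => (hV k).1) sM).
  exists v; split; first by apply: (@span_sum _ _ _ _ _ (fun k => 2 * pi * m k) V) => // k; exact: (hV k).1.
  have h0 : psum (fun k => Lz (V k)) (Lz v) by exact: Lz_psum (fun k => (hV k).1) sM Vv.
  move=> x; have h1 := h0 x.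
  apply: (cvg_unique _ h1) => //.
  rewrite (_ : series _ = (fun n => (series (fun k => G k (x, 0)) n - series (fun k => G k (- x, 0)) n) / 2)).
    by apply: cvgMl; apply: cvgB; exact: GH.
  by apply/funext => n; rewrite /series /= -sumrB mulr_suml; apply: eq_bigr => k _; rewrite (hV k).2.
rewrite mulr1 in hM.
have cM : `|c * sin ps| <= M.
  by rewrite normrM (le_trans _ hM)// ler_piMr// ler_norml sin_geN1 sin_le1.
have GE x : (c * wa_e (p, q, ps) (x, 0) - c * wa_e (p, q, ps) (- x, 0)) / 2 =
    - (c * sin ps) * sin (p%:~R * x).
  by rewrite /wa_e /= !mulr0 !addr0 mulrN !cosD cosN sinN; field.
have [sg [n [sg1 hsg]]] : exists (s : R) (n : nat), `|s| = 1 /\ forall x, sin (p%:~R * x) = s * sin (n%:R * x).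
  case: p {GE} => n; first by exists 1, n; split; [rewrite normr1|move=> x; rewrite mul1r].
  exists (-1), n.+1; split; first by rewrite normrN1.
  by move=> x; rewrite NegzE mulrNz mulNr sinN mulN1r.
have sM : `|c * sin ps * sg| <= M by rewrite normrM sg1 mulr1.
have M0 : 0 <= M by apply: le_trans cM.
case: n hsg => [|[|n]] hsg.
- exists (fun=> 0); split.
    by apply: (Z_zero e); rewrite mulr_ge0// ltW.
  move=> x; rewrite GE hsg mul0r sin0 !mulr0.
  have := Lz_om 0 x; rewrite (_ : (fun t => _) = (fun=> 0)); last by apply/funext => t; rewrite mul0r.
  by rewrite oppr0 mul0r.
- exists (fun t => c * sin ps * sg * ze None t); split.
    apply: span_atom; rewrite /= mulr1 (le_trans sM)// ler_peMl//.
  by move=> x; rewrite Lz_om GE hsg mul1r; ring.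
have g0 := gam_gt0 n.
exists (fun t => - (c * sin ps * sg / gam n) * ze (Some n) t); split.
  apply: span_atom; rewrite /= normrN normrM normfV (gtr0_norm g0).
  rewrite (_ : _ / _ * _ = 2 * pi * `|c * sin ps * sg|).
    by rewrite ler_wpM2l// ltW.
  have P0 : 2 * pi != 0 :> R by rewrite gt_eqF.
  have W0 : Wt n != 0 by rewrite gt_eqF// Wt_gt0.
  have N0 : n.+2%:R != 0 :> R by rewrite pnatr_eq0.
  by rewrite /gam; move: (2 * pi) P0 n.+2%:R N0 => P P0 N N0; field; rewrite ?P0 ?W0 ?N0.
by move=> x; rewrite Lz_atom GE hsg; field; rewrite gt_eqF.
Qed.

End Linearised.

(** * Lipschitz estimates of the nonlinear terms *)

Section Nonlinear.
Context {R : realType}.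
Variables (e : R) (e0 : 0 < e) (e1 : e <= 1).
Local Notation Kt := (Kt e).
Local Notation Z := (Z e).
Local Notation Cs := (Cs e).
Local Notation Cc := (Cc e0 e1).
Local Notation beta := (1 - e / 2).
Variable (dl : R).

Definition sg v (t : R * R) : R := fv v t.1 + fv v t.2.
Definition bb v (t : R * R) : R := (fv v t.1 - fv v t.2) / 2.
Definition s2 v (t : R * R) : R := fv v t.1 * fv v t.2 + cotq v t * cotq v t + bb v t * bb v t.
Definition a2 v (t : R * R) : R := fv v t.1 * fv v t.2 + gv v t.1 * gv v t.2.
(* With rho = 1 + dl * f, the denominator of the self-interaction integrand is the
   power alpha / 2 of [vsin (x - y) ^+ 2 * (1 + ss v (x, y))], and [aa v (x, y)] is the
   coefficient of sin (x - y) in its numerator. [Vv] is what remains of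
   aa (1 + ss)^(-beta) after its part of degree 1 in dl, and [Uv] what remains of
   rho x (1 + ss)^(-beta) after 1. *)
Definition ss v (t : R * R) : R := dl * (sg v t + dl * s2 v t).
Definition aa v (t : R * R) : R := 1 + dl * (sg v t + dl * a2 v t).
Definition Vv v (t : R * R) : R :=
  dl ^+ 2 * (a2 v t - beta * s2 v t - beta * ((sg v t + dl * a2 v t) * (sg v t + dl * s2 v t))) +
  aa v t * binrem beta 2 (ss v t).
Definition Pv v (t : R * R) : R := 1 + binrem beta 1 (ss v t).
Definition Uv v (t : R * R) : R := dl * (fv v t.1 * Pv v t) + binrem beta 1 (ss v t).
Definition E1 v (t : R * R) : R := (2 * pi)^-1 *
  (dl^-1 * Ks e (Vv v) t + Kd e (gv v) (Uv v) t - dl * (gv v t.1 * Kd e (fv v) (Pv v) t)).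

(** These constants do not involve dl, so the powers of dl in the estimates are explicit. The dl^2
    gained on [Vv] compensates the factor dl^-1 in [E1]. *)
Definition kA : R := 2 * Kt + 6 * Kt ^+ 2.
Definition kV : R := 10 * Kt ^+ 2 + 2 * kA ^+ 2 + 16 * (1 + kA) * kA ^+ 2.
Definition kU : R := 4 * Kt + 4 * kA.
Definition kE1 : R := (2 * pi)^-1 * (2 * Cs * kV + 8 * Cc * kU + 32 * Kt * Cc).

Hypotheses (dl0 : 0 < dl) (dl1 : dl <= 1) (dls : dl * kA <= 16^-1).

Let K0 : 0 < Kt. Proof. exact: Kt_gt0. Qed.
Let kA0 : 0 < kA. Proof. by rewrite /kA; have := K0; have := sqr_ge0 Kt; lra. Qed.
Let beta01 : 0 <= beta <= 1. Proof. by have := e0; have := e1; move=> ? ?; apply/andP; split; lra. Qed.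
Let dn : `|dl| = dl. Proof. by rewrite gtr0_norm. Qed.

Section Pair.
Variables (m : R) (v1 v2 : option (bool * R) -> R).
Hypotheses (m0 : 0 <= m) (h1 : Z 1 v1) (h2 : Z 1 v2) (h12 : Z m (fun t => v1 t - v2 t)).

Lemma WP_fst : WP m Kt (fun t => fv v1 t.1) (fun t => fv v2 t.1).
Proof.
split; [by have := WA_fv e0 e1 h1; rewrite mulr1|by have := WA_fv e0 e1 h2; rewrite mulr1|].
exact: (WA_fv e0 e1 h12).
Qed.

Lemma WP_snd : WP m Kt (fun t => fv v1 t.2) (fun t => fv v2 t.2).
Proof.
split; [by have := WA_fsnd e0 e1 h1; rewrite mulr1|by have := WA_fsnd e0 e1 h2; rewrite mulr1|].
exact: (WA_fsnd e0 e1 h12).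
Qed.

Lemma WP_gfst : WP m Kt (fun t => gv v1 t.1) (fun t => gv v2 t.1).
Proof.
split; [by have := WA_gv e0 e1 h1; rewrite mulr1|by have := WA_gv e0 e1 h2; rewrite mulr1|].
exact: (WA_gv e0 e1 h12).
Qed.

Lemma WP_gsnd : WP m Kt (fun t => gv v1 t.2) (fun t => gv v2 t.2).
Proof.
split; [by have := WA_snd (WA_gv e0 e1 h1); rewrite mulr1|by have := WA_snd (WA_gv e0 e1 h2); rewrite mulr1|].
exact: (WA_snd (WA_gv e0 e1 h12)).
Qed.

Lemma WP_cotq : WP m Kt (cotq v1) (cotq v2).
Proof.
split; [by have := WA_cotq e0 e1 h1; rewrite mulr1|by have := WA_cotq e0 e1 h2; rewrite mulr1|].
apply: (WA_ext (WA_cotq e0 e1 h12)) => t; rewrite /cotq; case: eqP => _ //.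
by rewrite /fv; ring.
Qed.

Lemma WP_bb : WP m Kt (bb v1) (bb v2).
Proof.
apply: (WP_le m0 (WP_ext (WP_scale 2^-1 (WP_sub WP_fst WP_snd)) _ _)).
- by move=> t; rewrite /bb mulrC.
- by move=> t; rewrite /bb mulrC.
- by rewrite ger0_norm ?invr_ge0//; lra.
Qed.

Lemma WP_sg : WP m (2 * Kt) (sg v1) (sg v2).
Proof. by apply: (WP_le m0 (WP_add WP_fst WP_snd)); lra. Qed.

Lemma WP_s2 : WP m (6 * Kt ^+ 2) (s2 v1) (s2 v2).
Proof.
apply: (WP_le m0 (WP_add (WP_add (WP_mul WP_fst WP_snd) (WP_mul WP_cotq WP_cotq)) (WP_mul WP_bb WP_bb))).
by rewrite expr2; lra.
Qed.

Lemma WP_a2 : WP m (4 * Kt ^+ 2) (a2 v1) (a2 v2).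
Proof.
apply: (WP_le m0 (WP_add (WP_mul WP_fst WP_snd) (WP_mul WP_gfst WP_gsnd))).
by rewrite expr2; lra.
Qed.

Let shrink k : 0 <= k -> `|dl| * k <= k.
Proof. by move=> k0; rewrite dn ler_piMl. Qed.

Lemma WP_sgs : WP m kA (fun t => sg v1 t + dl * s2 v1 t) (fun t => sg v2 t + dl * s2 v2 t).
Proof.
apply: (WP_le m0 (WP_add WP_sg (WP_scale dl WP_s2))).
by rewrite /kA lerD2l shrink// mulr_ge0// sqr_ge0.
Qed.

Lemma WP_sga : WP m kA (fun t => sg v1 t + dl * a2 v1 t) (fun t => sg v2 t + dl * a2 v2 t).
Proof.
apply: (WP_le m0 (WP_add WP_sg (WP_scale dl WP_a2))).
have k2 := sqr_ge0 Kt.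
by rewrite /kA lerD2l (le_trans (shrink _))//; lra.
Qed.

Lemma WP_ss : WP m (dl * kA) (ss v1) (ss v2).
Proof. by rewrite -[X in X * kA]dn; exact: (WP_scale dl WP_sgs). Qed.

Lemma WP_aa : WP m (1 + kA) (aa v1) (aa v2).
Proof.
apply: (WP_le m0 (WP_add (WP_cst m0 1) (WP_scale dl WP_sga))).
by rewrite normr1 lerD2l shrink// ltW.
Qed.

Lemma WP_rem1 : WP m (4 * (dl * kA)) (fun t => binrem beta 1 (ss v1 t)) (fun t => binrem beta 1 (ss v2 t)).
Proof.
have /andP[b0 b1] := beta01.
apply: (WP_le m0 (WP_binrem b0 b1 m0 WP_ss dls (isT : (0 < 1)%N))).
by rewrite expr1 mulrA; lra.
Qed.

Lemma WP_rem2 : WP m (8 * (dl * kA) ^+ 2) (fun t => binrem beta 2 (ss v1 t)) (fun t => binrem beta 2 (ss v2 t)).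
Proof.
have /andP[b0 b1] := beta01.
apply: (WP_le m0 (WP_binrem b0 b1 m0 WP_ss dls (isT : (0 < 2)%N))).
by rewrite !expr2; lra.
Qed.

Lemma WP_Pv : WP m 2 (Pv v1) (Pv v2).
Proof.
apply: (WP_le m0 (WP_add (WP_cst m0 1) WP_rem1)).
by rewrite normr1; have := dls; lra.
Qed.

Lemma WP_Uv : WP m (dl * kU) (Uv v1) (Uv v2).
Proof.
apply: (WP_le m0 (WP_add (WP_scale dl (WP_mul WP_fst WP_Pv)) WP_rem1)).
by rewrite dn /kU; lra.
Qed.

Let bshrink k : 0 <= k -> `|beta| * k <= k.
Proof. by move=> k0; have /andP[b0 b1] := beta01; rewrite ger0_norm// ler_piMl. Qed.

Lemma WP_Vv : WP m (dl ^+ 2 * kV) (Vv v1) (Vv v2).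
Proof.
have hh := WP_add (WP_scale (dl ^+ 2) (WP_sub (WP_sub WP_a2 (WP_scale beta WP_s2))
   (WP_scale beta (WP_mul WP_sga WP_sgs)))) (WP_mul WP_aa WP_rem2).
apply: (WP_le m0 hh).
have k2 := sqr_ge0 Kt; have d2 : 0 <= dl ^+ 2 := sqr_ge0 _.
rewrite (ger0_norm d2).
have b1 := bshrink (mulr_ge0 (ler0n R 6) k2).
have b2 : `|beta| * (2 * kA * kA) <= 2 * kA * kA.
  by apply: bshrink; rewrite !mulr_ge0// ltW.
have := ler_wpM2l d2 (lerD (lerD (lexx (4 * Kt ^+ 2)) b1) b2).
move=> h; apply: le_trans (_ : _ <= dl ^+ 2 * (4 * Kt ^+ 2 + 6 * Kt ^+ 2 + 2 * kA * kA) + 2 * (1 + kA) * (8 * (dl * kA) ^+ 2)) _.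
  by rewrite lerD2r.
by rewrite le_eqVlt; apply/orP; left; apply/eqP; rewrite /kV; ring.
Qed.

Lemma WP_Ks k G1 G2 : WP m k G1 G2 -> WP m (2 * Cs * k) (Ks e G1) (Ks e G2).
Proof.
move=> [a b c]; split; [exact: WA_Ks|exact: WA_Ks|].
rewrite -mulrA; apply: (WA_ext (WA_Ks e0 e1 c)) => t.
exact: (KsB e0 e1 _ a b).
Qed.

Lemma WP_Kd k g1 g2 G1 G2 : wtrig (Wt e) 1 g1 -> wtrig (Wt e) 1 g2 ->
  wtrig (Wt e) m (fun x => g1 x - g2 x) -> WP m k G1 G2 ->
  WP m (8 * Cc * k) (Kd e g1 G1) (Kd e g2 G2).
Proof.
move=> w1 w2 w12 hG; have k0 := WP_ge0 hG; case: hG => a b c.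
have Cc0 := Cc_ge0 e0 e1; have Ck := mulr_ge0 Cc0 k0.
split.
- by apply: (WA_le (WA_Kd e0 e1 a w1)); lra.
- by apply: (WA_le (WA_Kd e0 e1 b w2)); lra.
apply: (@WA_le _ (4 * Cc * k * m + 4 * Cc * (k * m) * 1)); last by lra.
apply: (WA_ext (WA_add (WA_Kd e0 e1 a w12) (WA_Kd e0 e1 c w2))) => t.
rewrite (KdBl e0 e1 _ a w1 w2) (KdBr e0 e1 _ w2 a b); ring.
Qed.

Lemma WP_E1 : WP m (dl * kE1) (E1 v1) (E1 v2).
Proof.
have d0 : 0 <= dl^-1 by rewrite invr_ge0 ltW.
have hh := WP_scale (2 * pi)^-1 (WP_sub (WP_add (WP_scale dl^-1 (WP_Ks WP_Vv))
   (WP_Kd (Z_gv h1) (Z_gv h2) (Z_gv h12) WP_Uv))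
   (WP_scale dl (WP_mul WP_gfst (WP_Kd (Z_fv e0 e1 h1) (Z_fv e0 e1 h2) (Z_fv e0 e1 h12) WP_Pv)))).
apply: (WP_le m0 hh).
have p0 : 0 <= (2 * pi)^-1 :> R by rewrite invr_ge0 mulr_ge0// pi_ge0.
rewrite (ger0_norm p0) (ger0_norm d0) dn /kE1 [leRHS]mulrCA; apply: ler_wpM2l => //.
have -> : dl^-1 * (2 * Cs * (dl ^+ 2 * kV)) = dl * (2 * Cs * kV).
  by field; rewrite gt_eqF.
by rewrite le_eqVlt; apply/orP; left; apply/eqP; ring.
Qed.

End Pair.
End Nonlinear.

(** * The mutual interaction and the complete remainder *)

Section Mutual.
Context {R : realType}.
Local Notation mu := (@lebesgue_measure R).
Local Notation I2pi := (`[0, 2 * pi]%classic : set R).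
Variables (e : R) (e0 : 0 < e) (e1 : e <= 1).
Local Notation Kt := (Kt e).
Local Notation Z := (Z e).
Local Notation beta := (1 - e / 2).
Variables (d eps dl c0 w0 : R).

Let one : R -> R := fun=> 1.

Lemma intg_one : intg I2pi one.
Proof.
apply/integrableP; split; first exact/measurable_EFinP/measurable_cst.
rewrite (_ : (fun x => _) = cst 1%E); last by apply/funext => x; rewrite /= normr1.
by rewrite integral_cst//= mul1e lebesgue_measure_itv/= lte_fin; case: ifP => _; rewrite ?ltry.
Qed.

Lemma integral_one : \int[mu]_(y in I2pi) `|one y| = 2 * pi.
Proof.
rewrite (_ : (fun y => `|one y|) = cst 1); last by apply/funext => x; rewrite /= normr1.
suff h : mu I2pi = (2 * pi)%:E by rewrite Rintegral_cst// mul1r; exact: (congr1 fine h).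
by rewrite lebesgue_measure_itv/= lte_fin mulr_gt0 ?pi_gt0//= oppr0 adde0.
Qed.

Let one_le : \int[mu]_(y in I2pi) `|one y| <= 2 * pi. Proof. by rewrite integral_one. Qed.
Let one_m : measurable_fun [set: R] one. Proof. exact: measurable_cst. Qed.
Let one_p : periodic2pi one. Proof. by []. Qed.

Definition rho v (x : R) : R := 1 + dl * fv v x.
Definition N1 v (t : R * R) : R :=
  sin (t.1 - t.2) * (sg v t + dl * a2 v t) +
  cos (t.1 - t.2) * (gv v t.2 - gv v t.1 + dl * (fv v t.1 * gv v t.2 - gv v t.1 * fv v t.2)).
Definition Nn v (t : R * R) : R := sin (t.1 - t.2) + dl * N1 v t.
(* The squared distance between a point of the boundary and a point of the boundary
   of the companion is [(2 * d) ^+ 2 * (1 + st v (x, y))]. *)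
Definition st v (t : R * R) : R := eps *
  (- d^-1 * (rho v t.1 * cos t.1 + rho v t.2 * cos t.2) +
   eps / (4 * d ^+ 2) * (rho v t.1 * rho v t.1 + rho v t.2 * rho v t.2 +
      2 * (rho v t.1 * rho v t.2 * cos (t.1 - t.2)))).
Definition Pt v (t : R * R) : R := 1 + binrem beta 1 (st v t).
Definition E2 v (t : R * R) : R := - w0 * sin t.1 + c0 / eps * pconv one (fun t => Nn v t * Pt v t) t.
Definition E3 v (t : R * R) : R := (w0 + om v) * (dl * (fv v t.1 * sin t.1 - gv v t.1 * cos t.1)).
(* Multiplied by [rho x / C_ alpha], the left-hand side of the contour equation is
   [Lz v x + EE v (x, y)], whatever the value of [y]. *)
Definition EE v (t : R * R) : R := E1 e dl v t + E2 v t - E3 v t.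

Local Notation kA := (kA e).
Definition kR : R := 1 + Kt.
Definition kT : R := 4 * kR + 12 * kR ^+ 2.
Definition kN : R := 1 + 2 * kA + 4 * Kt + 8 * Kt ^+ 2.
Definition kE : R := kE1 e0 e1 + 16 * pi * `|c0| * kN + 8 * (`|w0| + 1) * Kt.

Hypotheses (dl0 : 0 < dl) (dl1 : dl <= eps) (dls : dl * kA <= 16^-1).
Hypotheses (eps0 : 0 < eps) (eps1 : eps <= 1) (d1 : 1 < d) (epsT : eps * kT <= 16^-1).

Let K0 : 0 < Kt. Proof. exact: Kt_gt0. Qed.
Let dl01 : dl <= 1. Proof. exact: le_trans dl1 _. Qed.

Lemma WA_cos1 : WA 1 (fun t : R * R => cos t.1).
Proof. by apply: (WA_ext (WA_cos 1 0 0)) => t; rewrite mul1r mul0r !addr0. Qed.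
Lemma WA_cos2 : WA 1 (fun t : R * R => cos t.2).
Proof. by apply: (WA_ext (WA_cos 0 1 0)) => t; rewrite mul1r mul0r add0r addr0. Qed.
Lemma WA_sin1 : WA 1 (fun t : R * R => sin t.1).
Proof. by apply: (WA_ext (WA_cos 1 0 (- (pi / 2)))) => t; rewrite cosBpihalf mul1r mul0r addr0. Qed.
Lemma WA_cosu : WA 1 (fun t : R * R => cos (t.1 - t.2)).
Proof. by apply: (WA_ext (WA_cos 1 (-1) 0)) => t; rewrite mul1r mulN1r addr0. Qed.
Lemma WA_sinu : WA 1 (fun t : R * R => sin (t.1 - t.2)).
Proof. by apply: (WA_ext (WA_cos 1 (-1) (- (pi / 2)))) => t; rewrite cosBpihalf mul1r mulN1r. Qed.

Lemma WA_pconv1 M G : WA M G -> WA (2 * (2 * pi) * M) (pconv one G).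
Proof.
exact: (WA_pconv one_m one_p intg_one one_le).
Qed.

Lemma pconv1_int M G x : WA M G -> intg I2pi (fun y => G (x, y)).
Proof.
move=> h; have [i _] := @pconv_integrable _ one (2 * pi) one_m one_p intg_one one_le M G x h.
by apply: (intg_ext _ i) => // y _; rewrite mul1r.
Qed.

Lemma pconv1B M M' G G' t : WA M G -> WA M' G' ->
  pconv one (fun t => G t - G' t) t = pconv one G t - pconv one G' t.
Proof. by move=> *; apply: (pconvB one_m one_p intg_one one_le); eassumption. Qed.

Lemma pconv1D M M' G G' t : WA M G -> WA M' G' ->
  pconv one (fun t => G t + G' t) t = pconv one G t + pconv one G' t.
Proof. by move=> *; apply: (pconvD one_m one_p intg_one one_le); eassumption. Qed.

Lemma pconv1Z M c G t : WA M G -> pconv one (fun t => c * G t) t = c * pconv one G t.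
Proof. by move=> *; apply: (pconvZ one_m one_p intg_one one_le); eassumption. Qed.

Section Pair.
Variables (m : R) (v1 v2 : option (bool * R) -> R).
Hypotheses (m0 : 0 <= m) (h1 : Z 1 v1) (h2 : Z 1 v2) (h12 : Z m (fun t => v1 t - v2 t)).

Let dm0 : 0 <= dl * m. Proof. by rewrite mulr_ge0// ltW. Qed.

(** In the mutual term f always comes with a factor dl. Charging it to the distance, dl m instead of
    m, is what compensates the prefactor 1 / eps of [E2] and leaves dl / eps. *)
Lemma WP_shrink k G1 G2 : WP m k G1 G2 ->
  WP (dl * m) k (fun t => dl * G1 t) (fun t => dl * G2 t).
Proof.
move=> h; have k0 := WP_ge0 h; have dk : dl * k <= k by rewrite ler_piMl.
have dn : `|dl| = dl by rewrite gtr0_norm.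
case: (WP_scale dl h); rewrite dn => a b c; split; [exact: WA_le a dk|exact: WA_le b dk|].
by apply: (WA_le c); rewrite le_eqVlt; apply/orP; left; apply/eqP; ring.
Qed.

Lemma WP_rho1 : WP (dl * m) kR (fun t => rho v1 t.1) (fun t => rho v2 t.1).
Proof.
apply: (WP_le dm0 (WP_add (WP_cst dm0 1) (WP_shrink (WP_fst e0 e1 h1 h2 h12)))).
by rewrite normr1.
Qed.

Lemma WP_rho2 : WP (dl * m) kR (fun t => rho v1 t.2) (fun t => rho v2 t.2).
Proof.
apply: (WP_le dm0 (WP_add (WP_cst dm0 1) (WP_shrink (WP_snd e0 e1 h1 h2 h12)))).
by rewrite normr1.
Qed.

Lemma WP_N1 : WP m (2 * kA + 4 * Kt + 8 * Kt ^+ 2) (N1 v1) (N1 v2).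
Proof.
have hf := WP_fst e0 e1 h1 h2 h12; have hs := WP_snd e0 e1 h1 h2 h12.
have hgf := WP_gfst e0 e1 h1 h2 h12; have hgs := WP_gsnd e0 e1 h1 h2 h12.
apply: (WP_le m0 (WP_add (WP_mul (WP_same m0 WA_sinu) (WP_sga e0 e1 dl0 dl01 m0 h1 h2 h12))
  (WP_mul (WP_same m0 WA_cosu) (WP_add (WP_sub hgs hgf)
     (WP_scale dl (WP_sub (WP_mul hf hgs) (WP_mul hgf hs))))))).
have k2 : 0 <= Kt * Kt by rewrite mulr_ge0// ltW.
have := ler_piMl k2 dl01.
by rewrite gtr0_norm// expr2; lra.
Qed.

Lemma WP_Nn : WP (dl * m) kN (Nn v1) (Nn v2).
Proof.
apply: (WP_le dm0 (WP_add (WP_same dm0 WA_sinu) (WP_shrink WP_N1))).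
by rewrite /kN; lra.
Qed.

Lemma WP_st : WP (dl * m) (eps * kT) (st v1) (st v2).
Proof.
have r1 := WP_rho1; have r2 := WP_rho2.
have hh := WP_scale eps (WP_add
  (WP_scale (- d^-1) (WP_add (WP_mul r1 (WP_same dm0 WA_cos1)) (WP_mul r2 (WP_same dm0 WA_cos2))))
  (WP_scale (eps / (4 * d ^+ 2)) (WP_add (WP_add (WP_mul r1 r1) (WP_mul r2 r2))
     (WP_scale 2 (WP_mul (WP_mul r1 r2) (WP_same dm0 WA_cosu)))))).
apply: (WP_le dm0 hh).
have k0 : 0 <= kR by rewrite addr_ge0// ltW.
have k2 : 0 <= kR * kR by rewrite mulr_ge0.
have d0 : 0 < d by apply: lt_trans d1.
have i1 : `|- d^-1| <= 1 by rewrite normrN gtr0_norm ?invr_gt0// invf_le1// ltW.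
have i2 : `|eps / (4 * d ^+ 2)| <= 1.
  have D0 : 0 < 4 * d ^+ 2 by rewrite mulr_gt0// exprn_gt0.
  rewrite gtr0_norm ?divr_gt0// ler_pdivrMr// mul1r.
  have := exprn_ege1 2 (ltW d1); have := eps1; lra.
rewrite (gtr0_norm eps0) (ler_pM2l eps0) /kT.
apply: lerD.
  by apply: (le_trans (ler_wpM2r _ i1)); lra.
by apply: (le_trans (ler_wpM2r _ i2)); rewrite ?normr_nat ?expr2; lra.
Qed.

Lemma WP_Pt : WP (dl * m) 2 (Pt v1) (Pt v2).
Proof.
have b0 : 0 <= beta by have := e1; lra.
have b1 : beta <= 1 by have := e0; lra.
apply: (WP_le dm0 (WP_add (WP_cst dm0 1) (WP_binrem b0 b1 dm0 WP_st epsT (isT : (0 < 1)%N)))).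
by rewrite normr1 expr1; have := epsT; lra.
Qed.

Lemma EE_lipschitz : WA (dl / eps * (kE * m)) (fun t => EE v1 t - EE v2 t).
Proof.
have [_ _ hE1] := WP_E1 e0 e1 dl0 dl01 dls m0 h1 h2 h12.
have [_ _ hNP] := WP_mul WP_Nn WP_Pt; have [hN1 hN2 _] := WP_mul WP_Nn WP_Pt.
have hE2 : WA (`|c0 / eps| * (2 * (2 * pi) * (2 * kN * 2 * (dl * m)))) (fun t => E2 v1 t - E2 v2 t).
  apply: (WA_ext (WA_scale (c0 / eps) (WA_pconv1 hNP))) => t.
  by rewrite /E2 (pconv1B _ hN1 hN2); ring.
have hom : WP m (`|w0| + 1) (fun=> w0 + om v1) (fun=> w0 + om v2).
  apply: WP_add; first exact: WP_cst.
  split; [exact: WA_le (WA_cst _) (Z_om e0 e1 h1)|exact: WA_le (WA_cst _) (Z_om e0 e1 h2)|].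
  by rewrite mul1r; exact: WA_le (WA_cst _) (Z_om e0 e1 h12).
have [_ _ hE3] := WP_mul hom (WP_scale dl (WP_sub
   (WP_mul (WP_fst e0 e1 h1 h2 h12) (WP_same m0 WA_sin1))
   (WP_mul (WP_gfst e0 e1 h1 h2 h12) (WP_same m0 WA_cos1)))).
apply: (WA_ext (WA_le (WA_sub (WA_add hE1 hE2) hE3) _)); last by move=> t /=; rewrite /EE /E3; ring.
(* [E1] and [E3] are Lipschitz with constants O(dl); only [E2] has the weaker rate dl / eps, which
   therefore governs the sum. *)
have le : dl <= dl / eps by rewrite ler_pdivlMr// ler_piMr// ltW.
have kE10 : 0 <= kE1 e0 e1.
  have /WP_ge0 := WP_E1 e0 e1 dl0 dl01 dls m0 h1 h2 h12; by rewrite pmulr_rge0.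
have c1 := ler_wpM2r (mulr_ge0 kE10 m0) le.
have kk : 0 <= 8 * (`|w0| + 1) * Kt * m.
  by rewrite !mulr_ge0// ?addr_ge0// ltW.
have c3 := ler_wpM2r kk le.
have -> : `|c0 / eps| = `|c0| / eps by rewrite normrM normfV (gtr0_norm eps0).
rewrite (gtr0_norm dl0) /kE.
apply: (@le_trans _ _ (dl / eps * (kE1 e0 e1 * m) + dl / eps * (16 * pi * `|c0| * kN * m) +
   dl / eps * (8 * (`|w0| + 1) * Kt * m))).
  apply: lerD; first apply: lerD.
  - by rewrite -mulrA.
  - by rewrite le_eqVlt; apply/orP; left; apply/eqP; ring.
  - by apply: le_trans c3; rewrite le_eqVlt; apply/orP; left; apply/eqP; ring.
by rewrite le_eqVlt; apply/orP; left; apply/eqP; ring.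
Qed.

End Pair.

End Mutual.

(** * Averages over the second variable *)

Section Oscillation.
Context {R : realType}.
Local Notation mu := (@lebesgue_measure R).
Local Notation I2pi := (`[0, 2 * pi]%classic : set R).

Let one : R -> R := fun=> 1.
Let pcv := pconv one.

(** Elements of the algebra with zero mean in y. Averages of explicit trigonometric expressions are
    found by removing such functions, with no further integral to compute. *)
Definition osc (G : R * R -> R) := (exists M, WA M G) /\ forall t, pcv G t = 0.

Lemma osc_add G H : osc G -> osc H -> osc (fun t => G t + H t).
Proof.
move=> [[M hM] h0] [[M' hM'] h0']; split; first by exists (M + M'); exact: WA_add.
by move=> t; rewrite /pcv (pconv1D t hM hM') [X in X + _]h0 [X in _ + X]h0' addr0.
Qed.

Lemma osc_mul_fst M h G : WA M (fun t => h t.1) -> osc G -> osc (fun t => h t.1 * G t).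
Proof.
move=> hM [[M' hM'] h0]; split; first by exists (M * M'); exact: WA_mul.
move=> t; transitivity (pcv (fun t' => h t.1 * G t') t); first by [].
by rewrite /pcv (pconv1Z _ _ hM') [X in _ * X]h0 mulr0.
Qed.

Lemma osc_scale c G : osc G -> osc (fun t => c * G t).
Proof. exact: (@osc_mul_fst _ (fun=> c) _ (WA_cst c)). Qed.

Lemma osc_ext G H : osc G -> G =1 H -> osc H.
Proof. by move=> h /funext <-. Qed.

Lemma osc_sin (p q : int) : q != 0 -> osc (fun t => sin (p%:~R * t.1 + q%:~R * t.2)).
Proof.
move=> q0; apply: (@osc_ext (wa_e (p, q, - (pi / 2)))); last first.
  by move=> t; rewrite /wa_e /= cosBpihalf.
have qR : q%:~R != 0 :> R by rewrite intr_eq0.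
have mc : measurable_fun [set: R] one by exact: measurable_cst.
split; first by exists 1; exact: WA_cos.
move=> t; rewrite /pcv (@pconv_cos _ one mc (fun=> erefl) intg_one).
have [n [n0 cE]] : exists n : nat, (0 < n)%N /\ forall y : R, cos (q%:~R * y) = cos (n%:R * y).
  case: q q0 {qR} => n q0; first by exists n; split=> //; rewrite lt0n.
  by exists n.+1; split=> // y; rewrite NegzE mulrNz mulNr cosN.
have ms : measurable_fun [set: R] (fun y : R => sin (q%:~R * y)).
  have := @measurable_trig R q%:~R (- (pi / 2)); apply: eq_measurable_fun => y _.
  by rewrite cosBpihalf.
under eq_Rintegral do rewrite mul1r cE.
rewrite integral_cosZ// mulr0 add0r.
under eq_Rintegral do rewrite mul1r.
rewrite [X in _ * X](_ : _ = 0) ?mulr0//.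
apply: integral_antisymmetric => //.
- move=> y; rewrite -!cosBpihalf mulrDr -[RHS](cosD2piZ _ q); congr cos; ring.
- by move=> u; rewrite mulrN sinN.
apply: intg_le intg_one => //; first exact: measurable_funTS.
by move=> y _; rewrite ler_norml sin_geN1 sin_le1.
Qed.

Lemma osc_fst M h t : WA M (fun t => h t.1) -> pcv (fun t => h t.1) t = 2 * pi * h t.1.
Proof.
move=> hM; transitivity (pcv (fun=> h t.1 * 1) t).
  by apply: eq_Rintegral => y _; rewrite mulr1.
have w1 : WA 1 (fun _ : R * R => 1 : R) by have := WA_cst (1 : R); rewrite normr1.
rewrite /pcv (pconv1Z _ _ w1) mulrC; congr (_ * _).
rewrite /pconv -[RHS]integral_one; apply: eq_Rintegral => y _.
by rewrite mulr1 normr1.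
Qed.

Local Notation su t := (sin (t.1 - t.2)).

Lemma osc_su : osc (fun t => su t).
Proof.
by apply: osc_ext (@osc_sin 1 (-1) _) _ => // t; rewrite mul1r mulN1r.
Qed.

Let i2 : 2%:~R = 2 :> R. Proof. by []. Qed.
Let iN2 : (-2)%:~R = -2 :> R. Proof. by rewrite mulrNz. Qed.
Let iN3 : (-3)%:~R = -3 :> R. Proof. by rewrite mulrNz. Qed.

Lemma osc_su_cos : osc (fun t => su t * cos t.2 - sin t.1 / 2).
Proof.
apply: osc_ext (osc_scale 2^-1 (@osc_sin 1 (-2) _)) _ => // t.
rewrite mul1r iN2 (_ : t.1 + -2 * t.2 = t.1 - t.2 - t.2); last by ring.
have := cos2Dsin2 t.2; set c := cos t.2; set s := sin t.2 => h.
(* Inserting c^2 + s^2 = 1 makes both sides homogeneous in c and s, so that the identity becomes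
   purely polynomial. *)
rewrite (_ : sin t.1 / 2 = sin t.1 / 2 * (c ^+ 2 + s ^+ 2)); last by rewrite h mulr1.
rewrite ![sin (_ - t.2)]sinB ![cos (_ - t.2)]cosB -/c -/s.
by field.
Qed.

Lemma osc_su_cosu : osc (fun t => su t * cos (t.1 - t.2)).
Proof.
apply: osc_ext (osc_scale 2^-1 (@osc_sin 2 (-2) _)) _ => // t.
rewrite i2 iN2 (_ : 2 * t.1 + -2 * t.2 = (t.1 - t.2) + (t.1 - t.2)); last by ring.
by rewrite [sin (_ + _)]sinD; field.
Qed.

Lemma osc_su_cos2 : osc (fun t => su t * (cos t.2 * cos t.2)).
Proof.
apply: osc_ext (osc_add (osc_scale 2^-1 osc_su) (osc_scale 4^-1 (osc_add (@osc_sin 1 1 _) (@osc_sin 1 (-3) _)))) _ => // t.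
rewrite !mul1r iN3 (_ : t.1 + -3 * t.2 = t.1 - t.2 - t.2 - t.2); last by ring.
have h := cos2Dsin2 t.2.
rewrite (_ : 2^-1 * su t = 2^-1 * su t * (cos t.2 ^+ 2 + sin t.2 ^+ 2)); last by rewrite h mulr1.
rewrite (_ : sin (t.1 + t.2) = sin (t.1 + t.2) * (cos t.2 ^+ 2 + sin t.2 ^+ 2)); last by rewrite h mulr1.
rewrite ![sin (_ - t.2)]sinB ![cos (_ - t.2)]cosB [su t]sinB sinD.
by field.
Qed.

End Oscillation.

(** * The remainder at the pair of discs *)

Section Initial.
Context {R : realType}.
Variables (e : R) (e0 : 0 < e) (e1 : e <= 1).
Local Notation Z := (Z e).
Local Notation beta := (1 - e / 2).
Variables (d eps dl c0 w0 : R).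
Hypotheses (eps0 : 0 < eps) (eps1 : eps <= 1) (d1 : 1 < d) (epsT : eps * kT e <= 16^-1)
  (dl0 : 0 < dl) (dl1 : dl <= eps) (w0E : w0 = c0 * (beta * pi / d)).
Local Notation su t := (sin (t.1 - t.2)).

Let v0 : option (bool * R) -> R := fun=> 0.
Let b2 : R := beta * (beta + 1) / 2.
Definition c2 : R := 2 * pi * (c0 * b2 / d ^+ 2).
Definition kE0 : R := 4 * pi * `|c0| * (5 + 16 * kT e ^+ 3).

Let pp (t : R * R) : R := - d^-1 * (cos t.1 + cos t.2).
Let qq (t : R * R) : R := (2 * d ^+ 2)^-1 * (1 + cos (t.1 - t.2)).

Let d0 : 0 < d. Proof. exact: lt_trans d1. Qed.

Let st0E t : st d eps dl v0 t = eps * (pp t + eps * qq t).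
Proof. by rewrite /st /rho /fv /v0 /pp /qq; field; rewrite gt_eqF. Qed.

(** The expansion of the mutual integrand through order eps^2. The rest [rem] is of order eps^3, and
    the prefactor 1 / eps in [E2] leaves eps^2. *)
Let main (t : R * R) : R :=
  su t * (1 - beta * (eps * (pp t + eps * qq t)) + b2 * eps ^+ 2 * (pp t * pp t)).
Let rem (t : R * R) : R :=
  su t * (b2 * (eps ^+ 3 * (2 * (pp t * qq t) + eps * (qq t * qq t))) + binrem beta 3 (st d eps dl v0 t)).

Let b01 : 0 <= beta <= 1. Proof. by have := e0; have := e1; move=> ? ?; apply/andP; split; lra. Qed.

Let binrem0 j : binrem beta j.+1 0 = 0.
Proof.
rewrite /binrem addr0 powR1 big_ord_recl /= big1 ?addr0 ?subrr// ?expr0 ?mulr1 ?addr0 ?subrr// => i _.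
by rewrite exprS mul0r mulr0.
Qed.

Let c0E t : cotq v0 t = 0.
Proof. by rewrite /cotq /fv /gv /v0; case: eqP => // _; rewrite subrr !mul0r. Qed.

Let int0 (g : R -> R) : (forall y, g y = 0) -> \int[lebesgue_measure]_(y in `[0, 2 * pi]) g y = 0.
Proof. by move=> g0; under eq_Rintegral do rewrite g0; rewrite Rintegral_cst// mul0r. Qed.

Let E10 t : E1 e dl v0 t = 0.
Proof.
have ssE t' : ss dl v0 t' = 0 by rewrite /ss /sg /s2 /bb c0E /fv /v0; ring.
rewrite /E1; have -> : Ks e (Vv e dl v0) t = 0.
  apply: int0 => y; rewrite /Vv ssE binrem0 mulr0 addr0 /a2 /s2 /sg /bb c0E /fv /gv /v0; ring.
have -> : Kd e (gv v0) (Uv e dl v0) t = 0.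
  by apply: int0 => y; rewrite /gv /v0 subrr mulr0 mul0r.
by rewrite {1}/gv {1}/v0 mul0r !mulr0 subr0 addr0 mulr0.
Qed.

Let N0E t : Nn dl v0 t * Pt e d eps dl v0 t = main t + rem t.
Proof.
have NE : Nn dl v0 t = su t.
  rewrite /Nn /N1 /sg /a2 /fv /gv /v0; ring.
rewrite NE /Pt /rem /main /binrem !big_ord_recr !big_ord0 /=.
by rewrite st0E /b2; move: (_ `^ _) => P; field.
Qed.

(** The mean of [main] over y: frequency 1 at order eps, which [w0] cancels, and frequency 2 at
    order eps^2. *)
Let avg (t : R * R) : R :=
  beta * eps / (2 * d) * sin t.1 + b2 * eps ^+ 2 / d ^+ 2 * (sin t.1 * cos t.1).

Let WA_avg : exists M, WA M avg.
Proof.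
by eexists; apply: WA_add; apply: WA_scale; [exact: WA_sin1|apply: WA_mul; [exact: WA_sin1|exact: WA_cos1]].
Qed.

Let osc_main : osc (fun t => main t - avg t).
Proof.
have c1 := @WA_cos1 R; have cc1 := WA_mul c1 c1.
have h := osc_add (osc_add (osc_add (@osc_su R)
  (osc_scale (beta * eps / d) (osc_add (osc_mul_fst (h := cos) c1 (@osc_su R)) (@osc_su_cos R))))
  (osc_scale (- (beta * eps ^+ 2 / (2 * d ^+ 2))) (osc_add (@osc_su R) (@osc_su_cosu R))))
  (osc_scale (b2 * eps ^+ 2 / d ^+ 2) (osc_add (osc_add
     (osc_mul_fst (h := fun x => cos x * cos x) cc1 (@osc_su R))
     (osc_mul_fst (h := fun x => 2 * cos x) (WA_scale 2 c1) (@osc_su_cos R))) (@osc_su_cos2 R))).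
apply: (osc_ext h) => t; rewrite /main /avg /pp /qq /=.
by field; rewrite gt_eqF.
Qed.

Let WA_rem : WA (eps ^+ 3 * (5 + 16 * kT e ^+ 3)) rem.
Proof.
have /andP[b0 b1] := b01.
have hp : WA 2 pp.
  apply: (WA_le (WA_scale (- d^-1) (WA_add (@WA_cos1 R) (@WA_cos2 R)))).
  by rewrite normrN gtr0_norm ?invr_gt0// ler_pdivrMl//; have := d1; lra.
have hq : WA 1 qq.
  have w1 : WA 1 (fun _ : R * R => 1 : R) by have := WA_cst (1 : R); rewrite normr1.
  apply: (WA_le (WA_scale (2 * d ^+ 2)^-1 (WA_add w1 (@WA_cosu R)))).
  have D0 : 0 < 2 * d ^+ 2 by rewrite mulr_gt0// exprn_gt0.
  by rewrite gtr0_norm ?invr_gt0// ler_pdivrMl// mulr1; have := exprn_ege1 2 (ltW d1); lra.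
have z0 : Z 1 v0 by exact: Z_zero.
(* Pairing an unknown with itself at distance 0 lets the Lipschitz lemmas serve as mere membership
   statements. *)
have z00 : Z 0 (fun t => v0 t - v0 t).
  by rewrite (_ : (fun t => _) = fun=> 0); [exact: Z_zero|apply/funext => t; rewrite subrr].
have hs : WP 0 (eps * kT e) (st d eps dl v0) (st d eps dl v0).
  by have := WP_st e0 e1 dl0 dl1 eps0 eps1 d1 (lexx 0) z0 z0 z00; rewrite mulr0.
have [hb _ _] := WP_binrem b0 b1 (lexx 0) hs epsT (isT : (0 < 3)%N).
apply: (WA_le (WA_mul (@WA_sinu R) (WA_add (WA_scale b2 (WA_scale (eps ^+ 3)
  (WA_add (WA_scale 2 (WA_mul hp hq)) (WA_scale eps (WA_mul hq hq))))) hb))).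
have e3 : 0 < eps ^+ 3 by rewrite exprn_gt0.
have b20 : 0 <= b2 by rewrite /b2 divr_ge0// mulr_ge0// addr_ge0.
have b21 : b2 <= 1.
  have : beta * (beta + 1) <= 1 * (1 + 1) by apply: ler_pM => //; [rewrite addr_ge0|rewrite lerD2r].
  by rewrite /b2; lra.
rewrite mul1r normr_nat (gtr0_norm e3) (gtr0_norm eps0) (ger0_norm b20).
rewrite [leRHS]mulrDr; apply: lerD.
  apply: (@le_trans _ _ (1 * (eps ^+ 3 * (2 * (2 * 1) + 1 * (1 * 1))))).
    apply: ler_pM => //; first by rewrite mulr_ge0 ?(ltW e3)// addr_ge0// mulr_ge0// ltW.
    by rewrite ler_pM2l// lerD2l ler_wpM2r.
  lra.
by rewrite le_eqVlt; apply/orP; left; apply/eqP; ring.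
Qed.

(* The choice of [w0] cancels the term of order 1. The term of order [eps] has
   frequency 2 and is therefore compensated by f alone, not by omega: this is why
   omega is as small as [eps ^+ 2 + dl / eps]. *)
Lemma EE_zero : WA (eps ^+ 2 * kE0) (fun t => EE e d eps dl c0 w0 (fun=> 0) t -
  eps * c2 * (sin t.1 * cos t.1)).
Proof.
apply: (WA_le (M := `|c0 / eps| * (2 * (2 * pi) * (eps ^+ 3 * (5 + 16 * kT e ^+ 3)))) _); last first.
  rewrite normrM normfV (gtr0_norm eps0) /kE0 le_eqVlt; apply/orP; left; apply/eqP.
  by field; rewrite gt_eqF.
apply: (WA_ext (WA_scale (c0 / eps) (WA_pconv1 WA_rem))) => t.
have [Ma hA] := WA_avg; have [[Mo ho] oz] := osc_main.
have hma : WA (Ma + Mo) main.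
  by apply: (WA_ext (WA_add hA ho)) => t'; rewrite addrC subrK.
have mE : pconv (fun=> 1) main t = 2 * pi * avg t.
  transitivity (pconv (fun=> 1) (fun t => avg t + (main t - avg t)) t).
    by congr (pconv _ _ t); apply/funext => t'; rewrite addrC subrK.
  rewrite (pconv1D t hA ho) [X in _ + X]oz addr0.
  exact: (@osc_fst _ _ (fun x => beta * eps / (2 * d) * sin x + b2 * eps ^+ 2 / d ^+ 2 * (sin x * cos x)) _ hA).
rewrite /EE E10 /E3 /E2.
rewrite (_ : (fun t => Nn dl _ t * _) = (fun t => main t + rem t)); last exact/funext/N0E.
rewrite (pconv1D t hma WA_rem) mE /avg /om /fv /gv w0E /c2.
by field; rewrite !gt_eqF.
Qed.

End Initial.

(** * Symmetry with respect to the first axis *)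

Section Parity.
Context {R : realType}.
Local Notation mu := (@lebesgue_measure R).
Local Notation I2pi := (`[0, 2 * pi]%classic : set R).

Lemma integral_parity (H : R -> R -> R) (s : R) x :
  (forall x, measurable_fun [set: R] (H x)) -> (forall x, periodic2pi (H x)) ->
  (forall x, intg I2pi (H x)) -> (forall x y, H (- x) (- y) = s * H x y) ->
  \int[mu]_(y in I2pi) H (- x) y = s * \int[mu]_(y in I2pi) H x y.
Proof.
move=> mH pH iH sH; have [_ <-] := integral_period 0 (mH (- x)) (pH (- x)) (iH (- x)).
rewrite -RintegralZl//; last exact: iH.
by apply: eq_Rintegral => y _; rewrite sub0r sH.
Qed.

Lemma WA_per2 (M : R) (G : R * R -> R) (x : R) : WA M G -> periodic2pi (fun y => G (x, y)).
Proof. by move=> h y; have := WA_periodic x y 0 1 h; rewrite mul0r addr0 mul1r. Qed.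

Variables (e : R) (e0 : 0 < e) (e1 : e <= 1).
Local Notation Z := (Z e).
Local Notation beta := (1 - e / 2).

Let ap (s : R) (G : R * R -> R) := forall x y, G (- x, - y) = s * G (x, y).

Let shift_m (k : R -> R) x : measurable_fun [set: R] k -> measurable_fun [set: R] (fun y => k (x - y)).
Proof. by move=> mk; apply: measurableT_comp => //; exact: measurable_funB. Qed.

Let shift_p (k : R -> R) x : periodic2pi k -> periodic2pi (fun y => k (x - y)).
Proof.
by move=> pk y; have := periodic2piZ (x - y) (-1) pk; rewrite mulN1r opprD addrA.
Qed.

Lemma Ks_parity M G s x y : WA M G -> ap s G -> Ks e G (- x, - y) = - (s * Ks e G (x, y)).
Proof.
move=> hG sG; rewrite -mulNr.
apply: (@integral_parity (fun x y => ks e (x - y) * G (x, y))) => [z|z|z|z w].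
- by apply: measurable_funM; [apply: shift_m; exact: measurable_ks|exact: WA_measurable hG].
- by move=> w; rewrite (shift_p _ (@ks_periodic R e)) (WA_per2 _ hG).
- exact: Ks_int hG.
- by rewrite sG -opprD ksN; ring.
Qed.

Lemma pconv1_parity M G s x y : WA M G -> ap s G ->
  pconv (fun=> 1) G (- x, - y) = s * pconv (fun=> 1) G (x, y).
Proof.
move=> hG sG; apply: (@integral_parity (fun x y => 1 * G (x, y))) => [z|z|z|z w].
- by apply: measurable_funM => //; exact: WA_measurable hG.
- by move=> w; rewrite (WA_per2 _ hG).
- by apply: (intg_ext _ (pconv1_int z hG)) => // w _; rewrite mul1r.
- by rewrite sG; ring.
Qed.

Lemma Kd_parity M G M' M'' g s s' x y : WA M G -> ap s G ->
  wtrig (Wt e) M' g -> WA M'' (fun t => g t.1) -> (forall x, g (- x) = s' * g x) ->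
  Kd e g G (- x, - y) = s' * s * Kd e g G (x, y).
Proof.
move=> hG sG wg hg sg.
apply: (@integral_parity (fun x y => kc e (x - y) * (g y - g x) * G (x, y))) => [z|z|z|z w].
- apply: measurable_funM; last exact: WA_measurable hG.
  apply: measurable_funM; first by apply: shift_m; exact: measurable_kc.
  by apply: measurable_funB => //; exact: (WA_measurable 0 (WA_snd hg)).
- move=> w; rewrite (shift_p _ (@kc_periodic R e)) (WA_per2 _ hG).
  by rewrite (WA_per2 0 (WA_snd hg)).
- exact: (Kd_int e0 e1 z hG wg).
- by rewrite sG !sg -opprD kcN; ring.
Qed.

Variables (d eps dl c0 w0 : R).
Hypotheses (dl0 : 0 < dl) (dl1 : dl <= eps) (dls : dl * kA e <= 16^-1).
Hypotheses (eps0 : 0 < eps) (eps1 : eps <= 1) (d1 : 1 < d) (epsT : eps * kT e <= 16^-1).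

(** Under (x, y) to (- x, - y), f, [kc] and [Pv] are even, while f', [ks] and [Nn] are odd; each
    term of [EE] then changes sign. The second coordinate is free because every term has been
    integrated over it or depends on x alone. *)
Lemma EE_odd v x y y' : Z 1 v ->
  EE e d eps dl c0 w0 v (- x, y) = - EE e d eps dl c0 w0 v (x, y').
Proof.
move=> hv.
have hvv : Z 0 (fun t => v t - v t).
  by rewrite (_ : (fun t => _) = fun=> 0); [exact: Z_zero|apply/funext => t; rewrite subrr].
have fE : forall x, fv v (- x) = fv v x by move=> z; exact: fv_even hv.
have gE : forall x, gv v (- x) = - gv v x by move=> z; exact: gv_odd hv.
have cE z w : cotq v (- z, - w) = - cotq v (z, w).
  rewrite /cotq /= -opprD mulNr sinN cosN oppr_eq0 !fE gE; case: eqP => // _.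
  by rewrite invrN; ring.
have sgE z w : sg v (- z, - w) = sg v (z, w) by rewrite /sg /= !fE.
have a2E z w : a2 v (- z, - w) = a2 v (z, w) by rewrite /a2 /= !fE !gE mulrNN.
have s2E z w : s2 v (- z, - w) = s2 v (z, w) by rewrite /s2 /bb /= !cE !fE mulrNN.
have ssE z w : ss dl v (- z, - w) = ss dl v (z, w) by rewrite /ss sgE s2E.
have dl01 : dl <= 1 by exact: le_trans dl1 eps1.
have [hV _ _] := WP_Vv e0 e1 dl0 dl01 dls (lexx 0) hv hv hvv.
have [hU _ _] := WP_Uv e0 e1 dl0 dl01 dls (lexx 0) hv hv hvv.
have [hP _ _] := WP_Pv e0 e1 dl0 dl01 dls (lexx 0) hv hv hvv.
have [hNP _ _] := WP_mul (WP_Nn e0 e1 dl0 dl1 eps1 (lexx 0) hv hv hvv)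
  (WP_Pt e0 e1 dl0 dl1 eps0 eps1 d1 epsT (lexx 0) hv hv hvv).
have hf := WA_fv e0 e1 hv; have hg := WA_gv e0 e1 hv.
have EV : Ks e (Vv e dl v) (- x, - y) = - Ks e (Vv e dl v) (x, y).
  rewrite (@Ks_parity _ _ 1 x y hV) ?mul1r// => z w.
  by rewrite /Vv /aa ssE sgE s2E a2E mul1r.
have gE' : forall x, gv v (- x) = -1 * gv v x by move=> z; rewrite gE mulN1r.
have fE' : forall x, fv v (- x) = 1 * fv v x by move=> z; rewrite fE mul1r.
have EU : Kd e (gv v) (Uv e dl v) (- x, - y) = - Kd e (gv v) (Uv e dl v) (x, y).
  rewrite (@Kd_parity _ _ _ _ _ 1 (-1) x y hU _ (Z_gv hv) hg gE') ?mulr1 ?mulN1r//.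
  by move=> z w; rewrite /Uv /Pv /= ssE fE mul1r.
have EP : Kd e (fv v) (Pv e dl v) (- x, - y) = Kd e (fv v) (Pv e dl v) (x, y).
  rewrite (@Kd_parity _ _ _ _ _ 1 1 x y hP _ (Z_fv e0 e1 hv) hf fE') ?mulr1 ?mul1r//.
  by move=> z w; rewrite /Pv /= ssE mul1r.
have EN : pconv (fun=> 1) (fun t => Nn dl v t * Pt e d eps dl v t) (- x, - y) =
    - pconv (fun=> 1) (fun t => Nn dl v t * Pt e d eps dl v t) (x, y).
  rewrite (@pconv1_parity _ _ (-1) x y hNP) ?mulN1r// => z w.
  rewrite /Nn /N1 /Pt /st /rho /= sgE a2E !fE !gE !cosN -opprD sinN cosN; ring.
transitivity (EE e d eps dl c0 w0 v (- x, - y)); first by [].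
transitivity (- EE e d eps dl c0 w0 v (x, y)); last by [].
rewrite /EE /E1 /E2 /E3 EV EU EP EN /= fE gE sinN cosN; ring.
Qed.

End Parity.

(** * The fixed point *)

Section Iteration.
Context {R : realType}.
Variables (e : R) (e0 : 0 < e) (e1 : e <= 1).
Local Notation Z := (Z e).
Local Notation beta := (1 - e / 2).
Variables (d eps dl c0 w0 : R).
Hypotheses (dl0 : 0 < dl) (dl1 : dl <= eps) (dls : dl * kA e <= 16^-1).
Hypotheses (eps0 : 0 < eps) (eps1 : eps <= 1) (d1 : 1 < d) (epsT : eps * kT e <= 16^-1).
Hypotheses (w0E : w0 = c0 * (beta * pi / d)).

(** The contraction factor: 2 pi from [Lz_inverse] times the Lipschitz constant of [EE]. The next
    quantity [m0] bounds the first iterate, its first summand coming from frequency 2. *)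
Let th : R := 2 * pi * (dl / eps * kE e0 e1 c0 w0).
Let m0 : R := pi * (eps * `|c2 e d c0|) + 2 * pi * (eps ^+ 2 * kE0 e c0).
Hypotheses (th2 : th <= 2^-1) (m02 : m0 <= 2^-1).
Local Notation EE := (EE e d eps dl c0 w0).

Let odd_solve M G : WA M G -> (forall x, G (- x, 0) = - G (x, 0)) ->
  exists v, Z (2 * pi * M) v /\ forall x, Lz e v x = - G (x, 0).
Proof.
move=> hG oG; have [v [hv vE]] := Lz_inverse e0 e1 (WA_opp hG).
by exists v; split=> // x; rewrite vE oG; field.
Qed.

Let pi0 : 0 < pi :> R. Proof. exact: pi_gt0. Qed.
Let Zz : Z 1 (fun=> 0). Proof. exact: Z_zero. Qed.
Let th0 : 0 <= th.
Proof.
have hz : Z 1 (fun t : option (bool * R) => (0 : R) - 0).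
  by rewrite (_ : (fun t => _) = fun=> 0); [exact: Z_zero|apply/funext => t; rewrite subrr].
have := WA_ge0 (EE_lipschitz e0 e1 c0 w0 dl0 dl1 dls eps0 eps1 d1 epsT ler01 Zz Zz hz).
by rewrite mulr1 => h; rewrite /th mulr_ge0// mulr_ge0// ltW.
Qed.

Lemma Lz_add M1 M2 v1 v2 x : Z M1 v1 -> Z M2 v2 ->
  Lz e (fun t => v1 t + v2 t) x = Lz e v1 x + Lz e v2 x.
Proof.
move=> h1 h2; have := Lz_sub e0 e1 x (Z_add e0 e1 h1 h2) h2.
rewrite (_ : (fun t => v1 t + v2 t - v2 t) = v1); last by apply/funext => t; rewrite addrK.
by move=> ->; rewrite subrK.
Qed.

Lemma first_step : exists D, [/\ Z m0 D, forall x, Lz e D x = - EE (fun=> 0) (x, 0) &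
  `|om D| <= 2 * pi * (eps ^+ 2 * kE0 e c0)].
Proof.
have h0 := EE_zero e0 e1 eps0 eps1 d1 epsT dl0 dl1 w0E.
have [|v [hv vE]] := odd_solve h0.
  move=> x; rewrite /= sinN cosN (EE_odd e0 e1 c0 w0 dl0 dl1 dls eps0 eps1 d1 epsT x 0 0 Zz); ring.
(* As sin x cos x = sin (2 x) / 2, this coefficient of cos (2 x), the atom of index 0, cancels the
   term of order eps. *)
pose c : R := - (eps * c2 e d c0 / (2 * gam e 0)).
have g0 : 0 < gam e 0 := gam_gt0 e0 e1 0.
have hc : Z (pi * (eps * `|c2 e d c0|)) (fun t => c * ze (Some 0%N) t).
  apply: span_atom; rewrite /= /c normrN normrM normrM normfV (gtr0_norm eps0) (gtr0_norm (mulr_gt0 (ltr0n _ 2) g0)).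
  rewrite /gam le_eqVlt; apply/orP; left; apply/eqP.
  have W0 := Wt_gt0 e0 e1 0; move: (Wt e 0) W0 (pi : R) pi0 => W W0 P P0.
  by field; rewrite !gt_eqF.
exists (fun t => c * ze (Some 0%N) t + v t); split.
- exact: Z_add.
- move=> x; rewrite (Lz_add x hc hv) (Lz_atom e0 e1) vE /c /=.
  rewrite (_ : 2%:R * x = x + x); last by ring.
  by rewrite sinD; field; rewrite gt_eqF.
- by rewrite /om /= mulr0 add0r; exact: (Z_om e0 e1 hv).
Qed.

Lemma next_step m u D : 0 <= m -> Z 1 u -> Z m D -> Z 1 (fun t => u t + D t) ->
  exists D', Z (th * m) D' /\
    forall x, Lz e D' x = - (EE (fun t => u t + D t) (x, 0) - EE u (x, 0)).
Proof.
move=> m00 hu hD huD.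
have h12 : Z m (fun t => u t + D t - u t).
  by rewrite (_ : (fun t => _) = D)//; apply/funext => t; rewrite addrC addKr.
have hL := EE_lipschitz e0 e1 c0 w0 dl0 dl1 dls eps0 eps1 d1 epsT m00 huD hu h12.
have [|v [hv vE]] := odd_solve hL.
  move=> x; rewrite !(EE_odd e0 e1 c0 w0 dl0 dl1 dls eps0 eps1 d1 epsT x 0 0)//; ring.
exists v; split=> //.
by rewrite (_ : th * m = 2 * pi * (dl / eps * (kE e0 e1 c0 w0 * m)))// /th; ring.
Qed.

Lemma geo_bound n k : \sum_(n <= i < k) th ^+ i * m0 <= 2 * (th ^+ n * m0).
Proof.
have [D0 [/(Z_ge0 e0 e1) m00 _ _]] := first_step.
have t0 j : 0 <= th ^+ j * m0 by rewrite mulr_ge0// exprn_ge0.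
case: (leqP n k) => [|kn]; last by rewrite (big_geq (ltnW kn)) (mulr_ge0 _ (t0 n)).
suff : forall k, (n <= k)%N ->
    \sum_(n <= i < k) th ^+ i * m0 <= 2 * (th ^+ n * m0) - 2 * (th ^+ k * m0).
  by move=> h /h; have := t0 k; lra.
elim=> [|j IH]; first by rewrite leqn0 => /eqP ->; rewrite big_geq// subrr.
rewrite leq_eqVlt => /orP[/eqP ->|]; first by rewrite big_geq// subrr.
rewrite ltnS => nj; rewrite big_nat_recr//=; have := IH nj.
have := ler_wpM2r (t0 j) th2; rewrite exprS; lra.
Qed.

(** [Lz_inverse] asserts existence only, so neither linearity nor a bound on differences of its
    solutions is at hand. The iteration is thus carried by increments: each solves the equation
    whose right-hand side is minus the last change of [EE], with a bound smaller by [th], and the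
    solution is their sum. *)
Lemma fixed_point : exists v, [/\ Z 1 v, forall x, Lz e v x = - EE v (x, 0) &
  `|om v| <= 2 * pi * (eps ^+ 2 * kE0 e c0) + th].
Proof.
have [D0 [hD0 LD0 oD0]] := first_step.
have m00 : 0 <= m0 := Z_ge0 e0 e1 hD0.
pose V := option (bool * R) -> R.
(* [nx] sends a bound, an iterate and its increment to the next increment. The hypotheses of
   [next_step] are premises of its specification, so that it can be chosen as a total function. *)
have /choice [nx hnx] : forall p : R * (V * V), exists D',
    0 <= p.1 -> Z 1 p.2.1 -> Z p.1 p.2.2 -> Z 1 (fun t => p.2.1 t + p.2.2 t) ->
    Z (th * p.1) D' /\ forall x, Lz e D' x = - (EE (fun t => p.2.1 t + p.2.2 t) (x, 0) - EE p.2.1 (x, 0)).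
  move=> p; case: (pselect [/\ 0 <= p.1, Z 1 p.2.1, Z p.1 p.2.2 & Z 1 (fun t => p.2.1 t + p.2.2 t)]).
    by move=> [h1 h2 h3 h4]; have [D' hD'] := next_step h1 h2 h3 h4; exists D'.
  by move=> h; exists (fun=> 0) => h1 h2 h3 h4; case: h.
pose s := fix s n : V * V := if n is n'.+1 then
  ((fun t => (s n').1 t + (s n').2 t), nx (th ^+ n' * m0, s n')) else ((fun=> 0), D0).
pose D n := (s n).2.
have sE n : (s n).1 = (fun t => series (D^~ t) n).
  elim: n => [|n IH]; first by apply/funext => t; rewrite /series /= big_geq.
  by apply/funext => t; rewrite seriesSr /= IH.
have m1 n : series (fun k => th ^+ k * m0) n <= 1.
  have := geo_bound 0 n; rewrite /series /= expr0 mul1r => h; apply: le_trans h _.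
  by have := m02; lra.
have t0 j : 0 <= th ^+ j * m0 by rewrite mulr_ge0// exprn_ge0.
have hD n : Z (th ^+ n * m0) (D n) /\ Z (series (fun k => th ^+ k * m0) n) (fun t => series (D^~ t) n).
  elim: n => [|n [IH1 IH2]].
    rewrite expr0 mul1r; split=> //.
    rewrite (_ : (fun t => series (D^~ t) 0) = (fun=> 0)); first by apply: Z_zero; rewrite /series /= big_geq.
    by apply/funext => t; rewrite /series /= big_geq.
  have h2 : Z (series (fun k => th ^+ k * m0) n.+1) (fun t => series (D^~ t) n.+1).
    rewrite seriesSr; apply: (span_ext (Z_add e0 e1 IH2 IH1)) => t; by rewrite seriesSr.
  split=> //; rewrite exprS -mulrA.
  have hu : Z 1 (s n).1 by rewrite sE; exact: span_le IH2 (m1 n).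
  have [] // := hnx (th ^+ n * m0, s n) (t0 n) hu IH1.
  apply: (span_le (span_ext h2 _) (m1 _)) => t; by rewrite seriesSr /= sE.
(* The right-hand sides telescope: the increments up to index n together solve the equation with
   [EE] taken at the sum of those before n. *)
have LD n x : series (fun k => Lz e (D k) x) n.+1 = - EE (fun t => series (D^~ t) n) (x, 0).
  elim: n => [|n IH].
    have -> : (fun t => series (D^~ t) 0%N) = (fun=> 0).
      by apply/funext => t; rewrite /series /= big_geq.
    by rewrite -LD0 /series /= big_nat1.
  rewrite seriesSr IH.
  have hu : Z 1 (s n).1 by rewrite sE; exact: span_le (hD n).2 (m1 n).
  have [|_ ->] := hnx (th ^+ n * m0, s n) (t0 n) hu (hD n).1.
    apply: (span_le (span_ext (hD n.+1).2 _) (m1 n.+1)) => t; by rewrite seriesSr /= sE.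
  rewrite /= (_ : (fun t => (s n).1 t + _) = (fun t => series (D^~ t) n.+1)); last first.
    by apply/funext => t; rewrite seriesSr sE.
  by rewrite sE; ring.
pose v t := limn (series (D^~ t)).
have Dv : psum D v.
  move=> t; have h := Z_psum_cvg e0 e1 (fun k => proj1 (hD k)) m1.
  exact: h.
have hv : Z 1 v by apply: (span_sum (fun k => proj1 (hD k)) m1 Dv).
have tail n : Z (2 * (th ^+ n * m0)) (fun t => v t - series (D^~ t) n).
  apply: (@span_sum _ _ _ _ _ (fun k => th ^+ (n + k) * m0) (fun k => D (n + k)%N)).
  - by move=> k; exact: (hD _).1.
  - move=> k; apply: le_trans (geo_bound n (n + k)).
    rewrite -[X in _ <= \sum_(X <= _ < _) _]add0n big_addn addKn.
    by rewrite le_eqVlt; apply/orP; left; apply/eqP; apply: eq_bigr => i _; rewrite addnC.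
  - move=> t; rewrite (_ : series _ = (fun k => series (D^~ t) (k + n)%N - series (D^~ t) n)).
      by apply: cvgB; [rewrite cvg_shiftn; exact: Dv|exact: cvg_cst].
    apply/funext => k; rewrite /series /= (big_cat_nat (leq0n n) (leq_addl k n))/= addrAC subrr add0r.
    rewrite -[X in _ = \sum_(X <= _ < _) _]add0n big_addn addnK.
    by apply: eq_bigr => i _; rewrite addnC.
exists v; split=> //.
  move=> x; apply: (@cvg_unique _ _ (series (fun k => Lz e (D k) x) @ \oo)) => //.
    exact: (Lz_psum e0 e1 (fun k => proj1 (hD k)) m1 Dv).
  suff h : (fun n => EE (fun t => series (D^~ t) n) (x, 0)) @ \oo --> EE v (x, 0).
    have sh : (fun n => series (fun k => Lz e (D k) x) n.+1) @ \oo --> - EE v (x, 0).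
      rewrite (_ : (fun n => _) = (fun n => - EE (fun t => series (D^~ t) n) (x, 0))).
        exact: cvgN.
      by apply/funext => n; rewrite LD.
    by move: sh; rewrite (cvg_shiftS (series (fun k => Lz e (D k) x))).
  pose K := dl / eps * (kE e0 e1 c0 w0 * (2 * m0)).
  have Kn : (fun n : nat => K * th ^+ n) @ \oo --> (0 : R).
    rewrite -[X in _ --> X](mulr0 K); apply: cvgMr; apply: cvg_expr.
    by rewrite ger0_norm//; have := th2; lra.
  have Kn1 : (fun n : nat => EE v (x, 0) - K * th ^+ n) @ \oo --> EE v (x, 0).
    by rewrite -[X in _ --> X]subr0; apply: cvgB => //; exact: cvg_cst.
  have Kn2 : (fun n : nat => EE v (x, 0) + K * th ^+ n) @ \oo --> EE v (x, 0).
    by rewrite -[X in _ --> X]addr0; apply: cvgD => //; exact: cvg_cst.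
  apply: squeeze_cvgr Kn1 Kn2; apply: nearW => n; rewrite -ler_distlC.
  have hu : Z 1 (fun t => series (D^~ t) n) by exact: span_le (hD n).2 (m1 n).
  have := WA_bound (x, 0) (EE_lipschitz e0 e1 c0 w0 dl0 dl1 dls eps0 eps1 d1 epsT
    (mulr_ge0 (ler0n _ 2) (t0 n)) hv hu (tail n)).
  by rewrite (_ : _ * (_ * (2 * _)) = K * th ^+ n)// /K; ring.
(* The first increment has omega of order eps^2 because its large part is pure frequency 2; all the
   later ones together weigh at most 2 th m0 <= th. *)
have -> : om v = om D0 + om (fun t => v t - series (D^~ t) 1).
  by rewrite /om /series /= big_nat1 /D /=; ring.
apply: (le_trans (ler_normD _ _)); apply: lerD => //.
apply: (le_trans (Z_om e0 e1 (tail 1%N))); rewrite expr1.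
by have := ler_wpM2l th0 m02; lra.
Qed.

End Iteration.

(** * Back to the contour equation *)

Section ContourEquation.
Context {R : realType}.
Local Notation mu := (@lebesgue_measure R).
Local Notation I2pi := (`[0, 2 * pi]%classic : set R).
Variables (e : R) (e0 : 0 < e) (e1 : e <= 1).
Local Notation Z := (Z e).
Local Notation beta := (1 - e / 2).
Local Notation alpha := (2 - e).
Variables (d eps dl : R).
Hypotheses (dl0 : 0 < dl) (dl1 : dl <= eps) (dls : dl * kA e <= 16^-1).
Hypotheses (eps0 : 0 < eps) (eps1 : eps <= 1) (d1 : 1 < d) (epsT : eps * kT e <= 16^-1).
Variables (v : option (bool * R) -> R) (hv : Z 1 v).
Hypothesis dv : forall x, derive1 (rho dl v) x = dl * gv v x.

Let b01 : 0 <= beta <= 1. Proof. by have := e0; have := e1; move=> ? ?; apply/andP; split; lra. Qed.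
Let dl01 : dl <= 1. Proof. exact: le_trans dl1 eps1. Qed.
Let hvv : Z 0 (fun t => v t - v t).
Proof. by rewrite (_ : (fun t => _) = fun=> 0); [exact: Z_zero|apply/funext => t; rewrite subrr]. Qed.

(** A zero of sin ((x - y) / 2) forces x - y to be a multiple of 2 pi. This serves on the diagonal,
    where the self-interaction integrand is 0 by convention. *)
Lemma fv_eq x y : sin ((x - y) / 2) = 0 -> fv v x = fv v y.
Proof.
move=> s0; have [k /andP[k0 k1]] := mod2pi (x - y).
set r := x - y - k%:~R * (2 * pi) in k0 k1.
have cr : cos r = 1.
  rewrite /r -mulNr -intrN cosD2piZ (_ : x - y = (x - y) / 2 + (x - y) / 2); last by field.
  by rewrite cosD s0 mulr0 subr0 -expr2; have := cos2Dsin2 ((x - y) / 2); rewrite s0 expr0n addr0.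
have r0 : r = 0.
  apply/eqP; rewrite eq_le k0 andbT leNgt; apply/negP => rp.
  have := cos2Dsin2 (r / 2).
  have : cos (r / 2 + r / 2) = 1 by rewrite -[RHS]cr; congr cos; field.
  rewrite cosD -!expr2 => h1 h2.
  have : 0 < sin (r / 2) by apply: sin_gt0_pi; apply/andP; split; lra.
  by move=> /(exprn_gt0 2); lra.
have -> : x = y + k%:~R * (2 * pi) by move: r0; rewrite /r; lra.
exact: (periodic2piZ _ _ (fv_periodic e0 e1 hv)).
Qed.

Lemma Nn_N x y : N_ (rho dl v) x y = Nn dl v (x, y).
Proof. by rewrite /N_ !dv /Nn /N1 /rho /sg /a2 /=; ring. Qed.

(** The cosine part of the numerator is regrouped as (1 + dl f(x)) (f'(y) - f'(x)) - dl f'(x) (f(y)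
    - f(x)), up to a factor dl: the non-integrable kernel [kc] then only meets increments. *)
Let self x y : R := ks e (x - y) + dl * (e / 2) * (ks e (x - y) * sg v (x, y)) + ks e (x - y) * Vv e dl v (x, y) +
  dl * (kc e (x - y) * (gv v y - gv v x) * 1 + kc e (x - y) * (gv v y - gv v x) * Uv e dl v (x, y) -
   dl * gv v x * (kc e (x - y) * (fv v y - fv v x) * Pv e dl v (x, y))).

Let PvE t : Pv e dl v t = (1 + ss dl v t) `^ (- beta).
Proof. by rewrite /Pv /binrem big_ord_recr big_ord0 /= expr0; ring. Qed.

Lemma self_integrandE x y : self_integrand alpha (rho dl v) x y = self x y.
Proof.
have P2 : Pv e dl v (x, y) = 1 - beta * ss dl v (x, y) + binrem beta 2 (ss dl v (x, y)).
  by rewrite PvE /binrem !big_ord_recr big_ord0 /=; field.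
transitivity (phik e (x - y) * (Nn dl v (x, y) * Pv e dl v (x, y))); last first.
  have aP : aa dl v (x, y) * Pv e dl v (x, y) = 1 + dl * (e / 2) * sg v (x, y) + Vv e dl v (x, y).
    by rewrite P2 /Vv /aa /ss; field.
  have U : (1 + dl * fv v x) * Pv e dl v (x, y) = 1 + Uv e dl v (x, y).
    rewrite /Uv /= {2}/Pv /Pv; ring.
  rewrite /self -/(ks _ _) /ks /kc.
  transitivity (phik e (x - y) * sin (x - y) * (aa dl v (x, y) * Pv e dl v (x, y)) +
     dl * (phik e (x - y) * cos (x - y) * (gv v y - gv v x) * ((1 + dl * fv v x) * Pv e dl v (x, y)) -
      dl * gv v x * (phik e (x - y) * cos (x - y) * (fv v y - fv v x) * Pv e dl v (x, y)))).
    rewrite /Nn /N1 /aa /=; ring.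
  rewrite aP U; ring.
rewrite /self_integrand Nn_N [RHS]mulrCA; congr (_ * _).
have bE : alpha / 2 = beta by field.
(* On the diagonal both sides vanish: 0 to a nonzero power is 0, and so is the inverse of 0. *)
have [s0|s0] := eqVneq (sin ((x - y) / 2)) 0.
  rewrite /rho (fv_eq s0) subrr s0 expr0n /= mulr0 addr0 powR0; last first.
    by rewrite bE; have := e1; lra.
  rewrite invr0 /phik /vsin s0 mulr0 normr0 powR0 ?mul0r//.
  by apply/negP => /eqP; have := e1; lra.
have sp : 0 < 1 + ss dl v (x, y).
  have [h _ _] := WP_ss e0 e1 dl0 dl01 (lexx 0) hv hv hvv.
  by have := WA_bound (x, y) h; rewrite ler_norml; have := dls; lra.
have vp : 0 < `|vsin (x - y)| by rewrite normr_gt0 /vsin mulf_neq0.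
rewrite (_ : _ + _ = `|vsin (x - y)| ^+ 2 * (1 + ss dl v (x, y))); last first.
  rewrite real_normK ?num_real// /vsin /rho /ss /s2 /bb /sg /cotq /= (negbTE s0).
  have := cos2Dsin2 ((x - y) / 2); set s := sin _ in s0 *; set c := cos _ => h.
  (* The c^2 part of the squared increment gives the square of [cotq], the s^2 part that of [bb],
     each after extraction of 4 s^2. *)
  have -> : (1 + dl * fv v x - (1 + dl * fv v y)) ^+ 2 = (1 + dl * fv v x - (1 + dl * fv v y)) ^+ 2 * (c ^+ 2 + s ^+ 2).
    by rewrite h mulr1.
  by field.
rewrite powRM ?exprn_ge0 ?(ltW sp)// PvE powRN invfM; congr (_ * _); last by rewrite bE.
rewrite /phik -powR_mulrn// -powRrM -powRN; congr (_ `^ _); by field.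
Qed.

Let c0 : R := (2 * d) `^ (- alpha).

Lemma mutual_integrandE x y : mutual_integrand alpha d eps (rho dl v) x y =
  c0 * (Nn dl v (x, y) * Pt e d eps dl v (x, y)).
Proof.
rewrite /mutual_integrand Nn_N [RHS]mulrCA; congr (_ * _).
have bE : alpha / 2 = beta by field.
have d0 : 0 < 2 * d by rewrite mulr_gt0//; exact: lt_trans d1.
have sp : 0 < 1 + st d eps dl v (x, y).
  have [h _ _] := WP_st e0 e1 dl0 dl1 eps0 eps1 d1 (lexx 0) hv hv hvv.
  by have := WA_bound (x, y) h; rewrite ler_norml; have := epsT; lra.
rewrite (_ : _ + _ = (2 * d) ^+ 2 * (1 + st d eps dl v (x, y))); last first.
  rewrite /st /= cosB; have hx := cos2Dsin2 x; have hy := cos2Dsin2 y.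
  rewrite (_ : rho dl v x * rho dl v x = rho dl v x * rho dl v x * (cos x ^+ 2 + sin x ^+ 2)); last by rewrite hx mulr1.
  rewrite (_ : rho dl v y * rho dl v y = rho dl v y * rho dl v y * (cos y ^+ 2 + sin y ^+ 2)); last by rewrite hy mulr1.
  by field; rewrite gt_eqF//; exact: lt_trans d1.
have PtE : Pt e d eps dl v (x, y) = (1 + st d eps dl v (x, y)) `^ (- beta).
  by rewrite /Pt /binrem big_ord_recr big_ord0 /= expr0; ring.
rewrite powRM ?exprn_ge0 ?(ltW sp) ?(ltW d0)// PtE [in RHS]powRN invfM; congr (_ * _); last by rewrite bE.
rewrite /c0 -powR_mulrn ?(ltW d0)// -powRrM -powRN; congr (_ `^ _); by field.
Qed.

Let mI : @measurable _ (measurableTypeR R) I2pi. Proof. by []. Qed.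
Let WP_left m k (G1 G2 : R * R -> R) : WP m k G1 G2 -> WA k G1. Proof. by case. Qed.
Let g1 : WA 1 (fun _ : R * R => 1 : R).
Proof. by have := WA_cst (1 : R); rewrite normr1. Qed.

Let hV := WP_left (WP_Vv e0 e1 dl0 dl01 dls (lexx 0) hv hv hvv).
Let hU := WP_left (WP_Uv e0 e1 dl0 dl01 dls (lexx 0) hv hv hvv).
Let hP := WP_left (WP_Pv e0 e1 dl0 dl01 dls (lexx 0) hv hv hvv).
Let hsg := WP_left (WP_sg e0 e1 (lexx 0) hv hv hvv).
Let hNP := WP_left (WP_mul (WP_Nn e0 e1 dl0 dl1 eps1 (lexx 0) hv hv hvv)
  (WP_Pt e0 e1 dl0 dl1 eps0 eps1 d1 epsT (lexx 0) hv hv hvv)).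

(** Oddness of the kernel over a period: the undeformed disc contributes nothing to its own contour
    equation. *)
Lemma Ks_one x : Ks e (fun=> 1) (x, 0) = 0.
Proof.
have [_ h] := integral_period x (measurable_ks e) (@ks_periodic R e) (ks_int e0 e1).
rewrite /Ks /pconv /=; under eq_Rintegral do rewrite mulr1.
rewrite h; apply: integral_antisymmetric.
- exact: measurable_ks.
- exact: ks_periodic.
- exact: ksN.
- exact: ks_int.
Qed.

Lemma Ks_sg x : Ks e (sg v) (x, 0) = Ks e (fsnd v) (x, 0).
Proof.
transitivity (Ks e (fun t => fv v x * 1 + fsnd v t) (x, 0)).
  by apply: eq_Rintegral => y _; rewrite mulr1.
have h1 : WA (`|fv v x| * 1) (fun _ : R * R => fv v x * 1) by exact: WA_scale.
by rewrite (KsD e0 e1 _ h1 (WA_fsnd e0 e1 hv)) (KsZ e0 e1 _ _ g1) Ks_one mulr0 add0r.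
Qed.

Let i1 x : intg I2pi (fun y => ks e (x - y)).
Proof. by have [] := integral_period x (measurable_ks e) (@ks_periodic R e) (ks_int e0 e1). Qed.

Lemma self_integral x : intg I2pi (self_integrand alpha (rho dl v) x) /\
  \int[mu]_(y in I2pi) self_integrand alpha (rho dl v) x y =
  dl * (e / 2) * Ks e (fsnd v) (x, 0) + Ks e (Vv e dl v) (x, 0) +
  dl * (Kd e (gv v) (fun=> 1) (x, 0) + Kd e (gv v) (Uv e dl v) (x, 0) -
   dl * gv v x * Kd e (fv v) (Pv e dl v) (x, 0)).
Proof.
rewrite (_ : self_integrand alpha (rho dl v) x = self x); last exact/funext/self_integrandE.
have a2 := Ks_int e0 e1 x hsg; have a3 := Ks_int e0 e1 x hV.
have a4 := Kd_int e0 e1 x g1 (Z_gv hv); have a5 := Kd_int e0 e1 x hU (Z_gv hv).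
have a6 := Kd_int e0 e1 x hP (Z_fv e0 e1 hv).
have b2 := intgZ mI (dl * (e / 2)) a2.
have b6 := intgZ mI (dl * gv v x) a6.
have b45 := intgD mI a4 a5; have b456 := intgB mI b45 b6.
have b := intgZ mI dl b456.
have b12 := intgD mI (i1 x) b2; have b123 := intgD mI b12 a3.
split; first exact: (intgD mI b123 b).
rewrite (RintegralD mI b123 b) (RintegralD mI b12 a3) (RintegralD mI (i1 x) b2).
rewrite (RintegralZl _ mI b456) (RintegralB mI b45 b6) (RintegralD mI a4 a5).
rewrite (RintegralZl _ mI a2) (RintegralZl _ mI a6).
rewrite -[\int[mu]_(y in I2pi) (ks e (x - y) * sg v (x, y))]/(Ks e (sg v) (x, 0)) Ks_sg.
rewrite (_ : \int[mu]_(y in I2pi) ks e (x - y) = 0) ?add0r//.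
by rewrite -[RHS](Ks_one x); apply: eq_Rintegral => y _; rewrite mulr1.
Qed.

Lemma mutual_integral x : intg I2pi (mutual_integrand alpha d eps (rho dl v) x) /\
  \int[mu]_(y in I2pi) mutual_integrand alpha d eps (rho dl v) x y =
  c0 * pconv (fun=> 1) (fun t => Nn dl v t * Pt e d eps dl v t) (x, 0).
Proof.
rewrite (_ : mutual_integrand alpha d eps (rho dl v) x =
    (fun y => c0 * (Nn dl v (x, y) * Pt e d eps dl v (x, y)))); last exact/funext/mutual_integrandE.
have a := pconv1_int x hNP.
split; first exact: (intgZ mI c0 a).
rewrite (RintegralZl _ mI a); congr (_ * _).
by apply: eq_Rintegral => y _; rewrite mul1r.
Qed.

Lemma rho_gt0 x : 0 < rho dl v x.
Proof.
have := WA_bound (x, 0) (WA_fv e0 e1 hv); rewrite mulr1 ler_norml => /andP[h _].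
have K0 := Kt_gt0 e0 e1; have : dl * Kt e <= 16^-1.
  apply: le_trans dls; rewrite ler_pM2l// /kA; have := sqr_ge0 (Kt e); lra.
have := ler_wpM2l (ltW dl0) h; rewrite /rho /=; lra.
Qed.

Lemma contour_solved w0 : dl = eps `^ (1 + alpha) ->
  (forall x, Lz e v x = - EE e d eps dl (c0 / (2 * pi)) w0 v (x, 0)) ->
  contour_equation alpha d eps (rho dl v) (C_ alpha * (w0 + om v)).
Proof.
move=> dlE hL x _; have [h1 I1] := self_integral x; have [h2 I2] := mutual_integral x.
split; [exact: h1|exact: h2|].
rewrite /contour_lhs I1 I2 dv -dlE.
have r0 := rho_gt0 x; have P0 : 2 * pi != 0 :> R by rewrite mulf_neq0// gt_eqF// pi_gt0.
transitivity (C_ alpha / rho dl v x * (Lz e v x + EE e d eps dl (c0 / (2 * pi)) w0 v (x, 0))); last first.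
  by rewrite hL addNr mulr0.
rewrite /Lz /EE /E1 /E2 /E3 /=.
(* Eliminating f(x) in favour of the radius leaves a rational identity whose denominators dl, eps, r
   and P are known to be nonzero. *)
have -> : fv v x = (rho dl v x - 1) / dl by rewrite /rho; field; rewrite gt_eqF.
move: (rho dl v x) r0 => r r0.
move: (2 * pi) P0 => P P0.
by field; rewrite !(gt_eqF dl0) !(gt_eqF eps0) !(gt_eqF r0) P0.
Qed.

End ContourEquation.

(** * Termwise differentiation of the unknown *)

Section Differentiability.
Context {R : realType}.
Variables (e : R) (e0 : 0 < e) (e1 : e <= 1).
Local Notation Z := (Z e).
Local Notation Kt := (Kt e).

Lemma lipschitz_deriv (f g : R -> R) (K : R) : (forall x : R, is_derive x 1 f (g x)) ->
  (forall x, `|g x| <= K) -> forall x y : R, `|f y - f x| <= K * `|y - x|.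
Proof.
move=> df gK; have lt a b : a < b -> `|f b - f a| <= K * `|b - a|.
  move=> ab; have cf : {within `[a, b], continuous f}.
    apply: continuous_subspaceT => z; apply: differentiable_continuous.
    by apply/derivable1_diffP; have [] := df z.
  have [c _ ->] := MVT ab (fun z _ => df z) cf.
  by rewrite normrM ler_wpM2r.
move=> x y; have [xy|yx|->] := ltgtP x y; [exact: lt| |by rewrite !subrr normr0 mulr0].
by rewrite distrC (distrC y); exact: lt.
Qed.

Lemma fv_C1 M v : Z M v ->
  (forall x : R, is_derive x 1 (fv v) (gv v x)) /\ (forall x, {for x, continuous (gv v)}).
Proof.
elim=> {M v} [[n|] c M hM|m G H M hG IH mM GH].
- have cc (a : R) : continuous (fun x : R => a * x) by move=> x; apply: cvgMr; exact: cvg_id.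
  have ls (a x : R) : is_derive x 1 (fun x : R => a * x) a.
    by have := is_deriveZ a (is_derive_id x 1); rewrite /GRing.scale /= mulr1.
  split=> x.
    have h := @is_derive1_comp R cos (fun x => n.+2%:R * x) x _ _ (is_derive_cos _) (ls n.+2%:R x).
    rewrite (_ : gv _ x = c *: (- sin (n.+2%:R * x) * n.+2%:R)); first exact: (is_deriveZ c h).
    by rewrite /gv /GRing.scale /=; ring.
  apply: cvgMr; apply: cvgN; apply: cvgMr.
  by apply: continuous_comp; [exact: cc|exact: continuous_sin].
- split=> x; rewrite /fv /gv /= !mulr0; first exact: is_derive_cst.
  exact: cvg_cst.
have gb k x : `|gv (G k) x| <= Kt * m k by exact: (WA_bound (x, 0) (WA_gv e0 e1 (hG k))).
have sm : summ (fun k => Kt * m k) (Kt * M).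
  split=> k; first by apply: le_trans (gb k 0).
  by rewrite /series /= -mulr_sumr ler_wpM2l ?(ltW (Kt_gt0 e0 e1))//; exact: mM.
split=> x; last first.
  apply: (@tannery _ _ (nbhs x) _ (fun k t => gv (G k) t) (fun k => gv (G k) x) _ _ (gv H) (gv H x) sm) => //.
  - by move=> k; exact: (IH k).2.
  - by move=> t; exact: GH.
  - exact: GH.
(* By the mean value inequality the difference quotients have the same majorant as the derivatives,
   also at h = 0, where the inverse is 0 by convention. *)
have lim : (fun h : R => h^-1 *: (fv H (h *: 1 + x) - fv H x)) @ 0^' --> gv H x.
  apply: (@tannery _ _ (dnbhs (0 : R)) _ (fun k (h : R) => h^-1 *: (fv (G k) (h *: 1 + x) - fv (G k) x)) (fun k => gv (G k) x) _ _ (fun h : R => h^-1 *: (fv H (h *: 1 + x) - fv H x)) (gv H x) sm).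
  - move=> k h; have := lipschitz_deriv (IH k).1 (gb k) x (h *: 1 + x).
    rewrite addrK /GRing.scale /= mulr1 normrM normfV => lh.
    have [->|h0] := eqVneq h 0; first by rewrite normr0 invr0 mul0r (le_trans _ (gb k 0)).
    by rewrite ler_pdivrMl ?normr_gt0// mulrC.
  - move=> k; have [/= h1 h2] := (IH k).1 x.
    by have := h1; rewrite /derivable => /cvg_ex[l hl]; rewrite -h2 /derive; apply: (cvgP l).
  - move=> h; rewrite (_ : series _ = (fun n => h^-1 *: (series (fun k => fv (G k) (h *: 1 + x)) n - series (fun k => fv (G k) x) n))).
      apply: cvgZr; apply: cvgB; exact: GH.
    apply/funext => n; rewrite /series /= -sumrB scaler_sumr; by [].
  - exact: GH.
by split; [apply/cvg_ex; exists (gv H x)|exact: cvg_lim lim].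
Qed.
End Differentiability.

(** * The domain enclosed by an even polar curve *)

Section StarDomain.
Context {R : realType}.

Lemma cvg_pairR {T : Type} {F : set_system T} {FF : Filter F} (f g : T -> R) (a b : R) :
  f @ F --> a -> g @ F --> b -> (fun x => (f x, g x)) @ F --> (a, b).
Proof. by move=> fa gb; exact: (cvg_pair fa gb). Qed.

Lemma cos_decreasing (s t : R) : s \in `[0, pi] -> t \in `[0, pi] -> s <= t -> cos t <= cos s.
Proof. by move=> hs ht; rewrite le_eqVlt => /predU1P[->//|st]; apply/ltW; rewrite ltr_cos. Qed.

(** Strict monotonicity of cos on [0, pi] gives continuity up to the end values -1 and 1, where the
    derivative of acos blows up; these are the directions of the first axis. *)
Lemma acos_cvg (c0 ep : R) : -1 <= c0 <= 1 -> 0 < ep -> exists2 del : R, 0 < del &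
  forall c, -1 <= c <= 1 -> `|c0 - c| < del -> `|acos c0 - acos c| < ep.
Proof.
move=> h0 e0; have a0 := acos_ge0 h0; have ap := acos_lepi h0.
have c0E : cos (acos c0) = c0 by apply: acosK; rewrite in_itv.
have [d1 d10 h1] : exists2 d1 : R, 0 < d1 &
    forall c, -1 <= c <= 1 -> `|c0 - c| < d1 -> acos c < acos c0 + ep.
  have [lt|le] := ltP pi (acos c0 + ep).
    by exists 1 => // c hc _; apply: le_lt_trans lt; exact: acos_lepi.
  have I : acos c0 + ep \in `[0, pi] by rewrite in_itv /=; apply/andP; split; lra.
  have I0 : acos c0 \in `[0, pi] by rewrite in_itv /=; apply/andP; split; lra.
  exists (cos (acos c0) - cos (acos c0 + ep)).
    by rewrite subr_gt0 ltr_cos// ltrDl.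
  move=> c hc; rewrite c0E ltr_norml => /andP[_ hd].
  have Ic : acos c \in `[0, pi] by rewrite in_itv /= acos_ge0// acos_lepi.
  by rewrite ltNge; apply/negP => /(cos_decreasing I Ic); rewrite acosK ?in_itv//; lra.
have [d2 d20 h2] : exists2 d2 : R, 0 < d2 &
    forall c, -1 <= c <= 1 -> `|c0 - c| < d2 -> acos c0 - ep < acos c.
  have [lt|le] := ltP (acos c0 - ep) 0.
    by exists 1 => // c hc _; apply: (lt_le_trans lt); exact: acos_ge0.
  have I : acos c0 - ep \in `[0, pi] by rewrite in_itv /=; apply/andP; split; lra.
  have I0 : acos c0 \in `[0, pi] by rewrite in_itv /=; apply/andP; split; lra.
  exists (cos (acos c0 - ep) - cos (acos c0)).
    by rewrite subr_gt0 ltr_cos// gtrBl.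
  move=> c hc; rewrite c0E ltr_norml => /andP[hd _].
  have Ic : acos c \in `[0, pi] by rewrite in_itv /= acos_ge0// acos_lepi.
  by rewrite ltNge; apply/negP => /(cos_decreasing Ic I); rewrite acosK ?in_itv//; lra.
exists (Num.min d1 d2); first by rewrite lt_min d10.
move=> c hc; rewrite lt_min => /andP[l1 l2].
by rewrite ltr_norml; have := h1 c hc l1; have := h2 c hc l2; move=> ? ?; apply/andP; split; lra.
Qed.

Definition rad (z : R * R) : R := Num.sqrt (z.1 ^+ 2 + z.2 ^+ 2).

Lemma continuous_rad : continuous rad.
Proof.
move=> z; apply: continuous_comp; last exact: sqrt_continuous.
by apply: cvgD; apply: cvgM; [exact: cvg_fst|exact: cvg_fst|exact: cvg_snd|exact: cvg_snd].
Qed.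

Lemma rad_ge0 z : 0 <= rad z. Proof. exact: sqrtr_ge0. Qed.

Lemma rad_sqr z : rad z ^+ 2 = z.1 ^+ 2 + z.2 ^+ 2.
Proof. by rewrite sqr_sqrtr// addr_ge0// sqr_ge0. Qed.

Lemma rad_eq0 z : rad z = 0 -> z = (0, 0).
Proof.
move=> h; have := rad_sqr z; rewrite h expr0n /= => /esym/eqP.
by rewrite paddr_eq0 ?sqr_ge0// !sqrf_eq0; case: z {h} => x y /= /andP[/eqP-> /eqP->].
Qed.

Lemma radZ (l : R) z : 0 <= l -> rad (l * z.1, l * z.2) = l * rad z.
Proof.
move=> l0; rewrite /rad /= !exprMn -mulrDr sqrtrM ?sqr_ge0//.
by rewrite sqrtr_sqr ger0_norm.
Qed.

Lemma rad_le1 z : `|z.1| <= rad z.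
Proof.
rewrite -(@ler_pXn2r _ 2)// ?nnegrE ?rad_ge0//.
by rewrite real_normK ?num_real// rad_sqr lerDl sqr_ge0.
Qed.

Lemma rad_le2 z : `|z.2| <= rad z.
Proof.
rewrite -(@ler_pXn2r _ 2)// ?nnegrE ?rad_ge0//.
by rewrite real_normK ?num_real// rad_sqr lerDr sqr_ge0.
Qed.

Lemma radD z w : rad (z.1 + w.1, z.2 + w.2) <= rad z + rad w.
Proof.
have z0 := rad_ge0 z; have w0 := rad_ge0 w.
rewrite -(@ler_pXn2r _ 2)// ?nnegrE ?rad_ge0 ?addr_ge0//.
rewrite rad_sqr /= [leRHS]sqrrD !rad_sqr.
have cs : z.1 * w.1 + z.2 * w.2 <= rad z * rad w.
  apply: (le_trans (ler_norm _)).
  rewrite -(@ler_pXn2r _ 2)// ?nnegrE ?mulr_ge0//.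
  rewrite real_normK ?num_real// exprMn !rad_sqr -subr_ge0.
  rewrite (_ : _ - _ = (z.1 * w.2 - z.2 * w.1) ^+ 2) ?sqr_ge0//; ring.
rewrite !expr2; lra.
Qed.

Definition ang (z : R * R) : R := acos (z.1 / rad z).

Lemma ang_itv z : -1 <= z.1 / rad z <= 1.
Proof.
rewrite -ler_norml normrM normfV (ger0_norm (rad_ge0 z)).
have [->|h] := eqVneq (rad z) 0; first by rewrite invr0 mulr0.
by rewrite ler_pdivrMr ?mul1r ?rad_le1// lt0r h rad_ge0.
Qed.

Lemma continuous_ang z : rad z != 0 -> {for z, continuous ang}.
Proof.
move=> h; apply/cvgrPdist_lt => ep e0.
have [del d0 hd] := acos_cvg (ang_itv z) e0.
have cq : (fun w => w.1 / rad w) @ z --> z.1 / rad z.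
  by apply: cvgM; [exact: cvg_fst|apply: cvgV => //; exact: continuous_rad].
have /cvgrPdist_lt /(_ _ d0) := cq; apply: filterS => w hw.
by apply: hd hw; exact: ang_itv.
Qed.

Lemma angZ (l : R) z : 0 < l -> ang (l * z.1, l * z.2) = ang z.
Proof.
move=> l0; rewrite /ang radZ ?ltW//=; congr acos; rewrite -mulf_div divff ?mul1r//.
by rewrite gt_eqF.
Qed.

Lemma rad_cos z : rad z * cos (ang z) = z.1.
Proof.
rewrite acosK ?in_itv ?ang_itv//.
have [h|h] := eqVneq (rad z) 0; last by field.
by rewrite h (rad_eq0 h) mul0r.
Qed.

Lemma rad_sin z : rad z * sin (ang z) = `|z.2|.
Proof.
apply/eqP; rewrite -(@eqrXn2 _ 2)// ?mulr_ge0 ?rad_ge0//; last first.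
  by rewrite sin_ge0_pi// acos_ge0 ?acos_lepi ?ang_itv.
rewrite exprMn real_normK ?num_real//; have := cos2Dsin2 (ang z).
move=> h2; apply/eqP.
have -> : sin (ang z) ^+ 2 = 1 - cos (ang z) ^+ 2 by rewrite -h2; ring.
have e1 : rad z ^+ 2 * cos (ang z) ^+ 2 = z.1 ^+ 2 by rewrite -exprMn rad_cos.
by rewrite mulrBr e1 rad_sqr; ring.
Qed.

Lemma ang_polar (c : R) x : 0 < c -> ang (c * cos x, c * sin x) = acos (cos x).
Proof.
move=> c0; rewrite (angZ (cos x, sin x))// /ang /rad /=.
by rewrite cos2Dsin2 sqrtr1 divr1.
Qed.

Lemma rad_polar (c : R) x : 0 <= c -> rad (c * cos x, c * sin x) = c.
Proof. by move=> c0; rewrite (radZ (cos x, sin x))// /rad /= cos2Dsin2 sqrtr1 mulr1. Qed.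

Variables (r : R -> R) (a b : R).
Hypotheses (rc : continuous r) (rN : forall x, r (- x) = r x) (rp : periodic2pi r)
  (a0 : 0 < a) (ra : forall x, a <= r x) (rb : forall x, r x <= b).

Let r0 x : 0 < r x. Proof. exact: lt_le_trans (ra x). Qed.

Lemma even_acos_cos x : r (acos (cos x)) = r x.
Proof.
have [k /andP[k0 k1]] := mod2pi x; pose y := x - k%:~R * (2 * pi).
have -> : cos x = cos y by rewrite /y -mulNr -intrN cosD2piZ.
have -> : r x = r y by rewrite /y -mulNr -intrN periodic2piZ.
rewrite -/y in k0 k1; have [yp|py] := leP y pi; first by rewrite cosK// in_itv /= k0.
have -> : cos y = cos (2 * pi - y).
  by rewrite -cosN -[RHS](cosD2piZ _ (-1)); congr cos; rewrite mulrNz; ring.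
rewrite cosK ?in_itv /=; last by apply/andP; split; lra.
by rewrite -rN -rp; congr r; ring.
Qed.

Definition reach (z : R * R) : R := r (ang z).

Lemma continuous_reach z : rad z != 0 -> {for z, continuous reach}.
Proof. by move=> h; apply: continuous_comp; [exact: continuous_ang|exact: rc]. Qed.

(* The polar angle is only needed up to sign, as [r] is even; hence [acos]. *)
Definition star : set (R * R) := [set z | rad z < reach z].

Let near0 (z : R * R) : rad z < a -> star z.
Proof. by move=> h; exact: lt_le_trans h (ra _). Qed.

Lemma star0 : star (0, 0).
Proof. by apply: near0; rewrite /rad /= expr0n addr0 sqrtr0. Qed.

Lemma open_star : open star.
Proof.
rewrite openE => z hz; rewrite /interior.
have [h|h] := eqVneq (rad z) 0.
  have /cvgrPdist_lt /(_ _ a0) := @continuous_rad z; apply: filterS => w.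
  by rewrite h sub0r normrN (ger0_norm (rad_ge0 w)) => /near0.
have cs : (fun w => reach w - rad w) @ z --> reach z - rad z.
  by apply: cvgB; [exact: continuous_reach|exact: continuous_rad].
have p : 0 < reach z - rad z by rewrite subr_gt0.
have /cvgrPdist_lt /(_ _ p) := cs; apply: filterS => w.
by rewrite ltr_norml /star /= => /andP[_ ?]; lra.
Qed.

Lemma starZ (l : R) z : 0 <= l <= 1 -> star z -> star (l * z.1, l * z.2).
Proof.
move=> /andP[l0 l1] hz; have [->|lp] := eqVneq l 0; first by rewrite !mul0r; exact: star0.
have {}lp : 0 < l by rewrite lt0r lp.
rewrite /star /= radZ// /reach angZ//; apply: le_lt_trans hz.
by rewrite ler_piMl// rad_ge0.
Qed.

(** The closure adds exactly the points where [rad] equals [reach]: continuity excludes anything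
    beyond, and such a point z is the limit of l z, which lies inside for 0 < l < 1. *)
Lemma boundary_star : boundary star = [set polar_curve 1 r x | x in `[0, 2 * pi[].
Proof.
have ob := open_star; rewrite /boundary (_ : star° = star); last by apply/interior_id.
have cl : closure star = [set z | rad z <= reach z].
  apply/seteqP; split=> z /=.
    move=> hz; rewrite leNgt; apply/negP => lt.
    have rz : rad z != 0 by rewrite gt_eqF//; apply: lt_trans lt; exact: r0.
    have cs : (fun w => rad w - reach w) @ z --> rad z - reach z.
      by apply: cvgB; [exact: continuous_rad|exact: continuous_reach].
    have p : 0 < rad z - reach z by rewrite subr_gt0.
    have /cvgrPdist_lt /(_ _ p) nz := cs.
    have [w [sw]] := hz _ nz; move: sw; rewrite /star /= ltr_norml => sw /andP[_ ?]; lra.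
  move=> hz B nB.
  have cl : (fun l : R => (l * z.1, l * z.2)) @ (1 : R) --> (1 * z.1, 1 * z.2).
    by apply: cvg_pairR; apply: cvgMl; exact: cvg_id.
  have zE : (1 * z.1, 1 * z.2) = z by rewrite !mul1r; case: (z).
  rewrite -zE in nB.
  have nl : \forall l \near (1 : R)^'-, B (l * z.1, l * z.2).
    by apply: cvg_within; exact: cl _ nB.
  have [l [Bl l1 l0]] : exists l : R, [/\ B (l * z.1, l * z.2), l < 1 & 0 < l].
    apply: (@filter_ex _ (1 : R)^'-).
    near=> l; split; first by near: l.
      by near: l; exact: nbhs_left_lt.
    by near: l; exact: nbhs_left_gt.
  exists (l * z.1, l * z.2); split=> //.
  rewrite /star /= radZ ?(ltW l0)// /reach angZ//.
  apply: (le_lt_trans (ler_wpM2l (ltW l0) hz)).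
  by rewrite gtr_pMl// r0.
rewrite cl; apply/seteqP; split=> z /=.
  move=> [h1 /negP]; rewrite -leNgt => h2; have {h1 h2} h : rad z = reach z by apply/le_anti/andP.
  have ai : 0 <= ang z <= pi by rewrite acos_ge0 ?acos_lepi ?ang_itv.
  have pp := @pi_gt0 R.
  have [z2|z2] := leP 0 z.2.
    exists (ang z); first by rewrite /= in_itv /=; case/andP: ai => -> ?; lra.
    rewrite /polar_curve !mul1r -/(reach z) -h rad_cos rad_sin ger0_norm//.
    by case: (z).
  have az : 0 < ang z.
    rewrite lt0r; case/andP: ai => -> _; rewrite andbT; apply: contraTneq z2 => az.
    by have := rad_sin z; rewrite az sin0 mulr0 => /esym/eqP; rewrite normr_eq0 => /eqP ->; rewrite ltxx.
  (* [ang] does not see the sign of the second coordinate; in the lower half-plane the polar angle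
     in [0, 2 pi) is 2 pi - ang z, with the same radius since r is even and periodic. *)
  exists (2 * pi - ang z); first by rewrite /= in_itv /=; case/andP: ai => ? ?; apply/andP; split; lra.
  have e : 2 * pi - ang z = - ang z + 2 * pi by ring.
  rewrite /polar_curve !mul1r e rp rN -/(reach z) -h.
  have := cosD2piZ (- ang z) 1; rewrite mul1r => ->.
  have := cosD2piZ (- ang z - pi / 2) 1; rewrite mul1r addrAC !cosBpihalf => ->.
  rewrite cosN sinN mulrN rad_cos rad_sin ltr0_norm// opprK.
  by case: (z).
move=> [x _ <-]; rewrite /polar_curve !mul1r.
have h : rad (r x * cos x, r x * sin x) = reach (r x * cos x, r x * sin x).
  by rewrite rad_polar ?ltW// /reach ang_polar// even_acos_cos.
by split; [rewrite h|rewrite /star /= h ltxx].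
Unshelve. all: by end_near. Qed.

Lemma connected_star : connected star.
Proof.
pose seg (z : R * R) : set (R * R) := (fun l : R => (l * z.1, l * z.2)) @` `[0, 1].
have -> : star = \bigcup_(z in star) seg z.
  apply/seteqP; split=> [z hz|w [z hz [l hl <-]]].
    exists z => //; exists 1; first by rewrite /= in_itv /= lexx ler01.
    by rewrite !mul1r; case: (z).
  by apply: starZ => //; move: hl; rewrite /= in_itv.
apply: bigcup_connected.
  exists (0, 0) => z _; exists 0; first by rewrite /= in_itv /= lexx ler01.
  by rewrite !mul0r.
move=> z _; apply: connected_continuous_connected; first exact: segment_connected.
apply: continuous_subspaceT => l.
by apply: cvg_pairR; apply: cvgMl; exact: cvg_id.
Qed.

Let flat (z : R * R) : R * R := (z.1 / reach z, z.2 / reach z).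
Let bump (w : R * R) : R * R := (w.1 * reach w, w.2 * reach w).

Let reach_gt0 z : 0 < reach z. Proof. exact: r0. Qed.

Let reachZ l z : 0 < l -> reach (l * z.1, l * z.2) = reach z.
Proof. by move=> l0; rewrite /reach angZ. Qed.

Let flatK z : bump (flat z) = z.
Proof.
rewrite /bump /flat /=; have -> : reach (z.1 / reach z, z.2 / reach z) = reach z.
  by rewrite ![_ / _]mulrC reachZ// invr_gt0.
by rewrite !divfK ?gt_eqF ?reach_gt0//; case: (z).
Qed.

Let rad_flat z : star z -> rad (flat z) < 1.
Proof.
move=> hz; rewrite /flat ![_ / _]mulrC radZ ?invr_ge0 ?ltW//.
by rewrite ltr_pdivrMl ?mulr1.
Qed.

Let star_bump w : rad w < 1 -> star (bump w).
Proof.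
move=> hw; rewrite /star /= /bump ![_ * reach w]mulrC radZ ?ltW//.
by rewrite reachZ// gtr_pMr.
Qed.

(** The factor h depends on the direction and may have no limit at the origin; there its boundedness
    suffices, as it multiplies the coordinates of z. *)
Let continuous_scaled (h : R * R -> R) (K : R) : (forall z, `|h z| <= K) ->
  (forall z, rad z != 0 -> {for z, continuous h}) ->
  continuous (fun z : R * R => (z.1 * h z, z.2 * h z)).
Proof.
move=> hK ch z.
have [z0|zn] := eqVneq (rad z) 0; last first.
  by apply: cvg_pairR; apply: cvgM; [exact: cvg_fst|exact: ch|exact: cvg_snd|exact: ch].
have K0 : 0 <= K by apply: le_trans (hK z).
have sq (p : R * R -> R) : (forall w, `|p w| <= rad w) ->
    (fun w => p w * h w) @ z --> p z * h z.
  move=> hp; have -> : p z = 0 by apply/normr0_eq0/le_anti; rewrite normr_ge0 andbT -z0.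
  rewrite mul0r.
  have up : (fun w : R * R => K * rad w) @ z --> 0.
    have : (fun w : R * R => K * rad w) @ z --> K * rad z by apply: cvgMr; exact: continuous_rad.
    by rewrite z0 mulr0.
  have dn : (fun w : R * R => - (K * rad w)) @ z --> 0.
    by rewrite -[X in _ --> X]oppr0; exact: cvgN.
  apply: squeeze_cvgr dn up; apply: nearW => w; rewrite -ler_norml normrM mulrC.
  by apply: ler_pM.
by apply: cvg_pairR; apply: (sq _) => // w; [exact: rad_le1|exact: rad_le2].
Qed.

Let continuous_flat : continuous flat.
Proof.
apply: (@continuous_scaled (fun z => (reach z)^-1) a^-1) => z.
  by rewrite normfV gtr0_norm// lef_pV2 ?posrE//; exact: ra.
by move=> h; apply: cvgV; [rewrite gt_eqF|exact: continuous_reach].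
Qed.

Let continuous_bump : continuous bump.
Proof.
apply: (@continuous_scaled reach b) => z; first by rewrite gtr0_norm//; exact: rb.
exact: continuous_reach.
Qed.

(* A homeomorphism onto the unit disc turns [star] into a convex set, where the
   straight-line homotopy to the base point can be used. *)
Lemma null_homotopic_star (g : R -> R * R) : {within `[0, 1], continuous g} ->
  {in `[0, 1], forall t, star (g t)} -> g 0 = g 1 -> null_homotopic star g.
Proof.
(* Clamping the parameter to [0, 1] turns g, continuous on the segment only, into a loop continuous
   on the whole line. *)
move=> cg sg g01; pose cl (t : R) : R := Num.max 0 (Num.min 1 t).
have clI t : cl t \in `[0, 1].
  by rewrite in_itv /= /cl le_max lexx /= ge_max ler01 ge_min lexx.
have clE t : t \in `[0, 1] -> cl t = t.
  by rewrite in_itv /= => /andP[t0 t1]; rewrite /cl min_r// max_r.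
have ccl : continuous cl.
  move=> t; have c0 (c : R) : {for t, continuous (fun _ : R => c : R^o)} by exact: cvg_cst.
  have ci : {for t, continuous (fun t : R => t : R^o)} by exact: cvg_id.
  exact: (continuous_max (c0 0) (continuous_min (c0 1) ci)).
have cgc : continuous (g \o cl).
  move=> t P /= hP; have := (subspace_continuousP _ _).1 cg (cl t) (clI t) P hP.
  rewrite /within /= => hw.
  have k := ccl t _ hw; change (nbhs t (fun y => P (g (cl y)))).
  apply: (@filterS _ (nbhs t) (nbhs_filter t) _ _ _ k) => y h; exact: h (clI y).
pose H (p : R * R) := bump ((1 - p.1) * (flat (g (cl p.2))).1 + p.1 * (flat (g 0)).1,
   (1 - p.1) * (flat (g (cl p.2))).2 + p.1 * (flat (g 0)).2).
have H0 (t : R) : t \in `[0, 1] -> H (0, t) = g t.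
  move=> ht; rewrite /H /= !subr0 !mul1r !mul0r !addr0 clE// -[RHS]flatK.
  by congr bump; rewrite -surjective_pairing.
have Hc s w : g w = g 0 -> cl w = w -> H (s, w) = g 0.
  move=> gw cw; rewrite /H /= cw gw -[RHS]flatK; congr bump.
  by rewrite -!mulrDl !subrK !mul1r.
have I0 : (0 : R) \in `[0, 1] by rewrite in_itv /= lexx ler01.
have I1 : (1 : R) \in `[0, 1] by rewrite in_itv /= lexx ler01.
exists H; split.
- apply: continuous_subspaceT => p.
  apply: (@continuous_comp _ _ _ _ bump); last exact: continuous_bump.
  have c1 : (fun p : R * R => 1 - p.1) @ p --> 1 - p.1 by apply: cvgB; [exact: cvg_cst|exact: cvg_fst].
  have cf : (fun p : R * R => flat (g (cl p.2))) @ p --> flat (g (cl p.2)).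
    apply: (@continuous_comp _ _ _ (fun p : R * R => g (cl p.2)) flat); last exact: continuous_flat.
    apply: (@continuous_comp _ _ _ snd (g \o cl)); [exact: cvg_snd|exact: cgc].
  apply: cvg_pairR; apply: cvgD.
  + by apply: cvgM => //; exact: (cvg_comp _ _ cf cvg_fst).
  + by apply: cvgMl; exact: cvg_fst.
  + by apply: cvgM => //; exact: (cvg_comp _ _ cf cvg_snd).
  + by apply: cvgMl; exact: cvg_fst.
- move=> s t; rewrite in_itv /= => /andP[s0 s1] ht; apply: star_bump.
  set u := flat _; set w := flat (g 0).
  have hu : rad u < 1 by apply: rad_flat; exact: sg.
  have hw : rad w < 1 by apply: rad_flat; exact: sg.
  apply: (le_lt_trans (radD ((1 - s) * u.1, (1 - s) * u.2) (s * w.1, s * w.2))).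
  rewrite !radZ ?subr_ge0//.
  have [->|sn] := eqVneq s 0; first by rewrite subr0 mul1r mul0r addr0.
  have : s * rad w < s * 1 by rewrite ltr_pM2l// lt0r sn.
  have : (1 - s) * rad u <= (1 - s) * 1 by rewrite ler_wpM2l ?subr_ge0// ltW.
  lra.
- exact: H0.
- move=> t ht; rewrite /H /= subrr !mul0r !mul1r !add0r -[RHS]flatK.
  by congr bump; rewrite -surjective_pairing.
- by move=> s hs; split; apply: Hc => //; exact: clE.
Qed.

Lemma simply_connected_star : simply_connected_domain star.
Proof.
split; [exact: open_star|by exists (0, 0); exact: star0|exact: connected_star|].
exact: null_homotopic_star.
Qed.

End StarDomain.

(** * Smallness of eps and existence of the solution *)

Section Existence.
Context {R : realType}.
Variables (alpha d : R).
Hypotheses (alpha_ge1 : 1 <= alpha) (alpha_lt2 : alpha < 2) (d1 : 1 < d).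
Local Notation e := (2 - alpha).

Let e0 : 0 < e. Proof. by rewrite subr_gt0. Qed.
Let e1 : e <= 1. Proof. by have := alpha_ge1; lra. Qed.
Let aE : 2 - e = alpha. Proof. by ring. Qed.
Let d0 : 0 < d. Proof. exact: lt_trans d1. Qed.

Definition cc0 : R := (2 * d) `^ (- (2 - e)) / (2 * pi).
Definition ww0 : R := alpha / (2 * (2 * d) `^ (1 + alpha)).
(** One summand per smallness condition, so that eps cB < 1 yields them all: 16 for the two radii of
    the binomial series, the others for the contraction factor and the first iterate to be at most
    1/2. Absolute values avoid any discussion of signs. *)
Definition cB : R := 1 + 16 * `|kA e| + 16 * `|kT e| + 4 * pi * `|kE e0 e1 cc0 ww0| +
  2 * pi * `|c2 e d cc0| + 4 * pi * `|kE0 e cc0|.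
Definition cO : R := 2 * pi * (`|kE0 e cc0| + `|kE e0 e1 cc0 ww0|).

(** The value of [w0] that cancels the sin x term of order 1 is $W_\alpha^*/C_\alpha$; this
    identifies the limiting speed. *)
Let ww0E : ww0 = cc0 * ((1 - e / 2) * pi / d).
Proof.
have D : 0 < 2 * d by rewrite mulr_gt0.
rewrite /ww0 /cc0 aE powRD; last by rewrite (gt_eqF D) implybT.
rewrite powRr1 ?(ltW D)// powRN; have P := powR_gt0 alpha D.
move: (_ `^ _) P => P P0; move: (pi : R) (@pi_gt0 R) => p p0.
by field; rewrite !gt_eqF.
Qed.

Let pi0 : 0 < pi :> R. Proof. exact: pi_gt0. Qed.

Let powR_small (x p : R) : 0 < x <= 1 -> 0 <= p -> x `^ p <= 1.
Proof.
move=> /andP[x0 x1] p0.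
have := @ge0_ler_powR R p p0 x 1; rewrite powR1; apply=> //; by rewrite nnegrE ltW.
Qed.

Lemma cB_gt0 : 0 < cB.
Proof.
have pn (x : R) : 0 <= pi * `|x| by rewrite mulr_ge0// ltW.
have := pn (kE e0 e1 cc0 ww0); have := pn (c2 e d cc0); have := pn (kE0 e cc0).
have := normr_ge0 (kA e); have := normr_ge0 (kT e); rewrite /cB; lra.
Qed.

Lemma existence (eps : R) : 0 < eps -> eps < cB^-1 -> exists v,
  [/\ Z e 1 v, `|om v| <= cO * eps `^ alpha,
      forall x, 2^-1 <= rho (eps `^ (1 + alpha)) v x <= 2 &
      contour_equation alpha d eps (rho (eps `^ (1 + alpha)) v) (C_ alpha * (ww0 + om v))].
Proof.
move=> eps0 epsB; set dl := eps `^ (1 + alpha).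
pose nA := `|kA e|; pose nT := `|kT e|; pose nE := pi * `|kE e0 e1 cc0 ww0|.
pose n2 := pi * `|c2 e d cc0|; pose n0 := pi * `|kE0 e cc0|.
have [A0 T0 E0 C0 Z0] : [/\ 0 <= nA, 0 <= nT, 0 <= nE, 0 <= n2 & 0 <= n0].
  by rewrite /nA /nT /nE /n2 /n0; split=> //; rewrite mulr_ge0// ltW.
have BE : cB = 1 + 16 * nA + 16 * nT + 4 * nE + 2 * n2 + 4 * n0.
  by rewrite /cB /nE /n2 /n0 !mulrA.
have B0 := cB_gt0.
have eB : eps * (1 + 16 * nA + 16 * nT + 4 * nE + 2 * n2 + 4 * n0) < 1.
  by rewrite -BE -ltr_pdivlMr// div1r.
have [pA pT pE p2 p0] : [/\ 0 <= eps * nA, 0 <= eps * nT, 0 <= eps * nE, 0 <= eps * n2 & 0 <= eps * n0].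
  by split; rewrite mulr_ge0// ltW.
have eps1 : eps <= 1 by lra.
have e01 : 0 < eps <= 1 by rewrite eps0.
have dlE : dl = eps * eps `^ alpha.
  by rewrite /dl powRD ?(gt_eqF eps0) ?implybT// powRr1// ltW.
have ea0 : 0 < eps `^ alpha by exact: powR_gt0.
have ea1 : eps `^ alpha <= eps.
  rewrite -[X in _ `^ X <= _](subrK 1 alpha) addrC powRD ?(gt_eqF eps0) ?implybT//.
  by rewrite powRr1 ?(ltW eps0)// ler_piMr ?(ltW eps0)// powR_small// subr_ge0.
have dl0 : 0 < dl by exact: powR_gt0.
have dl1 : dl <= eps by rewrite dlE ler_piMr ?(ltW eps0)//; exact: le_trans eps1.
have dle : dl / eps = eps `^ alpha by rewrite dlE; field; rewrite gt_eqF.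
have dls : dl * kA e <= 16^-1.
  have : dl * kA e <= eps * nA.
    by apply: (le_trans (ler_wpM2l (ltW dl0) (ler_norm _))); rewrite ler_wpM2r.
  lra.
have epsT : eps * kT e <= 16^-1.
  have : eps * kT e <= eps * nT by rewrite ler_wpM2l ?(ltW eps0)// ler_norm.
  lra.
have thb : 2 * pi * (dl / eps * kE e0 e1 cc0 ww0) <= 2 * (eps `^ alpha * nE).
  rewrite dle /nE (_ : 2 * (_ * (pi * _)) = 2 * pi * (eps `^ alpha * `|kE e0 e1 cc0 ww0|)); last by ring.
  by rewrite ler_pM2l ?mulr_gt0// ler_pM2l// ler_norm.
have th2 : 2 * pi * (dl / eps * kE e0 e1 cc0 ww0) <= 2^-1.
  by apply: (le_trans thb); have := ler_wpM2r E0 ea1; lra.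
(* Since alpha <= 2 and eps <= 1, the O(eps^2) part of omega is within the announced
   O(eps^alpha). *)
have e2 : eps ^+ 2 <= eps `^ alpha.
  rewrite -powR_mulrn ?(ltW eps0)// -[X in _ `^ X <= _](subrK alpha) powRD ?(gt_eqF eps0) ?implybT//.
  by rewrite ler_piMl ?(ltW ea0)// powR_small// ltW.
have m0b : 2 * pi * (eps ^+ 2 * kE0 e cc0) <= 2 * (eps `^ alpha * n0).
  rewrite /n0 (_ : 2 * (_ * (pi * _)) = 2 * pi * (eps `^ alpha * `|kE0 e cc0|)); last by ring.
  rewrite ler_pM2l ?mulr_gt0//; apply: (le_trans (ler_wpM2l (sqr_ge0 _) (ler_norm _))).
  by rewrite ler_wpM2r.
have m02 : pi * (eps * `|c2 e d cc0|) + 2 * pi * (eps ^+ 2 * kE0 e cc0) <= 2^-1.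
  rewrite (_ : pi * _ = eps * n2); last by rewrite /n2; ring.
  by have := ler_wpM2r Z0 ea1; lra.
have [v [hv Lv ov]] := fixed_point dl0 dl1 dls eps0 eps1 d1 epsT ww0E th2 m02.
exists v; split=> //.
- apply: (le_trans ov); apply: (le_trans (lerD m0b thb)).
  by rewrite le_eqVlt; apply/orP; left; apply/eqP; rewrite /cO /n0 /nE; ring.
- move=> x; have := WA_bound (x, 0) (WA_fv e0 e1 hv); rewrite mulr1 ler_norml => /andP[h1 h2].
  have K0 := Kt_gt0 e0 e1; have : dl * Kt e <= 16^-1.
    apply: le_trans dls; rewrite ler_pM2l// /kA; have := sqr_ge0 (Kt e); lra.
  have := ler_wpM2l (ltW dl0) h1; have := ler_wpM2l (ltW dl0) h2.
  by rewrite /rho /= => *; apply/andP; split; lra.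
have dv x : derive1 (rho dl v) x = dl * gv v x.
  have h := (fv_C1 e0 e1 hv).1 x.
  have := is_deriveD (is_derive_cst (1 : R) x 1) (is_deriveZ dl h).
  rewrite derive1E => -[_ E]; transitivity (0 + dl *: gv v x); first exact: E.
  by rewrite add0r.
have := contour_solved e0 e1 dl0 dl1 dls eps0 eps1 d1 epsT hv dv.
rewrite aE => h; apply: h => // x.
by rewrite Lv /cc0 aE.
Qed.

End Existence.

Theorem theorem1p2 (R : realType) (alpha d : R)
    (alpha_ge1 : 1 <= alpha) (alpha_lt2 : alpha < 2) (d_gt1 : 1 < d) :
  exists (eps0 : R) (W : R -> R) (f : R -> R -> R) (D : R -> set (R * R))
    (theta : R -> R * R -> R -> R),
  [/\ 0 < eps0,
      forall eps : R, 0 < eps -> eps < eps0 ->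
        [/\ C1 (f eps),
            periodic (f eps) (2 * pi),
            simply_connected_domain (D eps),
            D eps (0, 0) &
            travelling_patch_solution alpha d eps (W eps)
              (fun x => 1 + eps `^ (1 + alpha) * f eps x)
              (D eps) (theta eps)],
      exists M : R, forall eps x : R, 0 < eps -> eps < eps0 ->
        `|f eps x| <= M /\ `|derive1 (f eps) x| <= M &
      W = (fun=> alpha * C_ alpha / (2 * (2 * d) `^ (1 + alpha)))
          +O_ (0^'+) (fun eps => eps `^ alpha)].
Proof.
have e0 : 0 < 2 - alpha by rewrite subr_gt0.
have e1 : 2 - alpha <= 1 by lra.
pose B := (cB d alpha_ge1 alpha_lt2)^-1.
have /choice [V hV] : forall eps : R, exists v, 0 < eps < B ->
    [/\ Z (2 - alpha) 1 v, `|om v| <= cO d alpha_ge1 alpha_lt2 * eps `^ alpha,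
      forall x, 2^-1 <= rho (eps `^ (1 + alpha)) v x <= 2 &
      contour_equation alpha d eps (rho (eps `^ (1 + alpha)) v) (C_ alpha * (ww0 alpha d + om v))].
  move=> eps; have [/andP[h1 h2]|h] := boolP (0 < eps < B); last by exists (fun=> 0).
  by have [v hv] := @existence _ _ _ alpha_ge1 alpha_lt2 d_gt1 _ h1 h2; exists v.
have B0 : 0 < B by rewrite invr_gt0 cB_gt0.
have CV (eps : R) : 0 < eps < B -> [/\ forall x, derive1 (fv (V eps)) x = gv (V eps) x,
    forall x : R, derivable (fv (V eps)) x 1 & continuous (gv (V eps))].
  move=> /hV [hv _ _ _]; have [h1 h2] := fv_C1 e0 e1 hv.
  by split=> // x; rewrite derive1E; have [] := h1 x.
pose W (eps : R) := C_ alpha * (ww0 alpha d + om (V eps)).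
(* The factor eps is put into the radius, so the boundary comes out as a polar curve of scale 1 and
   is rescaled at the end. *)
pose D (eps : R) := star (fun x => eps * rho (eps `^ (1 + alpha)) (V eps) x).
exists B, W, (fun eps => fv (V eps)), D,
  (fun eps x t => patch_pair d eps (D eps) (x - (0, t * W eps))).
split=> //.
- move=> eps h1 h2; have h12 : 0 < eps < B by rewrite h1.
  have [gE dV cV] := CV _ h12; have [hv _ hr hc] := hV _ h12.
  have rc : continuous (fun x => eps * rho (eps `^ (1 + alpha)) (V eps) x).
    move=> x; apply: cvgMr; apply: cvgD; first exact: cvg_cst.
    apply: cvgMr; apply: differentiable_continuous; exact/derivable1_diffP/dV.
  have rN x : eps * rho (eps `^ (1 + alpha)) (V eps) (- x) = eps * rho (eps `^ (1 + alpha)) (V eps) x.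
    by rewrite /rho (fv_even _ hv).
  have rp : periodic2pi (fun x => eps * rho (eps `^ (1 + alpha)) (V eps) x).
    by move=> x; rewrite /rho (fv_periodic e0 e1 hv).
  have a0 : 0 < eps / 2 by rewrite divr_gt0.
  have ra x : eps / 2 <= eps * rho (eps `^ (1 + alpha)) (V eps) x.
    by rewrite ler_pM2l//; case/andP: (hr x).
  have rb x : eps * rho (eps `^ (1 + alpha)) (V eps) x <= eps * 2.
    by rewrite ler_pM2l//; case/andP: (hr x).
  split.
  + split; first exact: dV.
    by rewrite (_ : derive1 _ = gv (V eps)) //; exact/funext.
  + exact: (fv_periodic e0 e1 hv).
  + exact: (simply_connected_star rc a0 ra rb).
  + exact: (star0 a0 ra).
  + split=> //; split.
      move=> x; apply: lt_le_trans (_ : 2^-1 <= _); first by rewrite invr_gt0.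
      by case/andP: (hr x).
    rewrite (boundary_star rc rN rp a0 ra).
    by congr image; apply/funext => x; rewrite /polar_curve !mul1r.
- exists (Kt (2 - alpha)) => eps x h1 h2; have h12 : 0 < eps < B by rewrite h1.
  have [gE _ _] := CV _ h12; have [hv _ _ _] := hV _ h12.
  have := WA_bound (x, 0) (WA_fv e0 e1 hv); have := WA_bound (x, 0) (WA_gv e0 e1 hv).
  by rewrite mulr1 gE.
(* The summand 1 ensures that the constant of the O is positive. *)
apply/eqaddOP/bigO_exP; exists (`|C_ alpha| * `|cO d alpha_ge1 alpha_lt2| + 1).
  by rewrite ltr_wpDl// mulr_ge0.
near=> eps.
have h12 : 0 < eps < B.
  by apply/andP; split; near: eps; [exact: nbhs_right_gt|exact: nbhs_right_lt].
have [_ ho _ _] := hV _ h12.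
rewrite [X in `|X|](_ : _ = C_ alpha * om (V eps)); last first.
  transitivity (W eps - alpha * C_ alpha / (2 * (2 * d) `^ (1 + alpha))); first by [].
  by rewrite /W /ww0; ring.
have p0 := powR_ge0 eps alpha.
rewrite (ger0_norm p0) normrM mulrDl mul1r ler_wpDr// -mulrA ler_wpM2l//.
by apply: (le_trans ho); rewrite ler_wpM2r// ler_norm.
Unshelve. all: by end_near. Qed.
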